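(* For any prime $p>3$ with $p\equiv 3\pmod 4$, we have $$\left|x+\left(\frac{j+k}{p}\right)+\left(\frac{j-k}{p}\right)+\left(\frac{j}{p}\right)y\right|_{1\le j,k\le (p-1)/2}=(-1)^{(h(-p)-1)/2}\,p^{(p-3)/4}\left(1-c_px-\frac{p-1}{2}y\right)$$ and $$\left|\left(\frac{j+k}{p}\right)+\left(\frac{j-k}{p}\right)+\left(\frac{j}{p}\right)y+\left(\frac{jk}{p}\right)w\right|_{1\le j,k\le (p-1)/2}=(-1)^{(h(-p)-1)/2}\,p^{(p-3)/4}\left(1-c_pw-\frac{p-1}{2}y\right),$$ where $c_p=\left(2-\left(\frac{2}{p}\right)\right)h(-p)$.
   Context: $\left(\frac{a}{p}\right)$ with $a\in\mathbb{Z}$ denotes the Legendre symbol modulo $p$ (with value $0$ when $p\mid a$). $|a_{jk}|_{1\le j,k\le n}$ denotes the determinant of the matrix $[a_{jk}]_{1\le j,k\le n}$. $h(-p)$ denotes the class number of the imaginary quadratic field $\mathbb{Q}(\sqrt{-p})$. Here $x,y,w$ are indeterminates (equivalently, arbitrary complex numbers). *)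

(* Defs.v *)
From mathcomp Require Import all_boot all_order all_algebra all_field.
From mathcomp Require Import finmap.
From mathcomp Require Import boolp classical_sets functions cardinality.

Set Implicit Arguments.
Unset Strict Implicit.
Unset Printing Implicit Defensive.

Import GRing.Theory Num.Theory.
Local Open Scope ring_scope.

Definition legendre (a : int) (p : nat) : int :=
  if (p %| a)%Z then 0
  else if [exists x : 'I_p, (x%:Z ^+ 2 == a %[mod p])%Z] then 1 else -1.

Local Open Scope classical_set_scope.

Definition quadratic_field (d : int) : set algC :=
  [set z | exists a b : rat, z = ratr a + ratr b * sqrtC d%:~R].

Definition ring_of_integers (K : set algC) : set algC :=
  K `&` [set z | z \in Aint].

(* Closure under opposites follows from absorption, since -1 \in O. *)
Definition nonzero_ideal (O : set algC) (I : set algC) : Prop :=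
  [/\ I `<=` O,
      exists2 x, I x & x != 0,
      forall x y, I x -> I y -> I (x + y)
    & forall a x, O a -> I x -> I (a * x)].

Definition ideal_equiv (O : set algC) (I J : set algC) : Prop :=
  exists a b : algC,
    [/\ O a, O b, a != 0, b != 0
      & [set a * x | x in I] = [set b * y | y in J]].

Definition ideal_class (O : set algC) (I : set algC) : set (set algC) :=
  [set J | nonzero_ideal O J /\ ideal_equiv O I J].

Definition ideal_classes (O : set algC) : set (set (set algC)) :=
  [set ideal_class O I | I in nonzero_ideal O].

(* [fset_set] sends an infinite set to the empty one, so this is 0 if there
   are infinitely many classes, which does not happen for a number field. *)
Definition class_number (K : set algC) : nat :=
  #|` fset_set (ideal_classes (ring_of_integers K))|%fset.

(* Main.v *)
Require Import Defs.
From mathcomp Require Import all_boot all_order all_fingroup all_algebra all_field.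
From mathcomp Require Import finmap.
From mathcomp Require Import boolp classical_sets functions cardinality.
From mathcomp Require Import zify ring lra.

Set Implicit Arguments.
Unset Strict Implicit.
Unset Printing Implicit Defensive.
Import Order.TTheory GRing.Theory Num.Theory.
Local Open Scope ring_scope.

(** Let n = (p - 1) / 2, let A be the matrix of chi (j + k) + chi (j - k), with chi
    the Legendre symbol, and l the row of the chi (k).  Since j + k and j - k cover
    the residues once, except for j, and since chi is odd because p = 3 modulo 4,
    one finds A 1 = - l^T and l A = - 1^T.  Both matrices of the theorem are
    therefore A times a rank-one perturbation of the identity, and their
    determinants are det A times a scalar in which l 1 = S, the sum of chi over
    1, ..., n, and l l^T = n appear ([det_affine_x], [det_affine_w]).  The
    autocorrelation of chi gives A^T A = p I - 2 J, with J the matrix of ones, so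
    (det A)^2 = p^(n - 1).  The sign of det A is found modulo 4: A is even off the
    diagonal, so det A is a product of signs, and a product of signs is determined
    modulo 4 by their sum ([det_sd_mx]).  What remains is Dirichlet's formula
    (2 - chi 2) h = S for the class number h.

    An elementary rearrangement ([double_half_sum]) reduces it to p h = C, where C
    is the sum of the partial sums of chi over one period.  Let O = Z + omega Z be
    the ring of integers, omega = (1 + sqrt (-p)) / 2.  Every ideal is
    d (a Z + (x + omega) Z) for unique d, a and x modulo a, with a dividing the norm
    of x + omega ([ideal_normal_form], [lattice_inj]).  The ideals of norm m are thus
    counted by roots of a quadratic polynomial modulo integers; the Gauss periods
    tell for which primes it has roots, and the count is the sum of chi over the
    divisors of m ([root_mod_prime], [ideal_countE]).  On the other hand a class has
    a binary quadratic form of discriminant -p, and the representations of m by it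
    correspond two to one, the units being 1 and -1, to the ideals of norm m in the
    class ([reps_form]).  Hence the sum of the theta series of the h classes is
    h + 2 (sum over m of (sum of chi over the divisors of m) q^m).

    The formula p h = C follows when q tends to 1 ([constant_term]).  For the theta
    series of a form, 4 theta (q^4) - theta (q) is a sum of alternating sums of a
    slowly varying function and tends to 0 ([theta_dilation]).  In the Lambert series
    of chi the same combination replaces z / (1 - z) by - (z / (1 + z) + 2 z^2 / (1 + z^2)),
    which is bounded, and Abel summation yields - (1/2 + 1) C / p ([lambert_combination],
    [periodic_abel]).  So 0 = 3 h - 3 C / p.  All this is done with finite sums, at
    q = 1 / (1 + 1 / N^2), where the vectors that matter have size about N; explicit
    error bounds replace the limits. *)

(** * Rank-one perturbations and determinants modulo 4 *)

(** The factor [a] on the left keeps the identity true over a ring in which [a]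
    is not invertible; it comes from a Schur complement computation. *)
Lemma det_scalar_sub_rank1 (R : comNzRingType) n (a : R) (u : 'cV[R]_n) (v : 'rV[R]_n) :
  a * \det (a%:M - u *m v) = a ^+ n * (a - (v *m u) 0 0).
Proof.
have E : block_mx 1%:M 0 (- v) a%:M *m
           (block_mx 1%:M u 0 1%:M *m block_mx (a%:M - u *m v) 0 v (1%:M : 'M_1)) =
         block_mx a%:M u 0 (a%:M - v *m u).
  rewrite !mulmx_block !(mul1mx, mul0mx, mulmx0, mulmx1, addr0, add0r).
  rewrite subrK mulNmx mul_mx_scalar mul_scalar_mx addNr.
  by rewrite mulNmx [X in block_mx _ _ _ X]addrC.
have := congr1 determinant E.
rewrite !det_mulmx !det_lblock !det_ublock !det1 !mul1r !mulr1 !det_scalar expr1 => ->.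
by rewrite det_mx11 !mxE mulr1n.
Qed.

Lemma det_1_sub_rank1 (R : comNzRingType) n (u : 'cV[R]_n) (v : 'rV[R]_n) :
  \det (1%:M - u *m v) = 1 - (v *m u) 0 0.
Proof. by have := det_scalar_sub_rank1 1 u v; rewrite expr1n !mul1r. Qed.

(** A nontrivial permutation moves at least two indices, so its term contains two
    even entries. *)
Lemma det_diag_mod4 n (A : 'M[int]_n) :
  (forall i j, i != j -> (2 %| A i j)%Z) ->
  (\det A = \prod_i A i i %[mod 4])%Z.
Proof.
move=> HA; apply/eqP; rewrite eqz_mod_dvd /determinant (bigD1 1%g) //=.
rewrite odd_perm1 expr0 mul1r.
under eq_bigr do rewrite perm1.
rewrite addrAC subrr add0r.
apply: rpred_sum => s sn1.
apply: dvdz_mull.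
have [i Hi] : exists i, s i != i.
  apply/existsP; apply: contraNT sn1; rewrite negb_exists => /forallP H.
  by apply/eqP/permP => i; rewrite perm1; apply/eqP/negPn/H.
rewrite (bigD1 i) //= (bigD1 (s i)) //=.
rewrite mulrA; apply: dvdz_mulr.
apply: (@dvdz_mul 2 2); apply: HA; first by rewrite eq_sym.
by rewrite eq_sym (inj_eq perm_inj).
Qed.

Lemma signr_mod4 (m : nat) : exists k : int, (-1) ^+ m = 2 * m%:Z + 1 + 4 * k :> int.
Proof.
rewrite -signr_odd; exists (- (odd m)%:Z - (m./2)%:Z).
by have := odd_double_half m; case: (odd m) => /=; rewrite ?expr1 ?expr0; lia.
Qed.

(** Changing one sign alters both sides by 2 modulo 4. *)
Lemma sum_signs_mod4 n (e : 'I_n -> int) :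
  (forall i, e i = 1 \/ e i = -1) ->
  (\sum_i e i = \prod_i e i + n%:Z - 1 %[mod 4])%Z.
Proof.
elim: n e => [|n IH] e He; first by rewrite !big_ord0.
have /eqP := IH (fun i => e (widen_ord (leqnSn n) i)) (fun i => He _).
rewrite !big_ord_recr /=; set s := \sum_(_ < n) _; set q := \prod_(_ < n) _.
have Hq : q = 1 \/ q = -1.
  rewrite /q; elim/big_ind: _ => [|x y [->|->] [->|->]|i _]; try by [left|right].
  exact: He.
rewrite !eqz_mod_dvd => H; apply/eqP; rewrite eqz_mod_dvd.
case: (He ord_max) Hq => -> [] Eq; rewrite Eq in H *; lia.
Qed.

(** * The quadratic character and its matrix of sums and differences *)

Definition chi (p : nat) (x : 'F_p) : int :=
  if x == 0 then 0 else if [exists y : 'F_p, y ^+ 2 == x] then 1 else -1.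

Lemma dvdz_Fp (p : nat) (a : int) : prime p -> (p %| a)%Z = (a%:~R == 0 :> 'F_p).
Proof. by move=> p_pr; rewrite (dvdz_pcharf (pchar_Fp p_pr)). Qed.

Lemma ltn_Fp (p : nat) (y : 'F_p) : prime p -> (val y < p)%N.
Proof. by move=> pp; rewrite -[X in (_ < X)%N](Fp_cast pp) ltn_ord. Qed.

(** Passing to the field ['F_p] makes the character theory an argument about
    polynomials and sums over a field. *)
Lemma legendreE (p : nat) (a : int) : prime p -> legendre a p = chi (a%:~R : 'F_p).
Proof.
move=> p_pr; rewrite /legendre /chi -dvdz_Fp //; case: ifP => // _.
congr (if _ then _ else _); apply/existsP/existsP => [[x]|[y /eqP Hy]].
  rewrite eqz_mod_dvd dvdz_Fp // rmorphB rmorphXn /= subr_eq0 => H.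
  by exists (x%:R); rewrite -(eqP H) -pmulrn.
exists (Ordinal (ltn_Fp y p_pr)).
rewrite eqz_mod_dvd dvdz_Fp // rmorphB rmorphXn /= subr_eq0 -Hy -pmulrn.
by rewrite natr_Zp.
Qed.

Section OddPrime.
Variables (p n : nat).
Hypotheses (p_pr : prime p) (p_gt3 : (3 < p)%N) (pE : p = (2 * n).+1).

Lemma Fp_nat_eq0 (i : nat) : (i%:R == 0 :> 'F_p) = (p %| i)%N.
Proof. by rewrite -(dvdn_pcharf (pchar_Fp p_pr)). Qed.

Lemma chi_range (x : 'F_p) : [/\ -1 <= chi x, chi x <= 1 & (chi x == 0) = (x == 0)].
Proof. by rewrite /chi; case: (x == 0) => //; case: ifP. Qed.

(** Since p > 3, a value in {-1, 0, 1} is determined by its residue; this turns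
    Euler's criterion into identities between integers. *)
Lemma small_int_Fp_inj (a b : int) : -1 <= a <= 1 -> -1 <= b <= 1 ->
  a%:~R = b%:~R :> 'F_p -> a = b.
Proof.
move=> Ha Hb /eqP; rewrite -subr_eq0 -rmorphB /= -dvdz_Fp // => /dvdzP [q Hq].
have : q = 0 by nia.
by move=> q0; rewrite q0 mul0r in Hq; lia.
Qed.

Lemma Fp_expn_sq (x : 'F_p) : x != 0 -> (x ^+ n) ^+ 2 = 1.
Proof.
move=> x0; apply: (mulfI x0); rewrite -exprM mulnC -exprS -pE mulr1.
by have := expf_card x; rewrite card_Fp.
Qed.

Lemma half_lt_neq0 i : (i < n)%N -> (i.+1%:R != 0 :> 'F_p).
Proof. by move=> Hi; rewrite Fp_nat_eq0; apply/negP => /dvdn_leq H; have := H isT; lia. Qed.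

(** Euler's criterion. A nonresidue x with x ^+ n = 1 would be, together with the n
    distinct nonzero squares, a set of n + 1 roots of X^n - 1. *)
Lemma chi_euler (x : 'F_p) : (chi x)%:~R = x ^+ n.
Proof.
have n0 : (0 < n)%N by lia.
rewrite /chi; case: eqP => [->|/eqP x0]; first by rewrite expr0n; case: (n) n0.
have := Fp_expn_sq x0 => /eqP; rewrite sqrf_eq1.
case: ifP => [/existsP [y /eqP Hy]|Hx].
  have y0 : y != 0 by apply: contraNneq x0 => y0; rewrite -Hy y0 expr0n.
  by rewrite -Hy -exprM mulnC exprM Fp_expn_sq.
case/orP => /eqP Hn; last by rewrite Hn.
pose rs := x :: [seq (i.+1%:R : 'F_p) ^+ 2 | i <- iota 0 n].
have P0 : 'X^n - 1 != 0 :> {poly 'F_p}.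
  by rewrite -size_poly_eq0 size_XnsubC.
have Hr : all (root ('X^n - 1)) rs.
  apply/allP => y; rewrite inE => /orP [/eqP ->|/mapP [i Hi ->]].
    by rewrite rootE !hornerE Hn subrr.
  rewrite rootE !hornerE -exprM mulnC exprM Fp_expn_sq ?subrr //.
  by apply: half_lt_neq0; rewrite mem_iota in Hi.
have Hu : uniq rs.
  rewrite /= map_inj_in_uniq ?iota_uniq ?andbT.
    apply/negP => /mapP [i _ Hi]; move/existsP: Hx; apply.
    by exists i.+1%:R; rewrite Hi.
  move=> i j; rewrite !mem_iota /= !add0n => Hi Hj /eqP; rewrite eqf_sqr.
  case/orP; last first.
    rewrite -subr_eq0 opprK -natrD Fp_nat_eq0 => /dvdn_leq H; have := H isT; lia.
  wlog Hij : i j Hi Hj / (i <= j)%N.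
    move=> W; case: (leqP i j) => Hij; first exact: W.
    by rewrite eq_sym => H; symmetry; apply: W => //; lia.
  rewrite eq_sym -subr_eq0 -natrB; last by lia.
  by rewrite Fp_nat_eq0 => /dvdn_leq H; lia.
have := max_poly_roots P0 Hr Hu; rewrite size_XnsubC //= size_map size_iota; lia.
Qed.

Lemma chiM (x y : 'F_p) : chi (x * y) = chi x * chi y.
Proof.
have [a1 a2 _] := chi_range x; have [b1 b2 _] := chi_range y.
have [c1 c2 _] := chi_range (x * y).
apply: small_int_Fp_inj; [lia|nia|].
by rewrite rmorphM /= !chi_euler exprMn.
Qed.

Lemma chi0 : chi (0 : 'F_p) = 0. Proof. by rewrite /chi eqxx. Qed.

Lemma chi_sqr (x : 'F_p) : x != 0 -> chi x ^+ 2 = 1.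
Proof. by rewrite /chi => /negPf ->; case: ifP. Qed.

Lemma chi1 : chi (1 : 'F_p) = 1.
Proof.
rewrite /chi oner_eq0; case: ifP => // /existsP; case; exists 1.
by rewrite expr1n.
Qed.

Lemma chi_pm1 (x : 'F_p) : x != 0 -> chi x = 1 \/ chi x = -1.
Proof. by rewrite /chi => /negPf ->; case: ifP; [left|right]. Qed.

Lemma sum_Fp (G : 'F_p -> int) : \sum_(x : 'F_p) G x = \sum_(i < p) G (i%:R).
Proof.
rewrite (reindex (fun i : 'I_p => i%:R : 'F_p)) //=.
exists (fun x => Ordinal (ltn_Fp x p_pr)) => [i _|x _]; last exact: natr_Zp.
by apply: val_inj; rewrite /= val_Fp_nat // modn_small.
Qed.

Lemma sum_Fp_half (G : 'F_p -> int) :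
  \sum_(x : 'F_p) G x = G 0 + \sum_(k < n) (G k.+1%:R + G (- k.+1%:R)).
Proof.
rewrite sum_Fp -(big_mkord xpredT (fun i => G i%:R)).
have -> : index_iota 0 p = index_iota 0 (2 * n).+1 by rewrite -pE.
rewrite big_nat_recl //=.
congr (_ + _).
rewrite (@big_cat_nat _ _ _ n) /=; [|by []|lia].
rewrite big_split /= big_mkord; congr (_ + _).
rewrite -{1}[n]add0n big_addn mul2n -addnn addnK big_mkord.
rewrite (reindex_inj rev_ord_inj) /=; apply: eq_bigr => i _; congr G.
apply/eqP; rewrite -subr_eq0 opprK -natrD Fp_nat_eq0 {1}pE.
by have := ltn_ord i => Hi; apply/dvdnP; exists 1%N; lia.
Qed.

Hypothesis n_odd : odd n.

(** -1 is a nonresidue because n is odd, which is where p = 3 modulo 4 enters. *)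
Lemma chiN (x : 'F_p) : chi (- x) = - chi x.
Proof.
have [a1 a2 _] := chi_range x; have [b1 b2 _] := chi_range (- x).
apply: small_int_Fp_inj; [lia|lia|].
by rewrite rmorphN /= !chi_euler exprNn -signr_odd n_odd expr1 mulN1r.
Qed.

Lemma chiBC (x y : 'F_p) : chi (- x + y) = - chi (x - y).
Proof. by rewrite addrC -opprB chiN. Qed.

Lemma sum_chi : \sum_(x : 'F_p) chi x = 0.
Proof.
rewrite sum_Fp_half chi0 add0r big1 // => k _.
by rewrite chiN subrr.
Qed.

Lemma sum_chi_shift (a : 'F_p) : \sum_(x : 'F_p) chi (x + a) = 0.
Proof.
by rewrite (reindex_inj (addIr (- a))) -[RHS]sum_chi; apply: eq_bigr => x _; rewrite subrK.
Qed.

(** For a different from b, the substitution of the inverse of x turns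
    chi (x) chi (x + k) into chi (1 + k / x), and one value is missing from a
    complete sum of chi. *)
Lemma chi_autocorr (a b : 'F_p) :
  \sum_(x : 'F_p) chi (x + a) * chi (x + b) = if a == b then p%:Z - 1 else -1.
Proof.
rewrite (reindex_inj (addIr (- a))) /=.
under eq_bigr do rewrite subrK -addrA.
set k := - a + b; rewrite (bigD1 0) //= chi0 mul0r add0r.
have -> : \sum_(x : 'F_p | x != 0) chi x * chi (x + k) =
          \sum_(x : 'F_p | x != 0) chi (1 + x * k).
  rewrite (reindex_inj (@invr_inj 'F_p)) /=.
  apply: eq_big => [x|x]; rewrite invr_eq0 // => x0.
  rewrite -chiM mulrDr.
  have -> : 1 + x * k = x ^+ 2 * (x^-1 * x^-1 + x^-1 * k) by field.
  have x2 : chi (x ^+ 2) = 1 by rewrite expr2 chiM -expr2 chi_sqr.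
  by rewrite chiM x2 mul1r.
case: eqP => [E|/eqP E].
  have -> : k = 0 by rewrite /k E addNr.
  under eq_bigr do rewrite mulr0 addr0 chi1.
  have /eqP := sumr_const (mem 'F_p) (1 : int).
  rewrite (bigD1 0) //= card_Fp // => /eqP H.
  have -> : p%:Z = 1 *+ p by rewrite -natz.
  by rewrite -H addrAC subrr add0r.
have k0 : k != 0 by rewrite /k addrC subr_eq0 eq_sym.
have /eqP := sum_chi_shift 1.
rewrite (reindex_inj (mulIf k0)) (bigD1 0) //= mul0r add0r chi1.
rewrite addrC addr_eq0 => /eqP <-.
by apply: eq_bigr => x _; rewrite addrC.
Qed.

(** The matrix of the statement at x = y = w = 0, with integer entries; sd stands
    for sum and difference. *)
Definition sd_mx : 'M[int]_n :=
  \matrix_(j, k) (chi (j.+1%:R + k.+1%:R : 'F_p) + chi (j.+1%:R - k.+1%:R : 'F_p)).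

Definition chi_row : 'rV[int]_n := \row_k chi (k.+1%:R : 'F_p).

(** j + k and j - k together run over all residues except j itself, and chi sums
    to zero over all residues. *)
Lemma sd_mx_ones : sd_mx *m const_mx 1 = - chi_row^T.
Proof.
apply/matrixP => j z; rewrite !mxE.
have := sum_Fp_half (fun y : 'F_p => chi (j.+1%:R + y)).
under eq_bigr do rewrite addrC.
rewrite sum_chi_shift // addr0 => /eqP.
rewrite eq_sym addrC addr_eq0 => /eqP <-.
by apply: eq_bigr => k _; rewrite !mxE mulr1.
Qed.

(** The half sum of chi (j) (chi (j + k) + chi (j - k)) is, by oddness of chi,
    the full autocorrelation of chi at distance k. *)
Lemma chi_row_sd_mx : chi_row *m sd_mx = - const_mx 1.
Proof.
apply/matrixP => z k; rewrite !mxE.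
have k0 : k.+1%:R != 0 :> 'F_p by apply: half_lt_neq0.
have := sum_Fp_half (fun y : 'F_p => chi (y + 0) * chi (y + k.+1%:R)).
rewrite chi_autocorr // eq_sym (negPf k0) addr0 chi0 mul0r add0r => ->.
apply: eq_bigr => j _; rewrite !mxE mulrDr !addr0.
by rewrite chiBC chiN mulrNN.
Qed.

(** The summand is even in y, so the entries of the Gram matrix are half of full
    sums, which are combinations of autocorrelations of chi. *)
Lemma sd_mx_gram : sd_mx^T *m sd_mx = p%:Z%:M - (const_mx 2 : 'cV_n) *m const_mx 1.
Proof.
apply/matrixP => k k'; rewrite !mxE big_ord1 !mxE mulr1.
have k0 : k.+1%:R != - k'.+1%:R :> 'F_p.
  rewrite -subr_eq0 opprK -natrD Fp_nat_eq0 //; apply/negP => /dvdn_leq H.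
  by have := ltn_ord k; have := ltn_ord k'; lia.
have kk : (k.+1%:R == k'.+1%:R :> 'F_p) = (k == k').
  apply/eqP/eqP => [|-> //].
  wlog Hij : k k' {k0} / (k' <= k)%N.
    move=> W; case: (leqP k' k) => Hij; first exact: W.
    by move=> H; symmetry; apply: W => //; lia.
  move=> /eqP; rewrite -subr_eq0 -natrB; last by lia.
  rewrite Fp_nat_eq0 // => /dvdn_leq H; apply: val_inj => /=.
  by have := ltn_ord k; have := ltn_ord k'; lia.
pose G (y : 'F_p) := (chi (y + k.+1%:R) + chi (y - k.+1%:R)) *
                     (chi (y + k'.+1%:R) + chi (y - k'.+1%:R)).
have E1 : \sum_y G y = 2 * \sum_(j < n) sd_mx^T k j * sd_mx j k'.
  rewrite (sum_Fp_half) /G !add0r !chiN // !subrr mul0r add0r mulr_sumr.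
  apply: eq_bigr => j _; rewrite !mxE.
  have ev (y z : 'F_p) : chi (- y + z) + chi (- y - z) = - (chi (y + z) + chi (y - z)).
    by rewrite chiBC -opprD chiN -opprD addrC.
  by rewrite !ev; ring.
have E2 : \sum_y G y = 2 * (if k == k' then p%:Z - 1 else -1) - 2.
  rewrite /G; under eq_bigr do rewrite mulrDl !mulrDr.
  rewrite !big_split /= !chi_autocorr // (negPf k0) kk eqr_opp kk.
  rewrite eq_sym -eqr_opp opprK (negPf k0); ring.
move: E1; rewrite E2; set s := \sum_(j < n) _.
by case: (k == k'); rewrite ?mulr1n ?mulr0n /= => ?; lia.
Qed.

Lemma sqr_det_sd_mx : (\det sd_mx) ^+ 2 = p%:Z ^+ n.-1.
Proof.
have n0 : (0 < n)%N by lia.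
have p0 : p%:Z != 0 by lia.
rewrite expr2 -{1}det_tr -det_mulmx sd_mx_gram.
apply: (mulfI p0); rewrite det_scalar_sub_rank1 -exprS prednK //.
rewrite mxE; under eq_bigr do rewrite !mxE mul1r.
have -> : p%:Z - \sum_(i < n) 2 = 1.
  by rewrite sumr_const card_ord; lia.
by rewrite mulr1.
Qed.

(** Off the diagonal both characters are odd, so their sum is even; on the diagonal
    only chi (2 j) remains. *)
Lemma det_sd_mx_mod4 :
  (\det sd_mx = chi (2%:R : 'F_p) * \prod_(j < n) chi (j.+1%:R : 'F_p) %[mod 4])%Z.
Proof.
rewrite det_diag_mod4.
  congr (_ %% _)%Z.
  have -> : chi (2%:R : 'F_p) = \prod_(j < n) chi (2%:R : 'F_p).
    rewrite prodr_const card_ord -[n]odd_double_half n_odd exprD expr1 -mul2n exprM.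
    rewrite chi_sqr ?expr1n ?mulr1 //.
    by rewrite (Fp_nat_eq0 2); apply/negP => /dvdn_leq H; lia.
  rewrite -big_split /=; apply: eq_bigr => j _.
  rewrite !mxE subrr chi0 addr0 -chiM //; congr chi; ring.
move=> j k jk; rewrite mxE.
have nz1 : j.+1%:R + k.+1%:R != 0 :> 'F_p.
  rewrite -natrD Fp_nat_eq0 //; apply/negP => /dvdn_leq H.
  by have := ltn_ord k; have := ltn_ord j; lia.
have nz2 : j.+1%:R - k.+1%:R != 0 :> 'F_p.
  wlog Hij : j k jk {nz1} / (k <= j)%N.
    move=> W; case: (leqP k j) => Hij; first exact: W.
    by rewrite -oppr_eq0 opprB; apply: W; [rewrite eq_sym|lia].
  rewrite -natrB; last by lia.
  rewrite Fp_nat_eq0 //; apply/negP => /dvdn_leq H.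
  move: jk; rewrite -val_eqE /= => jk.
  by have := ltn_ord k; have := ltn_ord j; lia.
by case: (chi_pm1 nz1) => ->; case: (chi_pm1 nz2) => ->.
Qed.

Definition half_sum := \sum_(j < n) chi (j.+1%:R : 'F_p).

(** The Gram matrix gives the determinant up to sign. The sign is read off modulo 4,
    where the determinant is a product of signs; that product is tied to the sum of
    the same signs, hence to the class number h through the hypothesis. *)
Lemma det_sd_mx (h : nat) : (2 - chi (2%:R : 'F_p)) * h%:Z = half_sum ->
  \det sd_mx = (-1) ^+ ((h - 1) %/ 2) * p%:Z ^+ ((p - 3) %/ 4).
Proof.
move=> hE; set r := ((p - 3) %/ 4)%N.
have rE : n = (2 * r).+1 by rewrite /r; lia.
have nz (j : 'I_n) : chi (j.+1%:R : 'F_p) = 1 \/ chi (j.+1%:R : 'F_p) = -1.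
  by apply/chi_pm1/half_lt_neq0.
have /eqP := sqr_det_sd_mx.
have -> : n.-1 = (r * 2)%N by rewrite rE mulnC.
rewrite exprM eqf_sqr.
have := det_sd_mx_mod4.
have := sum_signs_mod4 nz; rewrite -/half_sum -hE.
set P := \prod_(_ < n) _.
have HP : P = 1 \/ P = -1.
  by rewrite /P; elim/big_ind: _ => [|x y [->|->] [->|->]|i _ //]; try by [left|right].
have H2 : chi (2%:R : 'F_p) = 1 \/ chi (2%:R : 'F_p) = -1.
  apply: chi_pm1; rewrite Fp_nat_eq0; apply/negP => /dvdn_leq; lia.
have [g Hg] := signr_mod4 ((h - 1) %/ 2)%N.
have [e He] := signr_mod4 r.
(* p = -1 modulo 4 *)
have [q Hq] : exists q : int, p%:Z ^+ r = (-1) ^+ r + 4 * q.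
  have : (4 %| p%:Z ^+ r - (-1) ^+ r)%Z.
    rewrite subrXX; apply: dvdz_mulr; rewrite pE rE.
    by apply/dvdzP; exists (r%:Z + 1); lia.
  by case/dvdzP => q Hq; exists q; lia.
have sg (m : nat) : (-1) ^+ m = 1 :> int \/ (-1) ^+ m = -1 :> int.
  by rewrite -signr_odd; case: (odd m); [right|left].
move=> Hs Hd.
case/orP => /eqP HD; rewrite HD in Hd *.
  suff -> : (-1) ^+ ((h - 1) %/ 2) = 1 :> int by rewrite mul1r.
  case: (sg ((h - 1) %/ 2)%N) => // Gg; exfalso; move: Hs Hd; rewrite Hq.
  by rewrite Gg in Hg; case: (sg r) He => -> He; case: HP => ->; case: H2 => ->; lia.
suff -> : (-1) ^+ ((h - 1) %/ 2) = -1 :> int by rewrite mulN1r.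
case: (sg ((h - 1) %/ 2)%N) => // Gg; exfalso; move: Hs Hd; rewrite Hq.
by rewrite Gg in Hg; case: (sg r) He => -> He; case: HP => ->; case: H2 => ->; lia.
Qed.

Section AnyRing.
Variables (R : comNzRingType) (x y w : R).
Let A : 'M[R]_n := map_mx intr sd_mx.
Let l : 'rV[R]_n := map_mx intr chi_row.
Let o : 'cV[R]_n := const_mx 1.

Lemma sd_mx_mul_ones : A *m o = - l^T.
Proof.
have -> : o = map_mx intr (const_mx 1 : 'cV[int]_n) by apply/matrixP => i j; rewrite !mxE.
by rewrite -map_mxM sd_mx_ones map_mxN map_trmx.
Qed.

Lemma chi_row_mul_sd_mx : l *m A = - o^T.
Proof.
rewrite -map_mxM chi_row_sd_mx.
by apply/matrixP => i j; rewrite !mxE.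
Qed.

Lemma chi_row_mul_ones : (l *m o) 0 0 = half_sum%:~R.
Proof.
by rewrite !mxE rmorph_sum; apply: eq_bigr => i _; rewrite !mxE mulr1.
Qed.

Lemma chi_row_mul_tr : (l *m l^T) 0 0 = n%:R.
Proof.
rewrite !mxE -[n in RHS]card_ord -sum1_card natr_sum; apply: eq_bigr => i _.
by rewrite !mxE -rmorphM /= -expr2 chi_sqr //; apply: half_lt_neq0.
Qed.

(** The perturbation has columns o and l^T, and its right factor o^T is - l A; so it
    factors through A on the right, leaving a rank-one determinant. *)
Lemma det_affine_x :
  \det (A + x *: (o *m o^T) + y *: (l^T *m o^T)) =
  (\det sd_mx)%:~R * (1 - half_sum%:~R * x - n%:R * y).
Proof.
have -> : A + x *: (o *m o^T) + y *: (l^T *m o^T) =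
  (1%:M - (x *: o + y *: l^T) *m l) *m A.
  rewrite mulmxBl mul1mx -mulmxA chi_row_mul_sd_mx mulmxN opprK mulmxDl -!scalemxAl addrA //.
rewrite det_mulmx det_1_sub_rank1 det_map_mx mulrC; congr (_ * _).
rewrite mulmxDr -!scalemxAr.
have add00 (B C : 'M[R]_1) a b : (a *: B + b *: C) 0 0 = a * B 0 0 + b * C 0 0 by rewrite !mxE.
by rewrite add00 chi_row_mul_ones chi_row_mul_tr; ring.
Qed.

(** Here the left factor l^T = - A o is common, so the perturbation factors through
    A on the left. *)
Lemma det_affine_w :
  \det (A + y *: (l^T *m o^T) + w *: (l^T *m l)) =
  (\det sd_mx)%:~R * (1 - half_sum%:~R * w - n%:R * y).
Proof.
have -> : A + y *: (l^T *m o^T) + w *: (l^T *m l) =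
  A *m (1%:M - o *m (y *: o^T + w *: l)).
  rewrite mulmxBr mulmx1 mulmxA sd_mx_mul_ones mulNmx opprK mulmxDr -!scalemxAr addrA //.
rewrite det_mulmx det_1_sub_rank1 det_map_mx; congr (_ * _).
rewrite mulmxDl -!scalemxAl.
have add00 (B C : 'M[R]_1) a b : (a *: B + b *: C) 0 0 = a * B 0 0 + b * C 0 0 by rewrite !mxE.
rewrite add00 chi_row_mul_ones.
rewrite [(o^T *m o) 0 0]mxE; under eq_bigr do rewrite !mxE mulr1.
by rewrite sumr_const card_ord; ring.
Qed.

End AnyRing.
End OddPrime.

(** * Abel summation and alternating sums *)

Section Abel.
Variable F : numFieldType.

Lemma abel_sum (u g : nat -> F) (M : nat) :
  \sum_(i < M) u i * g i =
  (\sum_(i < M) u i) * g M + \sum_(i < M) (\sum_(j < i.+1) u j) * (g i - g i.+1).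
Proof.
elim: M => [|M IH]; first by rewrite !big_ord0 mul0r addr0.
by rewrite !(big_ord_recr M) /= IH; set s := \sum_(_ < M) _; set s' := \sum_(_ < M) _; ring.
Qed.

Lemma telescope_decr (g : nat -> F) (M : nat) : \sum_(i < M) (g i - g i.+1) = g 0%N - g M.
Proof.
elim: M => [|M IH]; first by rewrite big_ord0 subrr.
by rewrite big_ord_recr /= IH addrA subrK.
Qed.

(** Abel summation against a decreasing weight: only the first weight survives in
    the bound. *)
Lemma abel_bound (u g : nat -> F) (K : F) (M : nat) :
  (forall i, `|\sum_(j < i) u j| <= K) -> (forall i, 0 <= g i) -> (forall i, g i.+1 <= g i) ->
  `|\sum_(i < M) u i * g i| <= K * g 0%N.
Proof.
move=> HK g0 gd; rewrite abel_sum.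
have -> : K * g 0%N = K * g M + \sum_(i < M) K * (g i - g i.+1).
  by rewrite -mulr_sumr -mulrDr telescope_decr addrC subrK.
apply: (le_trans (ler_normD _ _)); apply: lerD.
  by rewrite normrM (ger0_norm (g0 _)) ler_wpM2r.
apply: (le_trans (ler_norm_sum _ _ _)); apply: ler_sum => i _.
by rewrite normrM [X in _ * X]ger0_norm ?subr_ge0 // ler_wpM2r ?subr_ge0.
Qed.

(** Twice an alternating sum is the alternating sum of the first differences, up to
    boundary terms. *)
Lemma alternating_step (g : nat -> F) (L : nat) :
  2 * \sum_(i < L) (-1) ^+ i * g i =
  \sum_(i < L) (-1) ^+ i * (g i - g i.+1) + g 0%N - (-1) ^+ L * g L.
Proof.
elim: L => [|L IH]; first by rewrite !big_ord0 expr0; ring.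
rewrite !big_ord_recr /= mulrDr IH exprS; ring.
Qed.

(** Three steps of [alternating_step]: an alternating sum of a smooth function is
    controlled by its third differences and its values near the ends. *)
Lemma alternating_bound (g : nat -> F) (L : nat) (eta : F) :
  (forall i, (i < 3)%N -> `|g i| <= eta) -> (forall i, (L <= i < L + 3)%N -> `|g i| <= eta) ->
  8 * `|\sum_(i < L) (-1) ^+ i * g i| <=
  \sum_(i < L) `|g i.+3 - 3 * g i.+2 + 3 * g i.+1 - g i| + 24 * eta.
Proof.
move=> H0 HL.
pose g1 i := g i - g i.+1; pose g2 i := g1 i - g1 i.+1.
have E1 := alternating_step g L.
have E2 := alternating_step g1 L.
have E3 := alternating_step g2 L.
have -> : 8 * `|\sum_(i < L) (-1) ^+ i * g i| = `|8 * \sum_(i < L) (-1) ^+ i * g i|.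
  by rewrite normrM ger0_norm.
have -> : 8 * \sum_(i < L) (-1) ^+ i * g i =
  \sum_(i < L) (-1) ^+ i * (g2 i - g2 i.+1)
  + (7 * g 0%N - 4 * g 1%N + g 2%N) - (-1) ^+ L * (7 * g L - 4 * g L.+1 + g L.+2).
  have -> : 8 * \sum_(i < L) (-1) ^+ i * g i = 4 * (2 * \sum_(i < L) (-1) ^+ i * g i) by ring.
  rewrite E1.
  have -> : \sum_(i < L) (-1) ^+ i * (g i - g i.+1) = \sum_(i < L) (-1) ^+ i * g1 i by [].
  transitivity (2 * (2 * \sum_(i < L) (-1) ^+ i * g1 i) + 4 * g 0%N - 4 * ((-1) ^+ L * g L)).
    by ring.
  rewrite E2.
  have -> : \sum_(i < L) (-1) ^+ i * (g1 i - g1 i.+1) = \sum_(i < L) (-1) ^+ i * g2 i by [].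
  transitivity (2 * \sum_(i < L) (-1) ^+ i * g2 i + 2 * g1 0%N - 2 * ((-1) ^+ L * g1 L) + 4 * g 0%N - 4 * ((-1) ^+ L * g L)).
    by ring.
  by rewrite E3 /g2 /g1; ring.
have nb (a b c : F) : `|a| <= eta -> `|b| <= eta -> `|c| <= eta ->
    `|7 * a - 4 * b + c| <= 12 * eta.
  move=> Ha Hb Hc.
  apply: (le_trans (ler_normD _ _)); have -> : 12 * eta = 11 * eta + eta by ring.
  apply: lerD => //; apply: (le_trans (ler_normB _ _)).
  have -> : 11 * eta = 7 * eta + 4 * eta by ring.
  by rewrite !normrM !normr_nat; apply: lerD; rewrite ler_wpM2l.
have -> : 24 * eta = 12 * eta + 12 * eta by ring.
apply: (le_trans (ler_normB _ _)); rewrite [X in _ <= X]addrA; apply: lerD; last first.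
  rewrite normrM normrX normrN1 expr1n mul1r.
  by apply: nb; apply: HL; lia.
apply: (le_trans (ler_normD _ _)); apply: lerD; last by apply: nb; apply: H0.
apply: (le_trans (ler_norm_sum _ _ _)); apply: ler_sum => i _.
rewrite normrM normrX normrN1 expr1n mul1r.
have -> // : g2 i - g2 i.+1 = - (g i.+3 - 3 * g i.+2 + 3 * g i.+1 - g i).
  by rewrite /g2 /g1; ring.
by rewrite normrN.
Qed.
End Abel.

(** * Third differences of a Gaussian profile *)

Section Gauss.
Variables (F : realFieldType) (N : nat).
Hypothesis N_gt0 : (0 < N)%N.
Let t : F := N%:R ^- 2.
Let x : F := 1 + t.
Let q : F := x^-1.

Lemma step_gt0 : 0 < t. Proof. by rewrite invr_gt0 exprn_gt0 // ltr0n. Qed.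
Lemma step_le1 : t <= 1.
Proof. by rewrite invf_le1 ?exprn_gt0 ?ltr0n // exprn_ege1 // ler1n. Qed.
Lemma base_gt1 : 1 < x. Proof. by rewrite ltrDl step_gt0. Qed.
Lemma base_le2 : x <= 2. Proof. by have := step_le1; rewrite /x; lra. Qed.
Lemma q_gt0 : 0 < q. Proof. by rewrite invr_gt0 (lt_trans ltr01) // base_gt1. Qed.
Lemma q_lt1 : q < 1. Proof. by rewrite invf_lt1 ?base_gt1 // (lt_trans ltr01) // base_gt1. Qed.
Lemma onemq_le : 1 - q <= t.
Proof.
have x0 : 0 < x by rewrite (lt_trans ltr01) // base_gt1.
rewrite -(ler_pM2l x0) mulrBr mulr1 divff ?gt_eqF // /x.
have := step_gt0; nra.
Qed.

Lemma bernoulli (u : F) (n : nat) : 0 <= u -> 1 + u *+ n <= (1 + u) ^+ n.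
Proof.
move=> u0; elim: n => [|n IH]; first by rewrite mulr0n addr0.
have un : 0 <= u *+ n by rewrite mulrn_wge0.
have H : (1 + u *+ n) * (1 + u) <= (1 + u) ^+ n * (1 + u).
  by rewrite ler_wpM2r // addr_ge0.
rewrite exprSr; apply: le_trans H; rewrite mulrSr.
set v := u *+ n in un *; nra.
Qed.

Lemma onemqn_le (n : nat) : 1 - q ^+ n <= t *+ n.
Proof.
elim: n => [|n IH]; first by rewrite expr0 subrr mulr0n.
have H0 : 0 <= q ^+ n <= 1 by rewrite exprn_ge0 ?exprn_ile1 // ltW // ?q_gt0 ?q_lt1.
rewrite exprSr mulrSr.
have Hq := onemq_le; have H1 : q ^+ n * (1 - q) <= 1 - q.
  by apply: ler_piMl; [rewrite subr_ge0 ltW // q_lt1|lra].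
set v := t *+ n in IH *; set z := q ^+ n in IH H0 H1 *; lra.
Qed.

(** q ^ E decays faster than any power of E / N^2; the fifth power pays for the
    powers of the derivative and leaves a square, which is summable over the
    plane. It follows from [bernoulli] at E / 5. *)
Lemma gauss_decay (E : nat) : q ^+ E * (1 + t *+ E) ^+ 5 <= 5 ^+ 5.
Proof.
have x0 : 0 < x by apply: lt_trans base_gt1.
rewrite exprVn mulrC ler_pdivrMr ?exprn_gt0 //.
have x1 := ltW base_gt1.
apply: (@le_trans _ _ (5 ^+ 5 * x ^+ (5 * (E %/ 5)))); last first.
  by rewrite ler_wpM2l ?exprn_ge0 // ler_weXn2l //; lia.
have tE : 0 <= t *+ E by rewrite mulrn_wge0 // ltW // step_gt0.
rewrite mulnC exprM -exprMn; apply: lerXn2r; rewrite ?nnegrE.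
- by rewrite addr_ge0.
- by rewrite mulr_ge0 // exprn_ge0 // (le_trans ler01).
have := bernoulli (E %/ 5) (ltW step_gt0); rewrite -/x => H.
apply: (@le_trans _ _ (5 * (1 + t *+ (E %/ 5)))); last by rewrite ler_wpM2l.
rewrite {1}(divn_eq E 5) mulrnDr mulnC mulrnA.
have : t *+ (E %% 5) <= t *+ 4 by rewrite ler_wpMn2l // ?ltW ?step_gt0 //; have := ltn_mod E 5; lia.
have -> : t *+ 5 *+ (E %/ 5) = 5 * (t *+ (E %/ 5)) by rewrite mulrnAC -[_ *+ 5]mulr_natl.
have -> : t *+ 4 = 4 * t by rewrite -[_ *+ 4]mulr_natl.
by have := step_le1; set v := t *+ (E %/ 5); set v' := t *+ (E %% 5); lra.
Qed.

Definition third_diff_const (a : nat) : F :=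
  (2 ^+ (4 * a)) ^+ 3 * (8 * a%:R ^+ 2) ^+ 3 * (1 + 6 * a%:R + 12 * a%:R ^+ 2) * 5 ^+ 5.

Lemma ler_of_sqr_le (u w : F) : 1 <= w -> u ^+ 2 <= w -> u <= w.
Proof.
move=> w1 uw; have [//|wu] := lerP u w.
have : w * w <= u ^+ 2 by rewrite expr2 ler_pM //; lra.
nra.
Qed.

(** D may be slightly negative, because it will be the increment of a quadratic
    form near its vertex; hence integer exponents. *)
Lemma qexpz_near1 (a : nat) (D : int) : - (4 * a)%N%:Z <= D ->
  [/\ 0 <= q ^ D, q ^ D <= 2 ^+ (4 * a) & `|q ^ D - 1| <= 2 ^+ (4 * a) * (t * `|D|%:~R)].
Proof.
have q0 := q_gt0; have q1 := q_lt1; have t0 := step_gt0.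
have x0 : 0 < x by apply: lt_trans base_gt1.
have W1 : 1 <= 2 ^+ (4 * a) :> F by rewrite exprn_ege1 // ler1n.
have h (d : nat) : 0 <= 1 - q ^+ d <= t * d%:R.
  apply/andP; split; last by rewrite mulr_natr onemqn_le.
  by rewrite subr_ge0 exprn_ile1 ?ltW.
case: D => d Hd.
  have := h d => /andP [h1 h2].
  have -> : q ^ d = q ^+ d by [].
  split; first by rewrite exprn_ge0 // ltW.
    by apply: le_trans W1; lra.
  rewrite distrC ger0_norm //; apply: (le_trans h2).
  have -> : (`|d%:Z|%:~R = d%:R :> F) by [].
  by rewrite ler_peMl // mulr_ge0 ?ler0n // ltW.
have := h d.+1 => /andP [h1 h2].
have -> : q ^ (Negz d) = x ^+ d.+1.
  by rewrite NegzE -exprnN /q exprVn invrK.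
have xW : x ^+ d.+1 <= 2 ^+ (4 * a).
  apply: (@le_trans _ _ (2 ^+ d.+1)).
    by rewrite lerXn2r ?nnegrE ?(ltW x0) // base_le2.
  by rewrite ler_weXn2l // ?ler1n //; lia.
have xd0 : 0 < x ^+ d.+1 by rewrite exprn_gt0.
split; [exact: ltW|by []|].
have -> : x ^+ d.+1 - 1 = x ^+ d.+1 * (1 - q ^+ d.+1).
  by rewrite mulrBr mulr1 /q exprVn divff ?gt_eqF.
rewrite ger0_norm ?mulr_ge0 // ?(ltW xd0) //.
have -> : (`|Negz d|%:~R = d.+1%:R :> F) by [].
by apply: ler_pM => //; rewrite ltW.
Qed.

Lemma third_diff_const_ge0 a : 0 <= third_diff_const a.
Proof.
have A0 : 0 <= a%:R :> F by rewrite ler0n.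
by rewrite /third_diff_const !mulr_ge0 ?exprn_ge0 ?mulr_ge0 ?exprn_ge0 ?addr_ge0 ?mulr_ge0 ?exprn_ge0.
Qed.

(** Here v = 1 / N, X = q ^ D and r = q ^ (2 a); each of the three terms of the
    third difference is of order v ^ 3. *)
Lemma third_diff_factor_bound (W w A v dl r X : F) :
  0 <= X <= W -> 1 <= W -> 0 <= r <= 1 -> 1 - r <= 2 * A * v ^+ 2 ->
  `|X - 1| <= W * (dl * v) -> 0 <= dl <= w -> 1 <= w -> 1 <= A -> 0 < v <= 1 ->
  `|(X - 1) ^+ 3 + (r - 1) * (r ^+ 2 + r + 1) * X ^+ 2 * (X - 1) +
    (r - 1) ^+ 2 * (r + 2) * X ^+ 2| <= W ^+ 3 * w ^+ 3 * (1 + 6 * A + 12 * A ^+ 2) * v ^+ 3.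
Proof.
move=> /andP [X0 XW] W1 /andP [r0 r1] rB XB /andP [d0 dw] w1 A1 /andP [v0 v1].
have nM3 (b c d : F) : `|b * c * d| = `|b| * `|c| * `|d| by rewrite !normrM.
have nM4 (b c d e : F) : `|b * c * d * e| = `|b| * `|c| * `|d| * `|e| by rewrite !normrM.
have W0 : 0 <= W by lra.
have w0 : 0 <= w by lra.
have XX : X ^+ 2 <= W ^+ 2 by rewrite lerXn2r ?nnegrE.
have XX0 : 0 <= X ^+ 2 by rewrite exprn_ge0.
have XB' : `|X - 1| <= W * w * v.
  by apply: (le_trans XB); rewrite mulrA ler_wpM2r ?(ltW v0) // ler_wpM2l.
have rn : `|r - 1| <= 2 * A * v ^+ 2 by rewrite distrC ger0_norm // subr_ge0.
have ww : w <= w ^+ 3 by rewrite -[X in X <= _]expr1 ler_weXn2l.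
have w31 : 1 <= w ^+ 3 by rewrite exprn_ege1.
have WW : W ^+ 2 <= W ^+ 3 by rewrite ler_weXn2l.
have vv : v ^+ 4 <= v ^+ 3 by rewrite ler_wiXn2l // ltW.
have v3 : 0 <= v ^+ 3 by rewrite exprn_ge0 // ltW.
have W3 : 0 <= W ^+ 3 by rewrite exprn_ge0.
have -> : W ^+ 3 * w ^+ 3 * (1 + 6 * A + 12 * A ^+ 2) * v ^+ 3 =
  (W * w * v) ^+ 3 + (2 * A * v ^+ 2) * 3 * W ^+ 2 * (W * w ^+ 3 * v) +
  (2 * A * v ^+ 2) ^+ 2 * 3 * (W ^+ 3 * w ^+ 3) * (v ^+ 3) / v ^+ 4.
  by field; rewrite gt_eqF.
apply: (le_trans (ler_normD _ _)); apply: lerD.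
  apply: (le_trans (ler_normD _ _)); apply: lerD.
    by rewrite normrX lerXn2r // ?nnegrE // !mulr_ge0 // ltW.
  rewrite nM4 [ `|X ^+ 2|]ger0_norm //; apply: ler_pM; rewrite ?mulr_ge0 //.
    apply: ler_pM; rewrite ?mulr_ge0 //.
    apply: ler_pM => //; rewrite ger0_norm; nra.
  by apply: (le_trans XB'); rewrite ler_wpM2r ?(ltW v0) // ler_wpM2l.
have -> : (2 * A * v ^+ 2) ^+ 2 * 3 * (W ^+ 3 * w ^+ 3) * (v ^+ 3) / v ^+ 4 =
   (4 * A ^+ 2) * 3 * (W ^+ 3 * w ^+ 3) * v ^+ 3 by field; rewrite gt_eqF.
apply: (@le_trans _ _ ((2 * A * v ^+ 2) ^+ 2 * 3 * W ^+ 2)).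
  rewrite nM3 [ `|X ^+ 2|]ger0_norm //; apply: ler_pM; rewrite ?mulr_ge0 //.
  apply: ler_pM; rewrite ?mulr_ge0 //.
    by rewrite normrX lerXn2r // ?nnegrE // !mulr_ge0 ?exprn_ge0 //; lra.
  by rewrite ger0_norm; lra.
have -> : (2 * A * v ^+ 2) ^+ 2 * 3 * W ^+ 2 = (4 * A ^+ 2) * 3 * W ^+ 2 * v ^+ 4 by ring.
have A0 : 0 <= 4 * A ^+ 2 * 3 by rewrite !mulr_ge0 ?exprn_ge0 //; lra.
apply: ler_pM => //; rewrite ?exprn_ge0 // ?(ltW v0) //.
  by apply: mulr_ge0 => //; apply: exprn_ge0.
rewrite ler_wpM2l //; apply: (le_trans WW).
by rewrite ler_peMr.
Qed.

(** e0, ..., e3 are consecutive values of a quadratic polynomial with leading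
    coefficient a, whose first increment D satisfies D^2 = O(e0). So q ^ e is, on the
    scale of N, a smooth bump, and its third difference is O(N^-3) times a
    function with quadratic decay. *)
Lemma third_diff_bound (a e0 e1 e2 e3 : nat) (D : int) : (0 < a)%N ->
  e1%:Z = e0%:Z + D -> e2%:Z = e0%:Z + 2 * D + 2 * a%:Z ->
  e3%:Z = e0%:Z + 3 * D + 6 * a%:Z ->
  - (4 * a)%N%:Z <= D -> D ^+ 2 <= 8 * a%:Z * e0%:Z + 2 * a%:Z ^+ 2 ->
  `|q ^+ e3 - 3 * q ^+ e2 + 3 * q ^+ e1 - q ^+ e0| * (1 + t *+ e0) ^+ 2
    <= third_diff_const a * N%:R ^- 3.
Proof.
move=> a0 E1 E2 E3 HD HD2.
have E2' : e2%:Z = e0%:Z + D + D + (2 * a)%N%:Z by lia.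
have E3' : e3%:Z = e0%:Z + D + D + D + (2 * a)%N%:Z + (2 * a)%N%:Z + (2 * a)%N%:Z by lia.
have q0 := q_gt0; have q1 := q_lt1; have t0 := step_gt0; have t1 := step_le1.
have N0 : 0 < N%:R :> F by rewrite ltr0n.
have [X0 XW XB] := qexpz_near1 HD.
set X := q ^ D in X0 XW XB; set W : F := 2 ^+ (4 * a) in XW XB.
have W1 : 1 <= W by rewrite exprn_ege1 // ler1n.
set r := q ^+ (2 * a).
have r01 : 0 <= r <= 1 by rewrite exprn_ge0 ?exprn_ile1 // ltW.
have rB : 1 - r <= 2 * a%:R * t.
  by apply: (le_trans (onemqn_le _)); rewrite -[t *+ _]mulr_natl natrM.
set f := q ^+ e0; set Y := t *+ e0.
have qn0 : q != 0 by rewrite gt_eqF.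
have -> : q ^+ e1 = f * X.
  by rewrite /f /X !exprnP E1 expfzDr.
have -> : q ^+ e2 = f * (X ^+ 2 * r).
  by rewrite [q ^+ e2]exprnP E2' !expfzDr // -!exprnP -/r -/f -/X; ring.
have -> : q ^+ e3 = f * (X ^+ 3 * r ^+ 3).
  by rewrite [q ^+ e3]exprnP E3' !expfzDr // -!exprnP -/r -/f -/X; ring.
(* the second difference of e is 2 a, whence the powers of r *)
have -> : f * (X ^+ 3 * r ^+ 3) - 3 * (f * (X ^+ 2 * r)) + 3 * (f * X) - f =
  f * ((X - 1) ^+ 3 + (r - 1) * (r ^+ 2 + r + 1) * X ^+ 2 * (X - 1) + (r - 1) ^+ 2 * (r + 2) * X ^+ 2).
  by ring.
have f0 : 0 < f by rewrite exprn_gt0.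
rewrite normrM (gtr0_norm f0).
have Y0 : 0 <= Y by rewrite mulrn_wge0 // ltW.
set A : F := a%:R; have A1 : 1 <= A by rewrite ler1n.
pose dl : F := `|D|%:~R / N%:R.
(* dl = |D| / N is O(1 + sqrt Y); the cruder bound w is polynomial in Y *)
pose w : F := 8 * A ^+ 2 * (1 + Y).
have dl0 : 0 <= dl by rewrite divr_ge0 ?ler0n // ler0z.
have A2 : 1 <= A ^+ 2 by rewrite exprn_ege1.
have w1 : 1 <= w by rewrite /w; nra.
have dlw : dl <= w.
  apply: ler_of_sqr_le => //.
  have : dl ^+ 2 <= 8 * A * Y + 2 * A ^+ 2 * t.
    have -> : dl ^+ 2 = (D ^+ 2)%:~R * t.
      by rewrite /dl expr_div_n -rmorphXn /= real_normK ?num_real.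
    have -> : 8 * A * Y + 2 * A ^+ 2 * t = (8 * a%:Z * e0%:Z + 2 * a%:Z ^+ 2)%:~R * t.
      by rewrite rmorphD !rmorphM /= /Y -[t *+ e0]mulr_natl; ring.
    by rewrite ler_wpM2r ?(ltW t0) // ler_int.
  have h1 : A * Y <= A ^+ 2 * Y by rewrite ler_wpM2r //; nra.
  have h2 : A ^+ 2 * t <= A ^+ 2 by rewrite ler_piMr // ltW // exprn_gt0 //; lra.
  by rewrite /w; nra.
have tD : t * `|D|%:~R = dl / N%:R.
  by rewrite /dl /t; field; rewrite gt_eqF.
rewrite tD in XB.
set v := N%:R^-1 : F.
have v0 : 0 < v by rewrite invr_gt0.
have v1 : v <= 1 by rewrite invf_le1 // ler1n.
have tv : t = v ^+ 2 by rewrite /v exprVn.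
have nv : N%:R ^- 3 = v ^+ 3 by rewrite /v exprVn.
rewrite nv; rewrite -/v in XB; rewrite tv in rB.
set Z := (X - 1) ^+ 3 + _ + _.
have HZ : `|Z| <= W ^+ 3 * w ^+ 3 * (1 + 6 * A + 12 * A ^+ 2) * v ^+ 3.
  by apply: (@third_diff_factor_bound W w A v dl r X); rewrite ?X0 ?v0 ?dl0 ?r01 //.
have HG := gauss_decay e0; rewrite -/f -/Y in HG.
have Y1 : 0 < 1 + Y by lra.
have C0 : 0 <= W ^+ 3 * (8 * A ^+ 2) ^+ 3 * (1 + 6 * A + 12 * A ^+ 2) * v ^+ 3.
  by rewrite !mulr_ge0 ?exprn_ge0 ?mulr_ge0 ?exprn_ge0 //; nra.
apply: (@le_trans _ _ (W ^+ 3 * (8 * A ^+ 2) ^+ 3 * (1 + 6 * A + 12 * A ^+ 2) * v ^+ 3 * (f * (1 + Y) ^+ 5))).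
  have -> : W ^+ 3 * (8 * A ^+ 2) ^+ 3 * (1 + 6 * A + 12 * A ^+ 2) * v ^+ 3 * (f * (1 + Y) ^+ 5)
    = f * (W ^+ 3 * w ^+ 3 * (1 + 6 * A + 12 * A ^+ 2) * v ^+ 3) * (1 + Y) ^+ 2.
    by rewrite /w; ring.
  rewrite ler_wpM2r ?exprn_ge0 ?(ltW Y1) //.
  by rewrite ler_wpM2l // ltW.
have -> : third_diff_const a * v ^+ 3 = W ^+ 3 * (8 * A ^+ 2) ^+ 3 * (1 + 6 * A + 12 * A ^+ 2) * v ^+ 3 * 5 ^+ 5.
  by rewrite /third_diff_const -/W -/A; ring.
by rewrite ler_wpM2l.
Qed.

(** A summable weight of mass O(N), replacing a Gaussian of width N: a product of two
    of these bounds the decay of a bump in the plane. *)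
Definition nu (m : int) : F := (1 + t * (m ^+ 2)%:~R)^-1.

Lemma nu_den_gt0 (m : int) : 0 < 1 + t * (m ^+ 2)%:~R.
Proof. by apply: ltr_wpDr; rewrite // mulr_ge0 ?(ltW step_gt0) // ler0z sqr_ge0. Qed.

Lemma nu_ge0 m : 0 <= nu m.
Proof. by rewrite invr_ge0 ltW // nu_den_gt0. Qed.

(** v^2 / (v^2 + l^2) is dominated by a telescoping difference of 1 / (v + l). *)
Lemma sum_nu_nat (L : nat) : \sum_(i < L) nu i%:Z <= 3 * N%:R.
Proof.
have N1 : 1 <= N%:R :> F by rewrite ler1n.
set v : F := N%:R in N1 *.
have v0 : 0 < v by lra.
suff H : \sum_(i < L.+1) nu i%:Z <= 1 + 2 * v - 2 * v ^+ 2 / (v + L%:R).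
  have : \sum_(i < L) nu i%:Z <= \sum_(i < L.+1) nu i%:Z by rewrite big_ord_recr lerDl nu_ge0.
  have : 0 <= 2 * v ^+ 2 / (v + L%:R) by rewrite divr_ge0 ?addr_ge0 ?mulr_ge0 ?sqr_ge0 ?ler0n // ltW.
  lra.
elim: L => [|L IH].
  rewrite big_ord1 addr0 /nu expr0n mulr0 addr0 invr1.
  have -> : 2 * v ^+ 2 / v = 2 * v by field; rewrite gt_eqF.
  lra.
rewrite big_ord_recr /=; set S := \sum_(_ < _) _ in IH *.
have -> : nu L.+1%:Z = v ^+ 2 / (v ^+ 2 + L.+1%:R ^+ 2).
  rewrite /nu; have -> : (L.+1%:Z ^+ 2)%:~R = L.+1%:R ^+ 2 :> F by rewrite rmorphXn.
  rewrite /t -/v; field.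
  have d4 : 0 < N%:R ^+ 2 + (1 + L%:R) ^+ 2 :> F by rewrite ltr_pwDl ?exprn_gt0 // sqr_ge0.
  by rewrite (gt_eqF d4) (gt_eqF v0).
have -> : L.+1%:R = L%:R + 1 :> F by rewrite -natr1.
set l : F := L%:R in IH *; have l0 : 0 <= l by rewrite ler0n.
have d1 : 0 < v + l by lra.
have d2 : 0 < v + (l + 1) by lra.
have d3 : 0 < v ^+ 2 + (l + 1) ^+ 2 by rewrite ltr_pwDl ?exprn_gt0 // sqr_ge0.
have key : v ^+ 2 / (v ^+ 2 + (l + 1) ^+ 2) <= 2 * v ^+ 2 / (v + l) - 2 * v ^+ 2 / (v + (l + 1)).
  have -> : 2 * v ^+ 2 / (v + l) - 2 * v ^+ 2 / (v + (l + 1)) =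
     v ^+ 2 * (2 / ((v + l) * (v + (l + 1)))).
    by field; rewrite !gt_eqF.
  rewrite ler_wpM2l ?sqr_ge0 // -[X in X <= _]mul1r ler_pdivrMr // mulrAC.
  rewrite ler_pdivlMr ?mulr_gt0 // mul1r.
  have := sqr_ge0 (v - l - 1); rewrite !expr2; nra.
lra.
Qed.

Lemma nuN m : nu (- m) = nu m. Proof. by rewrite /nu sqrrN. Qed.

Lemma sum_nu_shift (L c : nat) : (c <= L)%N -> \sum_(i < L) nu (i%:Z - c%:Z) <= 6 * N%:R.
Proof.
move=> cL; rewrite -(big_mkord xpredT (fun i => nu (i%:Z - c%:Z))) (@big_cat_nat _ _ _ c) //=.
have -> : 6 * N%:R = 3 * N%:R + 3 * N%:R :> F by ring.
apply: lerD.
  rewrite big_mkord (reindex_inj rev_ord_inj) /=.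
  apply: le_trans (sum_nu_nat c.+1); rewrite big_ord_recl.
  apply: ler_wpDl; first exact: nu_ge0.
  rewrite le_eqVlt; apply/orP; left; apply/eqP; apply: eq_bigr => i _.
  by rewrite -nuN; congr nu; have := ltn_ord i; rewrite /= /bump /=; lia.
rewrite -{1}[c]add0n big_addn big_mkord.
apply: le_trans (sum_nu_nat (L - c)); rewrite le_eqVlt; apply/orP; left; apply/eqP.
by apply: eq_bigr => i _; congr nu; lia.
Qed.

End Gauss.

(** * Theta sums of positive definite binary forms *)

Definition qform (a : nat) (b : int) (c : nat) (m k : int) : nat :=
  absz (a%:Z * m ^+ 2 + b * m * k + c%:Z * k ^+ 2).

Definition posdef (a : nat) (b : int) (c : nat) : Prop :=
  [/\ (0 < a)%N, (0 < c)%N & b ^+ 2 < 4 * a%:Z * c%:Z].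

Lemma posdefC a b c : posdef a b c -> posdef c b a.
Proof. by case=> a0 c0 H; split=> //; lia. Qed.

Lemma qformC a b c m k : qform a b c m k = qform c b a k m.
Proof. by rewrite /qform; congr (absz _); ring. Qed.

Lemma qform_disc a b c m k : posdef a b c ->
  4 * a%:Z * (qform a b c m k)%:Z = (2 * a%:Z * m + b * k) ^+ 2 + (4 * a%:Z * c%:Z - b ^+ 2) * k ^+ 2.
Proof.
case=> a0 c0 H; rewrite /qform.
have E : 4 * a%:Z * (a%:Z * m ^+ 2 + b * m * k + c%:Z * k ^+ 2) =
   (2 * a%:Z * m + b * k) ^+ 2 + (4 * a%:Z * c%:Z - b ^+ 2) * k ^+ 2 by ring.
rewrite gez0_abs //.
have : 0 <= (2 * a%:Z * m + b * k) ^+ 2 + (4 * a%:Z * c%:Z - b ^+ 2) * k ^+ 2.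
  by rewrite addr_ge0 ?sqr_ge0 // mulr_ge0 ?sqr_ge0 //; lia.
by rewrite -E pmulr_rge0 //; lia.
Qed.

Lemma qformE a b c m k : posdef a b c ->
  (qform a b c m k)%:Z = a%:Z * m ^+ 2 + b * m * k + c%:Z * k ^+ 2.
Proof.
move=> P; have := qform_disc m k P; case: P => a0 _ _ E.
apply: (@mulfI _ (4 * a%:Z)); first by lia.
by rewrite E; ring.
Qed.

(** Completing the square; such bounds confine the vectors of given norm to a box. *)
Lemma qform_gek a b c m k : posdef a b c -> k ^+ 2 <= 4 * a%:Z * (qform a b c m k)%:Z.
Proof.
move=> P; rewrite qform_disc //; case: P => _ _ H.
have := sqr_ge0 (2 * a%:Z * m + b * k); have := sqr_ge0 k.
set u := k ^+ 2; set w := (_ + _) ^+ 2; nia.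
Qed.

Lemma qform_gem a b c m k : posdef a b c -> m ^+ 2 <= 4 * c%:Z * (qform a b c m k)%:Z.
Proof. by move=> /posdefC P; rewrite qformC; exact: qform_gek. Qed.

Lemma qform_ge2 a b c m k : posdef a b c ->
  (2 * a%:Z * m + b * k) ^+ 2 <= 4 * a%:Z * (qform a b c m k)%:Z.
Proof.
move=> P; rewrite qform_disc // lerDl; case: P => _ _ H.
by rewrite mulr_ge0 ?sqr_ge0 //; lia.
Qed.

Section Theta.
Variables (F : realFieldType) (N : nat).
Hypothesis N_gt0 : (0 < N)%N.
Let t : F := N%:R ^- 2.
Let q : F := (1 + t)^-1.

(** The form dominates both m^2 and k^2, so the decay in its value splits into
    decay in each coordinate. *)
Lemma qform_nu (a : nat) (b : int) (c : nat) (m k : int) : posdef a b c ->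
  1 <= 16 * a%:R * c%:R * nu F N m * nu F N k * (1 + t *+ qform a b c m k) ^+ 2.
Proof.
move=> P; have t0 : 0 < t := step_gt0 F N_gt0.
have Hk := qform_gek m k P; have Hm := qform_gem m k P.
set e := qform a b c m k in Hk Hm *.
case: P => a0 c0 _.
have aux (u : nat) (z : int) : (0 < u)%N -> z ^+ 2 <= 4 * u%:Z * e%:Z ->
    1 <= 4 * u%:R * nu F N z * (1 + t *+ e).
  move=> u0 Hz; rewrite /nu mulrAC ler_pdivlMr ?nu_den_gt0 // mul1r -/t.
  have H1 : (z ^+ 2)%:~R <= 4 * u%:R * e%:R :> F.
    have -> : 4 * u%:R * e%:R = (4 * u%:Z * e%:Z)%:~R :> F by rewrite !rmorphM.
    by rewrite ler_int.
  have u1 : 1 <= u%:R :> F by rewrite ler1n.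
  have H2 : t * (z ^+ 2)%:~R <= t * (4 * u%:R * e%:R) by rewrite ler_wpM2l // ltW.
  rewrite -[t *+ e]mulr_natr; nra.
have Ha := aux _ _ a0 Hk; have Hc := aux _ _ c0 Hm.
have -> : 16 * a%:R * c%:R * nu F N m * nu F N k * (1 + t *+ e) ^+ 2 =
  (4 * a%:R * nu F N k * (1 + t *+ e)) * (4 * c%:R * nu F N m * (1 + t *+ e)) by ring.
by have := ler_pM ler01 ler01 Ha Hc; rewrite mulr1.
Qed.

(** The increment D of the form along m may have any sign. If it is very negative,
    the four values are read backwards, from m + 3 down to m. *)
Lemma third_diff_qform (a : nat) (b : int) (c : nat) (m k : int) : posdef a b c ->
  `|q ^+ qform a b c (m + 3) k - 3 * q ^+ qform a b c (m + 2) k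
    + 3 * q ^+ qform a b c (m + 1) k - q ^+ qform a b c m k| <=
  16 * a%:R * c%:R * (third_diff_const F a * N%:R ^- 3) *
    ((nu F N m + nu F N (m + 3)) * nu F N k).
Proof.
move=> P; set T := `|_|.
have a0 : (0 < a)%N by case: P.
have T0 : 0 <= T by rewrite normr_ge0.
have fin (z : int) : T * (1 + t *+ qform a b c z k) ^+ 2 <= third_diff_const F a * N%:R ^- 3 ->
    T <= 16 * a%:R * c%:R * (third_diff_const F a * N%:R ^- 3) * (nu F N z * nu F N k).
  move=> H; have := qform_nu z k P; set w := (1 + _) ^+ 2 in H * => H1.
  apply: (@le_trans _ _ (T * (16 * a%:R * c%:R * nu F N z * nu F N k * w))).
    by rewrite ler_peMr.
  have -> : T * (16 * a%:R * c%:R * nu F N z * nu F N k * w) =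
    (16 * a%:R * c%:R * nu F N z * nu F N k) * (T * w) by ring.
  have -> : 16 * a%:R * c%:R * (third_diff_const F a / N%:R ^+ 3) * (nu F N z * nu F N k)
    = 16 * a%:R * c%:R * nu F N z * nu F N k * (third_diff_const F a / N%:R ^+ 3) by ring.
  by rewrite ler_wpM2l // !mulr_ge0 ?nu_ge0 ?ler0n.
have n1 := nu_ge0 F N_gt0 m; have n2 := nu_ge0 F N_gt0 (m + 3).
have n3 := nu_ge0 F N_gt0 k.
have K0 : 0 <= 16 * a%:R * c%:R * (third_diff_const F a / N%:R ^+ 3).
  have A0 : 0 <= a%:R :> F by rewrite ler0n.
  rewrite !mulr_ge0 ?ler0n ?invr_ge0 ?exprn_ge0 ?mulr_ge0 ?exprn_ge0 ?ler0n //.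
  by rewrite !addr_ge0 ?mulr_ge0 ?exprn_ge0.
set e := qform a b c.
have E z : (e z k)%:Z = a%:Z * z ^+ 2 + b * z * k + c%:Z * k ^+ 2 by apply: qformE.
pose D : int := a%:Z * (2 * m + 1) + b * k.
have [HD|HD] := lerP (- (4 * a)%N%:Z) D.
- apply: (le_trans (fin m _)).
    apply: (@third_diff_bound F N N_gt0 a _ _ _ _ D) => //.
    + by rewrite !E /D; ring.
    + by rewrite !E /D; ring.
    + by rewrite !E /D; ring.
    have := qform_ge2 m k P; rewrite -/e.
    have := sqr_ge0 (2 * a%:Z * m + b * k - a%:Z).
    have -> : D = (2 * a%:Z * m + b * k) + a%:Z by rewrite /D; ring.
    move: (2 * a%:Z * m + b * k) (e m k) => z g; rewrite !expr2; nia.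
  by rewrite ler_wpM2l // ler_wpM2r // lerDl.
apply: (le_trans (fin (m + 3) _)); last by rewrite ler_wpM2l // ler_wpM2r // lerDr.
(* the reversed sequence has increment - (D + 4 a) > 0 *)
have -> : T = `|q ^+ e m k - 3 * q ^+ e (m + 1) k + 3 * q ^+ e (m + 2) k - q ^+ e (m + 3) k|.
  by rewrite /T -normrN; congr (`|_|); ring.
apply: (@third_diff_bound F N N_gt0 a _ _ _ _ (- (D + 4 * a%:Z))) => //.
- by rewrite !E /D; ring.
- by rewrite !E /D; ring.
- by rewrite !E /D; ring.
- by move: HD; lia.
have := qform_ge2 (m + 3) k P; rewrite -/e.
have := sqr_ge0 (2 * a%:Z * (m + 3) + b * k + a%:Z).
have -> : - (D + 4 * a%:Z) = a%:Z - (2 * a%:Z * (m + 3) + b * k) by rewrite /D; ring.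
move: (2 * a%:Z * (m + 3) + b * k) (e (m + 3) k) => z g; rewrite !expr2; nia.
Qed.

(** The third differences cost N^-3 and the weights along the line give back a
    factor N, so that after summation over the other coordinate the whole
    alternating sum is O(1 / N). The term q ^ M is the contribution of the boundary
    of the box. *)
Lemma inner_alternating (a : nat) (b : int) (c M B : nat) (k : int) : posdef a b c ->
  (4 * c * M + 3 <= B)%N ->
  8 * `|\sum_(i < (2 * B).+1) (-1) ^+ i * q ^+ qform a b c (i%:Z - B%:Z) k| <=
  16 * a%:R * c%:R * (third_diff_const F a * N%:R ^- 3) * (12 * N%:R * nu F N k)
  + 24 * q ^+ M.
Proof.
move=> P HB.
have q0 : 0 < q := q_gt0 F N_gt0.
have q1 : q < 1 := q_lt1 F N_gt0.
have bd (i : nat) : (i < 3)%N || ((2 * B).+1 <= i)%N ->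
    `|q ^+ qform a b c (i%:Z - B%:Z) k| <= q ^+ M.
  move=> Hi; rewrite ger0_norm ?exprn_ge0 ?(ltW q0) //.
  apply: ler_wiXn2l; rewrite ?(ltW q0) ?(ltW q1) //.
  have := qform_gem (i%:Z - B%:Z) k P; case: P => _ c0 _.
  set e := qform _ _ _ _ _ => He.
  have : (B%:Z - 2) ^+ 2 <= (i%:Z - B%:Z) ^+ 2.
    rewrite !expr2; case/orP: Hi => Hi; nia.
  move=> H2.
  have : (B%:Z - 2) ^+ 2 <= 4 * c%:Z * e%:Z by apply: le_trans He.
  rewrite expr2 => H3; have H4 : (4 * c%:Z * M%:Z + 1) <= B%:Z - 2 by lia.
  have H5 : (4 * c%:Z * M%:Z + 1) * (4 * c%:Z * M%:Z + 1) <= 4 * c%:Z * e%:Z.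
    apply: le_trans H3; apply: ler_pM => //; nia.
  (* near the ends of the line |m| >= B - 2, where the form exceeds M *)
  have [//|H6] := leqP M e; exfalso; nia.
have := @alternating_bound F (fun i => q ^+ qform a b c (i%:Z - B%:Z) k) (2 * B).+1 (q ^+ M).
move=> H; apply: (le_trans (H _ _)).
- by move=> i Hi; apply: bd; rewrite Hi.
- by move=> i /andP [Hi _]; apply: bd; rewrite Hi orbT.
rewrite lerD2r.
apply: (@le_trans _ _ (\sum_(i < (2 * B).+1) 16 * a%:R * c%:R * (third_diff_const F a * N%:R ^- 3) *
    ((nu F N (i%:Z - B%:Z) + nu F N (i%:Z - (B - 3)%N%:Z)) * nu F N k))).
  apply: ler_sum => i _.
  have := third_diff_qform (i%:Z - B%:Z) k P.
  have -> : i%:Z - B%:Z + 3 = i.+3%:Z - B%:Z by lia.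
  have -> : i%:Z - B%:Z + 2 = i.+2%:Z - B%:Z by lia.
  have -> : i%:Z - B%:Z + 1 = i.+1%:Z - B%:Z by lia.
  by have -> : i.+3%:Z - B%:Z = i%:Z - (B - 3)%N%:Z by lia.
rewrite -mulr_sumr -mulr_suml big_split /=.
apply: ler_wpM2l.
  have A0 : 0 <= a%:R :> F by rewrite ler0n.
  rewrite !mulr_ge0 ?ler0n ?invr_ge0 ?exprn_ge0 ?mulr_ge0 ?exprn_ge0 ?ler0n //.
  by rewrite !addr_ge0 ?mulr_ge0 ?exprn_ge0.
apply: ler_wpM2r; first exact: nu_ge0.
have -> : 12 * N%:R = 6 * N%:R + 6 * N%:R :> F by ring.
by apply: lerD; apply: sum_nu_shift => //; lia.
Qed.

Lemma alternating_box (a : nat) (b : int) (c M B : nat) : posdef a b c ->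
  (4 * c * M + 3 <= B)%N ->
  \sum_(j < (2 * B).+1)
    `|\sum_(i < (2 * B).+1) (-1) ^+ i * q ^+ qform a b c (i%:Z - B%:Z) (j%:Z - B%:Z)| <=
  144 * a%:R * c%:R * third_diff_const F a / N%:R + 3 * (2 * B).+1%:R * q ^+ M.
Proof.
move=> P HB.
have N0 : 0 < N%:R :> F by rewrite ltr0n.
rewrite -(ler_pM2l (_ : 0 < 8)) // mulr_sumr.
have H (j : 'I_(2 * B).+1) := inner_alternating (j%:Z - B%:Z) P HB.
apply: (le_trans (ler_sum _ (fun j _ => H j))).
rewrite big_split /= sumr_const card_ord -mulr_sumr -mulr_sumr.
have HS : \sum_(j < (2 * B).+1) nu F N (j%:Z - B%:Z) <= 6 * N%:R.
  by apply: sum_nu_shift => //; lia.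
have A0 : 0 <= a%:R :> F by rewrite ler0n.
have K0 : 0 <= 16 * a%:R * c%:R * (third_diff_const F a / N%:R ^+ 3).
  rewrite !mulr_ge0 ?ler0n ?invr_ge0 ?exprn_ge0 ?mulr_ge0 ?exprn_ge0 ?ler0n //.
  by rewrite !addr_ge0 ?mulr_ge0 ?exprn_ge0.
apply: (@le_trans _ _ (16 * a%:R * c%:R * (third_diff_const F a / N%:R ^+ 3) *
   (12 * N%:R * (6 * N%:R)) + (24 * q ^+ M) *+ (2 * B).+1)).
  by rewrite lerD2r; apply: ler_wpM2l => //; apply: ler_wpM2l => //; rewrite mulr_ge0 // ltW.
rewrite -[X in _ + X]mulr_natl le_eqVlt; apply/orP; left; apply/eqP.
by field; rewrite gt_eqF.
Qed.

(** The theta series of the form f, cut off to the box of side 2 B + 1. *)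
Definition theta (z : F) (f : nat * int * nat) (B : nat) : F :=
  \sum_(i < (2 * B).+1) \sum_(j < (2 * B).+1)
    z ^+ qform f.1.1 f.1.2 f.2 (i%:Z - B%:Z) (j%:Z - B%:Z).

Lemma sum_even_terms (g : nat -> F) L :
  \sum_(i < (2 * L).+1) (1 + (-1) ^+ i) * g i = 2 * \sum_(i < L.+1) g (2 * i)%N.
Proof.
elim: L => [|L IH]; first by rewrite !big_ord1 expr0.
rewrite [in RHS]big_ord_recr /= mulrDr -IH.
have -> : (2 * L.+1).+1 = (2 * L).+3 by lia.
rewrite !big_ord_recr /= -addrA; congr (_ + _).
have -> : (2 * L.+1 = (2 * L).+2)%N by lia.
have s2 : (-1) ^+ (2 * L) = 1 :> F by rewrite exprM sqrrN !expr1n.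
by rewrite !exprS s2; ring.
Qed.

Definition theta_const (f : nat * int * nat) : F :=
  144 * f.1.1%:R * f.2%:R * (third_diff_const F f.1.1 + 2 * third_diff_const F f.2).

Lemma theta_const_ge0 f : 0 <= theta_const f.
Proof.
rewrite /theta_const mulr_ge0 ?mulr_ge0 ?ler0n //.
apply: addr_ge0; first exact: third_diff_const_ge0.
by apply: mulr_ge0 => //; exact: third_diff_const_ge0.
Qed.

(** The Jacobi-type fact behind the class number formula: 4 theta(q^4) - theta(q)
    tends to 0 as q tends to 1. Indeed theta(q^4) is the sum over vectors with both
    coordinates even, so the difference is a sum of three alternating sums, with
    signs (-1)^m, (-1)^k and (-1)^(m+k). This avoids the asymptotics pi / t of theta
    itself. *)
Lemma theta_dilation (f : nat * int * nat) (M B : nat) : posdef f.1.1 f.1.2 f.2 ->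
  (4 * (f.1.1 + f.2) * M + 3 <= 2 * B)%N ->
  `|4 * theta (q ^+ 4) f B - theta q f (2 * B)| <=
  theta_const f / N%:R + 9 * (2 * (2 * B)).+1%:R * q ^+ M.
Proof.
case: f => [[a b] c] /= P HB; rewrite /theta_const /=.
set L := (2 * B)%N in HB *.
pose G i j := q ^+ qform a b c (i%:Z - L%:Z) (j%:Z - L%:Z).
have E : 4 * theta (q ^+ 4) (a, b, c) B =
    \sum_(i < (2 * L).+1) \sum_(j < (2 * L).+1) (1 + (-1) ^+ i) * ((1 + (-1) ^+ j) * G i j).
  under eq_bigr do rewrite -mulr_sumr.
  rewrite (sum_even_terms (fun i => \sum_(j < (2 * L).+1) (1 + (-1) ^+ j) * G i j)) -/L.
  under eq_bigr do rewrite sum_even_terms -/L.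
  rewrite -mulr_sumr mulrA -natrM; congr (_ * _).
  apply: eq_bigr => i _; apply: eq_bigr => j _ /=.
  rewrite /G -exprM; congr (_ ^+ _); apply: (@can_inj _ _ Posz absz) => //.
  rewrite PoszM !qformE // /L; have -> : ((2 * i)%N%:Z - (2 * B)%N%:Z) = 2 * (i%:Z - B%:Z) by lia.
  have -> : ((2 * j)%N%:Z - (2 * B)%N%:Z) = 2 * (j%:Z - B%:Z) by lia.
  ring.
have -> : theta q (a, b, c) L = \sum_(i < (2 * L).+1) \sum_(j < (2 * L).+1) G i j by [].
rewrite E -sumrB.
have -> : \sum_(i < (2 * L).+1) (\sum_(j < (2 * L).+1) (1 + (-1) ^+ i) * ((1 + (-1) ^+ j) * G i j)
    - \sum_(j < (2 * L).+1) G i j) =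
  \sum_(i < (2 * L).+1) (-1) ^+ i * (\sum_(j < (2 * L).+1) (-1) ^+ j * G i j)
  + \sum_(i < (2 * L).+1) \sum_(j < (2 * L).+1) (-1) ^+ j * G i j
  + \sum_(j < (2 * L).+1) \sum_(i < (2 * L).+1) (-1) ^+ i * G i j.
  rewrite [X in _ + X]exchange_big /= -!big_split /=; apply: eq_bigr => i _.
  by rewrite mulr_sumr -sumrB -!big_split /=; apply: eq_bigr => j _; ring.
have H1 : \sum_(j < (2 * L).+1) `|\sum_(i < (2 * L).+1) (-1) ^+ i * G i j| <= 
   144 * a%:R * c%:R * third_diff_const F a / N%:R + 3 * (2 * L).+1%:R * q ^+ M.
  by apply: alternating_box => //; nia.
have H2 : \sum_(i < (2 * L).+1) `|\sum_(j < (2 * L).+1) (-1) ^+ j * G i j| <= 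
   144 * c%:R * a%:R * third_diff_const F c / N%:R + 3 * (2 * L).+1%:R * q ^+ M.
  apply: le_trans (alternating_box (posdefC P) _); last by nia.
  rewrite le_eqVlt; apply/orP; left; apply/eqP.
  by apply: eq_bigr => i _; congr (`|_|); apply: eq_bigr => j _; rewrite /G qformC.
set S1 := \sum_(i < _) _ * _; set S2 := \sum_(i < _) \sum_(j < _) (-1) ^+ j * _.
set S3 := \sum_(i < _) _.
have B1 : `|S1| <= 144 * c%:R * a%:R * third_diff_const F c / N%:R + 3 * (2 * L).+1%:R * q ^+ M.
  apply: le_trans H2; apply: (le_trans (ler_norm_sum _ _ _)); apply: ler_sum => i _.
  by rewrite normrM normrX normrN1 expr1n mul1r.
have B2 : `|S2| <= 144 * c%:R * a%:R * third_diff_const F c / N%:R + 3 * (2 * L).+1%:R * q ^+ M.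
  by apply: le_trans H2; apply: ler_norm_sum.
have B3 : `|S3| <= 144 * a%:R * c%:R * third_diff_const F a / N%:R + 3 * (2 * L).+1%:R * q ^+ M.
  by apply: le_trans H1; apply: ler_norm_sum.
apply: (le_trans (ler_normD _ _)).
apply: (le_trans (lerD (ler_normD _ _) (lexx _))).
apply: (le_trans (lerD (lerD B1 B2) B3)).
rewrite le_eqVlt; apply/orP; left; apply/eqP.
by field; rewrite pnatr_eq0; lia.
Qed.

End Theta.

(** * Lambert series and Abel means of periodic sequences *)

Section Lambert.
Variable F : realFieldType.
Implicit Type z : F.

Definition divisor_sum (u : nat -> F) (n : nat) : F := \sum_(d < n | (d.+1 %| n)%N) u d.+1.

Lemma geometric_multiples z (e M : nat) : (0 < e)%N -> 0 <= z < 1 ->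
  \sum_(n < M | (e %| n.+1)%N) z ^+ n.+1 = (z ^+ e - z ^+ (e * (M %/ e).+1)) / (1 - z ^+ e).
Proof.
move=> e0 /andP [z0 z1].
have ze : 1 - z ^+ e != 0 by rewrite subr_eq0 eq_sym lt_eqF // exprn_ilt1 // -lt0n.
elim: M => [|M IH]; first by rewrite big_ord0 div0n muln1 subrr mul0r.
rewrite big_mkcond big_ord_recr -big_mkcond /= IH divnS //.
case: (boolP (e %| M.+1)%N) => H; last by rewrite addr0 add0n.
have -> : M.+1 = (e * (M %/ e).+1)%N.
  by rewrite -[LHS](divnK H) divnS // H mulnC add1n.
rewrite add1n [in RHS]mulnS exprD; set w := z ^+ (e * _).
by field.
Qed.

(** The Lambert series of u, truncated at M, against the truncated power series of
    its divisor sums. *)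
Lemma lambert_truncation (u : nat -> F) z (M : nat) : (forall d, `|u d| <= 1) -> 0 <= z < 1 ->
  `|\sum_(n < M) divisor_sum u n.+1 * z ^+ n.+1 -
    \sum_(d < M) u d.+1 * (z ^+ d.+1 / (1 - z ^+ d.+1))| <= M%:R * z ^+ M / (1 - z).
Proof.
move=> u1 z01; have /andP [z0 z1] := z01.
have -> : \sum_(n < M) divisor_sum u n.+1 * z ^+ n.+1 =
  \sum_(d < M) u d.+1 * \sum_(n < M | (d.+1 %| n.+1)%N) z ^+ n.+1.
  transitivity (\sum_(n < M) \sum_(d < M | (d.+1 %| n.+1)%N) u d.+1 * z ^+ n.+1).
    apply: eq_bigr => n _; rewrite /divisor_sum mulr_suml.
    rewrite (big_ord_widen_cond M (fun d => (d.+1 %| n.+1)%N) (fun d => u d.+1 * z ^+ n.+1)) //.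
    by apply: eq_bigl => d; rewrite andb_idr // => /dvdn_leq; apply.
  rewrite (exchange_big_dep xpredT) //=; apply: eq_bigr => d _.
  by rewrite mulr_sumr.
rewrite -sumrB.
have -> : M%:R * z ^+ M / (1 - z) = \sum_(d < M) z ^+ M / (1 - z).
  by rewrite sumr_const card_ord -[RHS]mulr_natl mulrA.
apply: (le_trans (ler_norm_sum _ _ _)); apply: ler_sum => d _.
rewrite geometric_multiples // -mulrBr normrM.
set e := d.+1; set k := (e * _)%N.
have ze : 0 < 1 - z ^+ e by rewrite subr_gt0 exprn_ilt1.
have -> : (z ^+ e - z ^+ k) / (1 - z ^+ e) - z ^+ e / (1 - z ^+ e) = - (z ^+ k / (1 - z ^+ e)).
  by field; rewrite gt_eqF.
rewrite [X in _ * X]normrN [X in _ * X]ger0_norm; last by rewrite divr_ge0 ?exprn_ge0 // ltW.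
rewrite -[X in _ <= X]mul1r; apply: ler_pM => //.
  by rewrite divr_ge0 ?exprn_ge0 // ltW.
apply: ler_pM; rewrite ?exprn_ge0 // ?invr_ge0 ?(ltW ze) //.
  apply: ler_wiXn2l => //; first exact: ltW.
  rewrite /k /e; have := divn_eq M d.+1; have := ltn_mod M d.+1; rewrite /= => H1 H2; nia.
have z1' : 0 < 1 - z by rewrite subr_gt0.
rewrite lef_pV2 ?posrE //.
have : z ^+ e <= z ^+ 1 by apply: ler_wiXn2l => //; exact: ltW.
by rewrite expr1; lra.
Qed.

(** In the combination of [theta_dilation] the poles at z = 1 cancel, leaving
    bounded functions of z. *)
Lemma lambert_combination z : 0 < z < 1 ->
  4 * (z ^+ 4 / (1 - z ^+ 4)) - z / (1 - z) = - (z / (1 + z) + 2 * (z ^+ 2 / (1 + z ^+ 2))).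
Proof.
move=> /andP [z0 z1].
have h1 : 1 - z != 0 by rewrite subr_eq0 gt_eqF.
have h2 : 1 + z != 0 by rewrite gt_eqF //; lra.
have h3 : 1 + z ^+ 2 != 0 by rewrite gt_eqF // ltr_pwDl ?sqr_ge0.
have h4 : 1 - z ^+ 4 != 0.
  have -> : 1 - z ^+ 4 = (1 - z) * (1 + z) * (1 + z ^+ 2) by ring.
  by rewrite !mulf_neq0.
by field; rewrite h1 h2 h3 h4.
Qed.

End Lambert.

Section PeriodicSums.
Variables (F : realFieldType) (p : nat).
Hypothesis p_gt0 : (0 < p)%N.

(** The partial sums of a periodic sequence of mean zero are periodic. *)
Lemma periodic_psum_bounded (u : nat -> F) : (forall i, u (i + p)%N = u i) ->
  \sum_(i < p) u i = 0 -> exists2 K, 0 <= K & forall i, `|\sum_(j < i) u j| <= K.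
Proof.
move=> up u0; pose S i := \sum_(j < i) u j.
have Sp i : S (i + p)%N = S i.
  elim: i => [|i IH]; first by rewrite add0n /S big_ord0.
  by rewrite addSn /S !big_ord_recr /= up; congr (_ + _); exact: IH.
exists (\sum_(i < p) `|S i|); first by apply: sumr_ge0 => i _; exact: normr_ge0.
move=> i; rewrite -/(S i).
have -> : S i = S (i %% p)%N.
  rewrite {1}(divn_eq i p) addnC; elim: (i %/ p)%N => [|k IH]; first by rewrite mul0n addn0.
  by rewrite mulSn addnCA addnC Sp.
rewrite (bigD1 (Ordinal (ltn_pmod i p_gt0))) //= lerDl.
by apply: sumr_ge0 => j _; exact: normr_ge0.
Qed.

(** Abel summation twice: the sum of u g is close to g 0 times the mean of the
    partial sums of u. Convexity of g makes its first differences decreasing, as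
    the second summation requires. *)
Lemma periodic_abel (u : nat -> F) : (forall i, u (i + p)%N = u i) -> \sum_(i < p) u i = 0 ->
  exists2 K, 0 <= K & forall (g : nat -> F) (M : nat),
    (forall i, 0 <= g i) -> (forall i, g i.+1 <= g i) ->
    (forall i, g i.+1 - g i.+2 <= g i - g i.+1) ->
    `|p%:R * (\sum_(i < M) u i * g i) - (\sum_(i < p) \sum_(j < i.+1) u j) * g 0%N| <=
    K * (g 0%N - g 1%N + g M).
Proof.
move=> up u0; have [K0 K00 HK0] := periodic_psum_bounded up u0.
set C := \sum_(i < p) _.
(* c is the periodic sequence of partial sums, recentred to have mean zero and
   multiplied by p to avoid a division *)
pose c i := p%:R * (\sum_(j < i.+1) u j) - C.
have cp i : c (i + p)%N = c i.
  rewrite /c; congr (_ * _ - _).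
  elim: i => [|i IH]; last by rewrite addSn big_ord_recr [in RHS]big_ord_recr /= IH -addSn up.
  by rewrite add0n big_ord_recr /= u0 add0r -[p]add0n up big_ord1.
have c0 : \sum_(i < p) c i = 0.
  by rewrite /c sumrB -mulr_sumr -/C sumr_const card_ord mulr_natl subrr.
have [K1 K10 HK1] := periodic_psum_bounded cp c0.
exists (K1 + `|C| + p%:R * K0).
  by rewrite !addr_ge0 // mulr_ge0 // ler0n.
move=> g M g0 gd gc.
rewrite abel_sum mulrDr mulr_sumr.
have -> : \sum_(i < M) p%:R * ((\sum_(j < i.+1) u j) * (g i - g i.+1)) =
  \sum_(i < M) c i * (g i - g i.+1) + C * (g 0%N - g M).
  rewrite -telescope_decr mulr_sumr -big_split /=; apply: eq_bigr => i _.
  by rewrite /c; ring.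
have HA : `|\sum_(i < M) c i * (g i - g i.+1)| <= K1 * (g 0%N - g 1%N).
  apply: (@abel_bound F c (fun i => g i - g i.+1)) => // i.
  by rewrite subr_ge0.
set A := \sum_(i < M) c i * _ in HA *; set U := \sum_(i < M) u i.
have -> : p%:R * (U * g M) + (A + C * (g 0%N - g M)) - C * g 0%N = A + (p%:R * U - C) * g M by ring.
apply: (le_trans (ler_normD _ _)).
have HU : `|(p%:R * U - C) * g M| <= (p%:R * K0 + `|C|) * g M.
  rewrite normrM [ `|g M|]ger0_norm // ler_wpM2r //.
  apply: (le_trans (ler_normB _ _)); rewrite lerD2r normrM normr_nat.
  by rewrite ler_wpM2l ?ler0n // HK0.
have d1 : 0 <= g 0%N - g 1%N by rewrite subr_ge0.
have d2 := g0 M; have d3 : 0 <= p%:R * K0 by rewrite mulr_ge0 ?ler0n.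
have d4 := normr_ge0 C.
set N := `|C| in HU d4 *; set v := p%:R * K0 in HU d3 *; nra.
Qed.

End PeriodicSums.

(** * The constant term of a theta identity *)

Section Expansion.
Variable F : realFieldType.
Implicit Types (z : F) (f : nat * int * nat).

(** The number of representations of n by the form f inside the box; it is the true
    number of representations once B is large. *)
Definition reps f (B n : nat) : nat :=
  \sum_(i < (2 * B).+1) \sum_(j < (2 * B).+1)
    (qform f.1.1 f.1.2 f.2 (i%:Z - B%:Z) (j%:Z - B%:Z) == n).

Lemma reps0 f B : posdef f.1.1 f.1.2 f.2 -> reps f B 0 = 1%N.
Proof.
move=> P; have HB : (B < (2 * B).+1)%N by lia.
have Z m k : (qform f.1.1 f.1.2 f.2 m k == 0%N) = (m == 0) && (k == 0).
  apply/eqP/andP => [E|[/eqP -> /eqP ->]]; last by rewrite /qform !mulr0 !addr0.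
  have := qform_gem m k P; have := qform_gek m k P; rewrite E !mulr0 => H1 H2.
  have := sqr_ge0 m; have := sqr_ge0 k => H3 H4.
  have /eqP : m ^+ 2 = 0 by apply/eqP; rewrite eq_le H2 H4.
  have /eqP : k ^+ 2 = 0 by apply/eqP; rewrite eq_le H1 H3.
  by rewrite !sqrf_eq0.
rewrite /reps (bigD1 (Ordinal HB)) //= [X in (_ + X)%N]big1 ?addn0.
  rewrite (bigD1 (Ordinal HB)) //= big1 ?addn0; first by rewrite Z subrr eqxx.
  move=> j Hj; rewrite Z subrr eqxx /=; case: eqP => // H; exfalso.
  by move/negP: Hj; apply; apply/eqP/val_inj => /=; lia.
move=> i Hi; rewrite big1 // => j _; rewrite Z; case: eqP => // H; exfalso.
by move/negP: Hi; apply; apply/eqP/val_inj => /=; lia.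
Qed.

Lemma theta_truncation z f (B M : nat) : 0 <= z <= 1 ->
  `|theta z f B - \sum_(n < M.+1) (reps f B n)%:R * z ^+ n| <= (2 * B).+1%:R ^+ 2 * z ^+ M.
Proof.
move=> /andP [z0 z1].
pose Q (i j : 'I_(2 * B).+1) := qform f.1.1 f.1.2 f.2 (i%:Z - B%:Z) (j%:Z - B%:Z).
have -> : \sum_(n < M.+1) (reps f B n)%:R * z ^+ n =
  \sum_(i < (2 * B).+1) \sum_(j < (2 * B).+1) (if (Q i j < M.+1)%N then z ^+ Q i j else 0).
  under eq_bigr do rewrite /reps natr_sum mulr_suml.
  rewrite exchange_big /=; apply: eq_bigr => i _.
  under eq_bigr do rewrite natr_sum mulr_suml.
  rewrite exchange_big /=; apply: eq_bigr => j _; rewrite -/(Q i j).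
  case: ltnP => H.
    rewrite (bigD1 (Ordinal H)) //= eqxx mul1r big1 ?addr0 // => n Hn.
    case: eqP => E; last by rewrite mul0r.
    by move/negP: Hn; case; apply/eqP/val_inj.
  rewrite big1 // => n _; case: eqP => E; last by rewrite mul0r.
  by have := ltn_ord n; lia.
rewrite /theta -sumrB.
have -> : (2 * B).+1%:R ^+ 2 * z ^+ M = \sum_(i < (2 * B).+1) \sum_(j < (2 * B).+1) z ^+ M.
  by rewrite !sumr_const card_ord -mulrnA -[RHS]mulr_natl natrM expr2.
apply: (le_trans (ler_norm_sum _ _ _)); apply: ler_sum => i _; rewrite -sumrB.
apply: (le_trans (ler_norm_sum _ _ _)); apply: ler_sum => j _; rewrite -/(Q i j).
case: ltnP => H; first by rewrite subrr normr0 exprn_ge0.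
by rewrite subr0 ger0_norm ?exprn_ge0 //; apply: ler_wiXn2l => //; lia.
Qed.

(** Collecting the vectors by their norms, the theta sums of the forms in fs add up
    to their number plus twice the generating function of the divisor sums of u. *)
Lemma theta_expansion (u : nat -> int) (fs : seq (nat * int * nat)) z (B M : nat) :
  {in fs, forall f, posdef f.1.1 f.1.2 f.2} ->
  (forall n, (0 < n <= M)%N ->
    (\sum_(f <- fs) reps f B n)%:R = 2 * \sum_(d < n | (d.+1 %| n)%N) u d.+1 :> int) ->
  0 <= z <= 1 ->
  `|\sum_(f <- fs) theta z f B -
     ((size fs)%:R + 2 * \sum_(n < M) divisor_sum (fun d => (u d)%:~R) n.+1 * z ^+ n.+1)| <=
  (size fs)%:R * ((2 * B).+1%:R ^+ 2 * z ^+ M).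
Proof.
move=> P Hr z01.
have -> : (size fs)%:R + 2 * \sum_(n < M) divisor_sum (fun d => (u d)%:~R) n.+1 * z ^+ n.+1 =
   \sum_(f <- fs) \sum_(n < M.+1) (reps f B n)%:R * z ^+ n :> F.
  rewrite exchange_big /= big_ord_recl; congr (_ + _).
    rewrite -(sum1_size fs) natr_sum big_seq [RHS]big_seq; apply: eq_bigr => f Hf.
    by rewrite reps0 ?expr0 ?mulr1 //; apply: P.
  rewrite mulr_sumr; apply: eq_bigr => n _; rewrite -mulr_suml mulrA; congr (_ * _).
  have Hn : (0 < n.+1 <= M)%N by have := ltn_ord n; lia.
  have := congr1 (intr : int -> F) (Hr _ Hn).
  have E1 (k : nat) : (k%:R : int)%:~R = k%:R :> F by rewrite natz.
  rewrite E1 natr_sum rmorphM /= rmorph_sum => H; exact: (esym H).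
rewrite -sumrB.
have -> : (size fs)%:R * ((2 * B).+1%:R ^+ 2 * z ^+ M) = \sum_(f <- fs) ((2 * B).+1%:R ^+ 2 * z ^+ M) :> F.
  by rewrite big_const_seq count_predT iter_addr addr0 mulr_natl.
apply: (le_trans (ler_norm_sum _ _ _)); apply: ler_sum => f _.
exact: theta_truncation.
Qed.

(** The functions z / (1 + z) at powers of z that [lambert_combination] leaves;
    decreasing and convex in i, and close to 1/2 at i = 0 when z is close to 1. *)
Definition fermi z (i : nat) : F := z ^+ i.+1 / (1 + z ^+ i.+1).

Lemma fermi_props z : 0 < z < 1 ->
  [/\ forall i, 0 <= fermi z i <= z ^+ i, forall i, fermi z i.+1 <= fermi z i,
     forall i, fermi z i.+1 - fermi z i.+2 <= fermi z i - fermi z i.+1,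
     fermi z 0 - fermi z 1 <= 1 - z & `|2 * fermi z 0 - 1| <= 1 - z].
Proof.
move=> /andP [z0 z1].
have dif (i : nat) : fermi z i - fermi z i.+1 =
   z ^+ i.+1 * (1 - z) / ((1 + z ^+ i.+1) * (1 + z ^+ i.+2)).
  have h1 : 0 < 1 + z ^+ i.+1 by rewrite ltr_pwDl // exprn_ge0 // ltW.
  have h2 : 0 < 1 + z ^+ i.+2 by rewrite ltr_pwDl // exprn_ge0 // ltW.
  rewrite /fermi; rewrite (exprS z i.+1) in h2 *; set y := z ^+ i.+1 in h1 h2 *.
  by field; rewrite !gt_eqF.
have zn (i : nat) : 0 < z ^+ i by rewrite exprn_gt0.
have zl (i : nat) : z ^+ i <= 1 by rewrite exprn_ile1 // ltW.
split.
- move=> i; rewrite /fermi; have h := zn i.+1; rewrite divr_ge0 //=; try lra.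
  rewrite ler_pdivrMr; last by lra.
  have := zn i; have := zl i; rewrite exprS; set y := z ^+ i => y1 y0; nra.
- move=> i; rewrite -subr_ge0 dif; have h1 := zn i.+1; have h2 := zn i.+2.
  by apply: divr_ge0; apply: mulr_ge0; lra.
- move=> i; rewrite !dif (exprS z i.+2) (exprS z i.+1).
  have := zn i.+1; have := zl i.+1; set y := z ^+ i.+1 => y1 y0.
  have h1 : 0 < 1 + y by lra.
  have h2 : 0 < 1 + z * y by nra.
  have h3 : 0 < 1 + z * (z * y) by nra.
  rewrite -subr_ge0.
  have -> : y * (1 - z) / ((1 + y) * (1 + z * y)) - z * y * (1 - z) / ((1 + z * y) * (1 + z * (z * y)))
    = y * (1 - z) ^+ 2 * (1 - z * y) / ((1 + y) * (1 + z * y) * (1 + z * (z * y))).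
    by field; rewrite !gt_eqF.
  apply: divr_ge0; last by rewrite !mulr_ge0 // ltW.
  by rewrite !mulr_ge0 ?sqr_ge0 ?(ltW y0) //; nra.
- rewrite dif expr1 expr2 ler_pdivrMr; last by rewrite mulr_gt0; nra.
  by rewrite [X in X <= _]mulrC ler_wpM2l; nra.
- rewrite /fermi expr1.
  have -> : 2 * (z / (1 + z)) - 1 = - ((1 - z) / (1 + z)) by field; rewrite gt_eqF //; lra.
  rewrite normrN ger0_norm; last by rewrite divr_ge0; lra.
  rewrite ler_pdivrMr; nra.
Qed.

End Expansion.

(** A separate statement, so that the arithmetic is decided for abstract terms. *)
Lemma norm_combination (F : realFieldType) (z1 z2 z3 z4 z5 z6 z7 z8 z9 b1 b2 b3 b4 b5 b6 b7 b8 b9 : F) :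
  `|z1| <= b1 -> `|z2| <= b2 -> `|z3| <= b3 -> `|z4| <= b4 -> `|z5| <= b5 ->
  `|z6| <= b6 -> `|z7| <= b7 -> `|z8| <= b8 -> `|z9| <= b9 ->
  `|z1 - 4 * z2 + z3 - 8 * z4 + 2 * z5 + 2 * z6 + 4 * z7 + z8 + 2 * z9| <=
  b1 + 4 * b2 + b3 + 8 * b4 + 2 * b5 + 2 * b6 + 4 * b7 + b8 + 2 * b9.
Proof.
rewrite !ler_norml => /andP [? ?] /andP [? ?] /andP [? ?] /andP [? ?] /andP [? ?].
move=> /andP [? ?] /andP [? ?] /andP [? ?] /andP [? ?].
by apply/andP; split; lra.
Qed.

Section ConstantTerm.
Variables (F : realFieldType) (p : nat) (u : nat -> int) (fs : seq (nat * int * nat)).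
Hypothesis p_gt0 : (0 < p)%N.
Hypothesis u_periodic : forall i, u (i + p)%N = u i.
Hypothesis u_bounded : forall i, `|u i| <= 1.
Hypothesis u_sum0 : \sum_(i < p) u i.+1 = 0.
Hypothesis fs_posdef : {in fs, forall f, posdef f.1.1 f.1.2 f.2}.
Hypothesis fs_reps : forall n B, (0 < n)%N ->
  {in fs, forall f, (4 * (f.1.1 + f.2) * n <= B)%N} ->
  (\sum_(f <- fs) reps f B n)%:R = 2 * \sum_(d < n | (d.+1 %| n)%N) u d.+1 :> int.

Let h := size fs.
Let C : int := \sum_(i < p) \sum_(j < i.+1) u j.+1.
Let U (d : nat) : F := (u d)%:~R.

Let box := (3 + \sum_(f <- fs) 4 * (f.1.1 + f.2))%N.

Lemma boxP f : f \in fs -> (4 * (f.1.1 + f.2) + 3 <= box)%N.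
Proof.
move=> Hf; rewrite /box addnC leq_add2l.
by rewrite (big_rem f) //= leq_addr.
Qed.

(** The two evaluations of 4 theta(q^4) - theta(q) are compared. Summed over the
    forms it is small by [theta_dilation]. By [theta_expansion] it also is 3 h
    plus twice the Lambert combination, and by [periodic_abel] this combination is
    close to - (1/2 + 1) C / p. The error K (1 / N + M^2 q^M / (1 - q)) collects the
    distance of q to 1 and the truncation at M. *)
Lemma constant_term_bound : exists2 K : F, 0 <= K & forall (N M : nat) (q : F), (0 < N)%N -> (0 < M)%N ->
  q = (1 + N%:R ^- 2)^-1 ->
  `|3 * (p%:R * h%:R - C%:~R)| <= K / N%:R + K * (M%:R ^+ 2 * q ^+ M / (1 - q)).
Proof.
have Up i : U (i + p)%N.+1 = U i.+1 by rewrite /U -addSn u_periodic.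
have U0 : \sum_(i < p) U i.+1 = 0.
  by rewrite /U -(rmorph_sum (intr : int -> F)) u_sum0.
have [K1 K10 HK1] := periodic_abel p_gt0 Up U0.
have CE : \sum_(i < p) \sum_(j < i.+1) U j.+1 = C%:~R.
  by rewrite /C rmorph_sum; apply: eq_bigr => i _; rewrite rmorph_sum.
rewrite CE in HK1.
pose T : F := \sum_(f <- fs) theta_const F f.
have T0 : 0 <= T.
  by apply: sumr_ge0 => f _; exact: theta_const_ge0.
pose b2 : F := (4 * box + 1)%:R ^+ 2.
have b20 : 0 <= b2 by rewrite exprn_ge0 // ler0n.
pose H : F := h%:R; have H0 : 0 <= H by rewrite ler0n.
pose P : F := p%:R; have P0 : 0 <= P by rewrite ler0n.
pose K : F := P * (T + 9 * H * b2 + 5 * H * b2 + 20) + 20 * K1 + 10 * `|C%:~R|.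
exists K; first by rewrite /K !addr_ge0 ?mulr_ge0 ?addr_ge0 ?mulr_ge0.
move=> N M q N0 M0 qE.
(* the box is large enough to contain all vectors of value at most M *)
pose B := (box * M)%N.
have rep B' : (B <= B')%N -> forall n, (0 < n <= M)%N ->
    (\sum_(f <- fs) reps f B' n)%:R = 2 * \sum_(d < n | (d.+1 %| n)%N) u d.+1 :> int.
  move=> HB n /andP [n0 nM]; apply: fs_reps => // f Hf.
  apply: leq_trans HB; rewrite /B; apply: leq_mul => //.
  by apply: leq_trans (boxP Hf); exact: leq_addr.
have nb1 : ((2 * (2 * B)).+1 <= (4 * box + 1) * M)%N by rewrite /B; clear -M0; nia.
have nb2 : ((2 * B).+1 <= (2 * (2 * B)).+1)%N by clear; lia.
have nb4 : (B <= 2 * B)%N by clear; lia.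
have nb3 f : f \in fs -> (4 * (f.1.1 + f.2) * M + 3 <= 2 * B)%N.
  move=> Hf; have := boxP Hf; rewrite /B; move: (4 * (f.1.1 + f.2))%N box => s b.
  by clear -M0; nia.
have q0 : 0 < q by rewrite qE; exact: q_gt0.
have q1 : q < 1 by rewrite qE; exact: q_lt1.
have qt : 1 - q <= N%:R^-1.
  rewrite qE; apply: (le_trans (onemq_le _ N0)); rewrite lef_pV2 ?posrE ?exprn_gt0 ?ltr0n //.
  by rewrite -natrX ler_nat expnS expn1 leq_pmulr.
set V := q ^+ M; set W := (1 - q)^-1.
have W1 : 1 <= W by rewrite /W invf_ge1 ?subr_gt0 //; lra.
have V0 : 0 < V by rewrite exprn_gt0.
set m2 : F := M%:R ^+ 2.
have m21 : 1 <= m2 by rewrite exprn_ege1 // ler1n.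
have mm2 : M%:R <= m2 by rewrite /m2 -[X in X <= _]expr1 ler_weXn2l // ler1n.
have boxM : (2 * (2 * B)).+1%:R ^+ 2 <= b2 * m2.
  by rewrite /b2 /m2 -exprMn -natrM lerXn2r ?nnegrE ?ler0n // ler_nat.
have boxM' : (2 * B).+1%:R ^+ 2 <= b2 * m2.
  by apply: le_trans boxM; rewrite lerXn2r ?nnegrE ?ler0n // ler_nat.
have boxM1 : (2 * (2 * B)).+1%:R <= b2 * m2.
  by apply: le_trans boxM; rewrite -[X in X <= _]expr1 ler_weXn2l // ler1n.
have q4 : 0 < q ^+ 4 < 1 by rewrite exprn_gt0 //= exprn_ilt1 // ltW.
have q4M : (q ^+ 4) ^+ M <= V.
  by rewrite -exprM /V; apply: ler_wiXn2l; [exact: ltW|exact: ltW|exact: leq_pmull].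
have q2 : 0 < q ^+ 2 < 1 by rewrite exprn_gt0 //= exprn_ilt1 // ltW.
have q2M : (q ^+ 2) ^+ M <= V.
  by rewrite -exprM /V; apply: ler_wiXn2l; [exact: ltW|exact: ltW|exact: leq_pmull].
have U1 d : `|U d| <= 1 by rewrite /U -intr_norm -[1]/(1%:~R) ler_int.
have X1 : `|\sum_(f <- fs) (4 * theta (q ^+ 4) f B - theta q f (2 * B))| <=
    T / N%:R + 9 * H * (b2 * m2) * V.
  apply: (le_trans (ler_norm_sum _ _ _)).
  have -> : T / N%:R + 9 * H * (b2 * m2) * V =
     \sum_(f <- fs) (theta_const F f / N%:R + 9 * (b2 * m2) * V).
    rewrite big_split /= -mulr_suml; congr (_ + _).
    by rewrite big_const_seq count_predT iter_addr addr0 -[RHS]mulr_natl /H /h; ring.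
  rewrite big_seq [X in _ <= X]big_seq; apply: ler_sum => f Hf.
  have td := theta_dilation F N0 (fs_posdef Hf) (nb3 _ Hf); rewrite -qE in td.
  apply: (le_trans td).
  by rewrite lerD2l ler_wpM2r ?(ltW V0) // ler_wpM2l.
set X := \sum_(f <- fs) _ in X1.
set A4 := \sum_(f <- fs) theta (q ^+ 4) f B.
set A1 := \sum_(f <- fs) theta q f (2 * B).
have XE : X = 4 * A4 - A1 by rewrite /X /A4 /A1 sumrB mulr_sumr.
pose S4 : F := \sum_(n < M) divisor_sum U n.+1 * (q ^+ 4) ^+ n.+1.
pose S1 : F := \sum_(n < M) divisor_sum U n.+1 * q ^+ n.+1.
have /andP [q40 q41] := q4.
have e1 : `|A4 - (H + 2 * S4)| <= H * (b2 * m2 * V).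
  apply: le_trans (theta_expansion fs_posdef (rep B (leqnn B)) _) _.
    by rewrite !ltW.
  rewrite ler_wpM2l //; apply: ler_pM => //; rewrite ?exprn_ge0 ?ler0n //; exact: ltW.
have e2 : `|A1 - (H + 2 * S1)| <= H * (b2 * m2 * V).
  apply: le_trans (theta_expansion fs_posdef (rep (2 * B)%N nb4) _) _.
    by rewrite !ltW.
  by rewrite ler_wpM2l // ler_wpM2r // ltW.
pose L4 : F := \sum_(d < M) U d.+1 * ((q ^+ 4) ^+ d.+1 / (1 - (q ^+ 4) ^+ d.+1)).
pose L1 : F := \sum_(d < M) U d.+1 * (q ^+ d.+1 / (1 - q ^+ d.+1)).
set E := m2 * V * W.
have MVW : M%:R * V * W <= E.
  by rewrite /E ler_wpM2r ?(le_trans _ W1) // ler_wpM2r // ltW.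
have d4 : `|S4 - L4| <= E.
  apply: le_trans (lambert_truncation M U1 _) _; first by rewrite q41 ltW.
  apply: le_trans MVW; apply: ler_pM; rewrite ?invr_ge0 ?subr_ge0 ?(ltW q41) //.
  - by rewrite mulr_ge0 ?ler0n // exprn_ge0 // ltW.
  - by rewrite ler_wpM2l ?ler0n.
  rewrite /W lef_pV2 ?posrE ?subr_gt0 // lerD2l lerN2 -[X in _ <= X]expr1.
  by apply: ler_wiXn2l; [exact: ltW|exact: ltW|].
have d1 : `|S1 - L1| <= E.
  by apply: le_trans (lambert_truncation M U1 _) _; [rewrite q1 ltW|].
pose F1 : F := \sum_(i < M) U i.+1 * fermi q i.
pose F2 : F := \sum_(i < M) U i.+1 * fermi (q ^+ 2) i.
have LE : 4 * L4 - L1 = - (F1 + 2 * F2).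
  rewrite /L4 /L1 /F1 /F2 !mulr_sumr -sumrB -big_split /= -sumrN.
  apply: eq_bigr => i _; rewrite /fermi.
  have : 0 < q ^+ i.+1 < 1 by rewrite exprn_gt0 //= exprn_ilt1 // ltW.
  move=> /lambert_combination; rewrite -!exprM [(4 * _)%N]mulnC [(2 * _)%N]mulnC !exprM.
  set y1 := _ / (1 - _); set y2 := _ / (1 - _) => Y.
  by rewrite mulrCA -mulrBr Y; ring.
have q01 : 0 < q < 1 by rewrite q0.
have [g0 gd gc g1 g2] := fermi_props q01.
have [g0' gd' gc' g1' g2'] := fermi_props q2.
have k1 := HK1 (fermi q) M (fun i => proj1 (andP (g0 i))) gd gc.
have k2 := HK1 (fermi (q ^+ 2)) M (fun i => proj1 (andP (g0' i))) gd' gc'.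
have gM : fermi q M <= V by have /andP [] := g0 M.
have gM' : fermi (q ^+ 2) M <= V by have /andP [_ G] := g0' M; apply: le_trans q2M.
rewrite -/F1 -/P in k1; rewrite -/F2 -/P in k2.
set c : F := C%:~R in k1 k2 *.
set f1 := fermi q 0 in g1 g2 k1; set f2 := fermi (q ^+ 2) 0 in g1' g2' k2.
set nv := N%:R^-1 in qt X1 *.
have nv0 : 0 <= nv by rewrite invr_ge0 ler0n.
have q2t : 1 - q ^+ 2 <= 2 * nv by rewrite expr2; nra.
have VE : m2 * V <= E by rewrite /E ler_peMr // mulr_ge0 ?(ltW V0) // (le_trans _ m21).
have VE' : V <= E by apply: le_trans VE; rewrite ler_peMl // ltW.
have E0 : 0 <= E by apply: le_trans VE'; exact: ltW.
have Hb : 0 <= H * b2 by rewrite mulr_ge0.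
have VEb : H * (b2 * m2 * V) <= H * b2 * E.
  by rewrite -[b2 * m2 * V]mulrA mulrA ler_wpM2l.
have pn (y z : F) : `|y| <= z -> `|P * y| <= P * z.
  by move=> yz; rewrite normrM (ger0_norm P0) ler_wpM2l.
have x1 : `|P * X| <= P * (T * nv + 9 * (H * b2 * E)).
  apply: pn; apply: (le_trans X1); rewrite lerD2l.
  have -> : 9 * H * (b2 * m2) * V = 9 * (H * (b2 * m2 * V)) by ring.
  by rewrite ler_wpM2l.
have x2 := pn _ _ (le_trans e1 VEb); have x3 := pn _ _ (le_trans e2 VEb).
have x4 := pn _ _ d4; have x5 := pn _ _ d1.
have x6 : `|P * F1 - c * f1| <= K1 * (nv + E).
  by apply: (le_trans k1); rewrite ler_wpM2l // lerD ?(le_trans g1 qt) ?(le_trans gM VE').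
have x7 : `|P * F2 - c * f2| <= K1 * (2 * nv + E).
  by apply: (le_trans k2); rewrite ler_wpM2l // lerD ?(le_trans g1' q2t) ?(le_trans gM' VE').
have x8 : `|c * (2 * f1 - 1)| <= `|c| * nv.
  by rewrite normrM ler_wpM2l ?normr_ge0 //; apply: le_trans qt.
have x9 : `|c * (2 * f2 - 1)| <= `|c| * (2 * nv).
  by rewrite normrM ler_wpM2l ?normr_ge0 //; apply: le_trans q2t.
(* the nine error terms, the first of which is the theta side *)
have ident : 3 * (P * H - c) = P * X - 4 * (P * (A4 - (H + 2 * S4))) + P * (A1 - (H + 2 * S1))
   - 8 * (P * (S4 - L4)) + 2 * (P * (S1 - L1)) + 2 * (P * F1 - c * f1) + 4 * (P * F2 - c * f2)
   + c * (2 * f1 - 1) + 2 * (c * (2 * f2 - 1)).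
  have -> : F1 = - (4 * L4 - L1) - 2 * F2 by rewrite LE; ring.
  by rewrite XE; ring.
apply: (@le_trans _ _ (P * (T * nv + 9 * (H * b2 * E)) + 5 * (P * (H * b2 * E)) + 10 * (P * E)
  + 2 * (K1 * (nv + E)) + 4 * (K1 * (2 * nv + E)) + `|c| * nv + 2 * (`|c| * (2 * nv)))).
  rewrite -/P -/H ident; apply: le_trans (norm_combination x1 x2 x3 x4 x5 x6 x7 x8 x9) _.
  by rewrite le_eqVlt; apply/orP; left; apply/eqP; ring.
rewrite /K -/c -subr_ge0.
set Hb2 := H * b2 in Hb *; have nc := normr_ge0 c; set ac := `|c| in nc *.
have -> : (P * (T + 9 * H * b2 + 5 * H * b2 + 20) + 20 * K1 + 10 * ac) * nv + (P * (T + 9 * H * b2 + 5 * H * b2 + 20) + 20 * K1 + 10 * ac) * E -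
  (P * (T * nv + 9 * (Hb2 * E)) + 5 * (P * (Hb2 * E)) + 10 * (P * E) + 2 * (K1 * (nv + E)) + 4 * (K1 * (2 * nv + E)) + ac * nv + 2 * (ac * (2 * nv)))
  = P * T * E + 14 * P * Hb2 * nv + 20 * P * nv + 10 * P * E + 10 * K1 * nv + 14 * K1 * E + 5 * ac * nv + 10 * ac * E.
  by rewrite /Hb2; ring.
by repeat first [done | apply: addr_ge0 | apply: mulr_ge0].
Qed.
End ConstantTerm.

(** N is chosen first and then M in terms of N: q ^ M decays faster than M^-2. *)
Lemma archi_vanish (F : archiRealFieldType) (K : F) : 0 <= K ->
  exists N M : nat, [/\ (0 < N)%N, (0 < M)%N &
    K / N%:R + K * (M%:R ^+ 2 * (1 + N%:R ^- 2)^-1 ^+ M / (1 - (1 + N%:R ^- 2)^-1)) < 2].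
Proof.
move=> K0; pose N := (Num.bound K).+1.
have KN : K < N%:R by apply: (lt_le_trans (archi_boundP K0)); rewrite ler_nat.
have N0 : 0 < N%:R :> F by rewrite ltr0n.
pose t : F := N%:R ^- 2; have t0 : 0 < t by apply: step_gt0.
pose q : F := (1 + t)^-1.
have q1 : q < 1 by apply: q_lt1.
have q0 : 0 < q by apply: q_gt0.
pose A : F := 9 * K / (1 - q) / t ^+ 3.
have A0 : 0 <= A.
  apply: divr_ge0; last by rewrite exprn_ge0 // ltW.
  by apply: divr_ge0; [apply: mulr_ge0|rewrite subr_ge0 ltW].
pose L := (Num.bound A).+1.
have AL : A < L%:R by apply: (lt_le_trans (archi_boundP A0)); rewrite ler_nat.
have L0 : 0 < L%:R :> F by rewrite ltr0n.
exists N, (3 * L)%N; split=> //; rewrite -/t -/q.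
have h1 : K / N%:R < 1 by rewrite ltr_pdivrMr // mul1r.
suff h2 : K * ((3 * L)%N%:R ^+ 2 * q ^+ (3 * L) / (1 - q)) < 1.
  by have := ltrD h1 h2; have -> : 1 + 1 = 2 :> F by ring.
have qL : q ^+ (3 * L) <= (L%:R * t) ^- 3.
  have Lt0 : 0 < L%:R * t by rewrite mulr_gt0.
  have x0 : 0 < 1 + t by apply: addr_gt0.
  rewrite mulnC exprM -exprVn; apply: lerXn2r; rewrite ?nnegrE ?exprn_ge0 ?(ltW q0) //.
    by rewrite invr_ge0 ltW.
  rewrite /q exprVn lef_pV2 ?posrE ?exprn_gt0 //.
  by apply: le_trans (bernoulli L (ltW t0)); rewrite mulr_natl lerDr.
apply: (@le_lt_trans _ _ (A / L%:R)); last by rewrite ltr_pdivrMr // mul1r.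
have -> : A / L%:R = K * (((3 * L)%N%:R ^+ 2 * (L%:R * t) ^- 3) / (1 - q)).
  by rewrite /A natrM; field; rewrite (gt_eqF t0) (gt_eqF L0) subr_eq0 (gt_eqF q1).
rewrite ler_wpM2l // ler_wpM2r ?invr_ge0 ?subr_ge0 ?(ltW q1) //.
by rewrite ler_wpM2l // exprn_ge0 // ler0n.
Qed.

(** If the representation numbers of a family of forms are the divisor sums of a
    periodic sequence u of mean zero, the size of the family is the Abel value of
    the series of u, that is, the mean of its partial sums. Three times the
    difference of the two sides is a multiple of 3 of absolute value less than 2. *)
Theorem constant_term (p : nat) (u : nat -> int) (fs : seq (nat * int * nat)) :
  (0 < p)%N -> (forall i, u (i + p)%N = u i) -> (forall i, `|u i| <= 1) ->
  \sum_(i < p) u i.+1 = 0 -> {in fs, forall f, posdef f.1.1 f.1.2 f.2} ->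
  (forall n B, (0 < n)%N -> {in fs, forall f, (4 * (f.1.1 + f.2) * n <= B)%N} ->
    (\sum_(f <- fs) reps f B n)%:R = 2 * \sum_(d < n | (d.+1 %| n)%N) u d.+1 :> int) ->
  p%:Z * (size fs)%:Z = \sum_(i < p) \sum_(j < i.+1) u j.+1.
Proof.
move=> p0 up u1 u0 Pf Rf; have [K K0 HK] := constant_term_bound rat p0 up u1 u0 Pf Rf.
have [N [M [N0 M0 small]]] := archi_vanish K0.
have := HK N M _ N0 M0 erefl; set C := \sum_(i < p) _.
have -> : 3 * (p%:R * (size fs)%:R - C%:~R) = (3 * (p%:Z * (size fs)%:Z - C))%:~R :> rat.
  by rewrite rmorphM /= rmorphB /= rmorphM /=.
rewrite -intr_norm => h3.
have := le_lt_trans h3 small.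
rewrite -[2]/(2%:~R) ltr_int; lia.
Qed.

(** * Gauss periods *)

Section GaussPeriods.
Variables (p n : nat).
Hypotheses (p_pr : prime p) (p_gt3 : (3 < p)%N) (pE : p = (2 * n).+1) (n_odd : odd n).

Variables (K : fieldType) (z : K).
Hypothesis z_root : \sum_(i < p) z ^+ i = 0.

Let e (t : 'F_p) : K := z ^+ t.

Lemma root_expr : z ^+ p = 1.
Proof. by apply/eqP; rewrite -subr_eq0 subrX1 z_root mulr0. Qed.

Lemma root_powD s t : e (s + t) = e s * e t.
Proof.
rewrite /e -exprD; have H := expr_mod (s + t)%N root_expr.
by rewrite -H /=; congr (_ ^+ (_ %% _)); rewrite Fp_cast.
Qed.

Lemma root_pow0 : e 0 = 1. Proof. by []. Qed.

Lemma root_pow_nat (i : nat) : e i%:R = z ^+ i.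
Proof. by rewrite /e val_Fp_nat // (expr_mod _ root_expr). Qed.

Lemma root_pow_mul (l : nat) t : e (l%:R * t) = e t ^+ l.
Proof.
rewrite mulr_natl; elim: l => [|l IH]; first by rewrite mulr0n expr0.
by rewrite mulrS root_powD IH exprS.
Qed.

Lemma sum_root_pow : \sum_t e t = 0.
Proof.
rewrite -[RHS]z_root (reindex (fun i : 'I_p => i%:R : 'F_p)) /=; last first.
  exists (fun x => Ordinal (ltn_Fp x p_pr)) => [i _|x _]; last exact: natr_Zp.
  by apply: val_inj; rewrite /= val_Fp_nat // modn_small.
by apply: eq_bigr => i _; rewrite root_pow_nat.
Qed.

(** For a = 1 and a = -1 these are the two quadratic Gauss periods, over any field
    that contains a nontrivial p-th root of unity z. *)
Definition period (a : int) : K := \sum_(t : 'F_p | chi t == a) e t.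

Lemma period_sum : period 1 + period (-1) = -1.
Proof.
have := sum_root_pow; rewrite (bigD1 0) //= root_pow0 => /eqP; rewrite addr_eq0 => /eqP ->.
rewrite opprK (bigID (fun t : 'F_p => chi t == 1)) /=; congr (_ + _); apply: eq_bigl => t.
  by case: (eqVneq t 0) => [->|] //=; rewrite chi0.
case: (eqVneq t 0) => [->|t0] /=; first by rewrite chi0.
by case: (chi_pm1 t0) => ->.
Qed.

Let r := ((p - 3) %/ 4)%N.
Let pr : p = (4 * r + 3)%N. Proof. by rewrite /r; lia. Qed.

Lemma card_chi1 : #|[pred t : 'F_p | chi t == 1]| = n.
Proof.
have H : \sum_(t : 'F_p | t != 0) (1 + chi t) = 2 * (#|[pred t : 'F_p | chi t == 1]|)%:Z.
  have -> : 2 * (#|[pred t : 'F_p | chi t == 1]|)%:Z = \sum_(t in [pred t : 'F_p | chi t == 1]) 2.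
    by rewrite sumr_const -[RHS]mulr_natr (natz #|_|).
  rewrite (bigID (fun t : 'F_p => chi t == 1)) /=.
  rewrite [X in _ + X]big1 ?addr0.
    apply: eq_big => [t|t /andP [_ /eqP ->] //]; rewrite inE.
    by case: (eqVneq t 0) => [->|] //=; rewrite chi0.
  by move=> t /andP [t0 H]; case: (chi_pm1 t0) H => ->.
have := sum_chi p_pr p_gt3 pE n_odd; rewrite (bigD1 0) //= chi0 add0r => H0.
rewrite big_split /= H0 addr0 sumr_const in H.
have : #|[pred t : 'F_p | t != 0]| = p.-1.
  by rewrite (cardC1 (0 : 'F_p)) card_Fp.
move=> E; rewrite /= E in H; rewrite -natz in H; move: H; rewrite natz; lia.
Qed.

(** Expanding (1 - chi t) (1 + chi (m - t)), which is 4 on the set counted and 0 on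
    other t different from 0 and m. *)
Lemma card_chi_sum (m : 'F_p) : m != 0 ->
  #|[pred t : 'F_p | (chi t == -1) && (chi (m - t) == 1)]| = r.
Proof.
move=> m0; set A := #|_|.
have H : \sum_(t : 'F_p | (t != 0) && (t != m)) (1 - chi t) * (1 + chi (m - t)) = 4 * A%:Z.
  have -> : 4 * A%:Z = \sum_(t in [pred t : 'F_p | (chi t == -1) && (chi (m - t) == 1)]) 4.
    by rewrite sumr_const -[RHS]mulr_natr (natz #|_|).
  rewrite (bigID (fun t : 'F_p => (chi t == -1) && (chi (m - t) == 1))) /=.
  rewrite [X in _ + X]big1 ?addr0.
    apply: eq_big => [t|t /andP [_ /andP [/eqP -> /eqP ->]] //]; rewrite inE.
    case: (eqVneq t 0) => [->|] //=.
    by case: (eqVneq t m) => [->|] //=; rewrite subrr chi0 andbF.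
  move=> t /andP [/andP [t0 tm]]; have tm' : m - t != 0 by rewrite subr_eq0 eq_sym.
  by case: (chi_pm1 t0) => ->; case: (chi_pm1 tm') => ->.
have E : \sum_(t : 'F_p) (1 - chi t) * (1 + chi (m - t)) = p%:Z - 1.
  have -> : \sum_(t : 'F_p) (1 - chi t) * (1 + chi (m - t)) =
      \sum_(t : 'F_p) (1 - chi t + (chi (m - t) - chi t * chi (m - t))).
    by apply: eq_bigr => t _; ring.
  rewrite big_split /= sumrB sumrB (sum_chi p_pr p_gt3 pE n_odd) subr0 sumr_const card_Fp //.
  have -> : \sum_(t : 'F_p) chi (m - t) = 0.
    rewrite (reindex_inj (inv_inj (@opprK 'F_p))) /=.
    by under eq_bigr do rewrite opprK addrC; rewrite (sum_chi_shift p_pr p_gt3 pE n_odd).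
  have -> : \sum_(t : 'F_p) chi t * chi (m - t) = 1.
    have := chi_autocorr p_pr p_gt3 pE n_odd 0 (- m).
    rewrite eq_sym oppr_eq0 (negPf m0) => H1.
    apply: oppr_inj; rewrite -H1 -sumrN; apply: eq_bigr => t _.
    by rewrite addr0 -[t - m]opprB (chiN p_pr p_gt3 pE) // mulrN.
  by rewrite sub0r natz.
move: E; rewrite (bigD1 0) //= chi0 subr0 mul1r subr0.
rewrite (bigD1 m) //= subrr chi0 addr0 mulr1 H; lia.
Qed.

(** A residue plus a nonresidue vanishes n times, since -1 is a nonresidue, and takes
    every other value r times. *)
Lemma period_prod : period 1 * period (-1) = (r.+1)%:R.
Proof.
rewrite /period mulr_suml.
under eq_bigr do rewrite mulr_sumr.
rewrite exchange_big /=.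
have -> : \sum_(t : 'F_p | chi t == -1) \sum_(s : 'F_p | chi s == 1) e s * e t =
   \sum_(t : 'F_p | chi t == -1) \sum_(m : 'F_p | chi (m - t) == 1) e m.
  apply: eq_bigr => t _; rewrite [RHS](reindex_inj (addIr t)) /=.
  apply: eq_big => [s|s _]; first by rewrite addrK.
  by rewrite root_powD.
rewrite (exchange_big_dep xpredT) //=.
have -> : \sum_(m : 'F_p) \sum_(t : 'F_p | (chi t == -1) && (chi (m - t) == 1)) e m =
  \sum_(m : 'F_p) #|[pred t : 'F_p | (chi t == -1) && (chi (m - t) == 1)]|%:R * e m.
  by apply: eq_bigr => m _; rewrite sumr_const mulr_natl.
rewrite (bigD1 0) //=.
have -> : #|[pred t : 'F_p | (chi t == -1) && (chi (0 - t) == 1)]| = n.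
  rewrite -card_chi1 -(fintype.card_image (inv_inj (@opprK 'F_p))); apply: eq_card => t.
  rewrite [RHS]inE; apply/mapP/eqP => [[s]|H].
    by rewrite mem_enum inE sub0r => /andP [_ /eqP H] ->.
  exists (- t); rewrite ?opprK // mem_enum inE sub0r opprK H eqxx andbT.
  by rewrite (chiN p_pr p_gt3 pE) // H.
rewrite (eq_bigr (fun m => r%:R * e m)) => [|m m0]; last by rewrite card_chi_sum.
have := sum_root_pow; rewrite (bigD1 0) //= root_pow0 => /eqP; rewrite addrC addr_eq0 => /eqP H.
rewrite -mulr_sumr H mulrN !mulr1.
have -> : n = (r + r.+1)%N by lia.
by rewrite natrD addrC addKr.
Qed.

Lemma period_N1 : period (-1) = - period 1 - 1.
Proof. by rewrite -period_sum; ring. Qed.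

Lemma period_root a : a = 1 \/ a = -1 -> period a ^+ 2 + period a + (r.+1)%:R = 0.
Proof.
move=> Ha; rewrite -period_prod.
by case: Ha => ->; rewrite period_N1; ring.
Qed.

Lemma period_root_iff x : x ^+ 2 + x + (r.+1)%:R = 0 -> x = period 1 \/ x = period (-1).
Proof.
rewrite -period_prod => H.
have : (x - period 1) * (x - period (-1)) = 0.
  by rewrite -H period_N1; ring.
by move=> /eqP; rewrite mulf_eq0 !subr_eq0 => /orP [] /eqP ->; [left|right].
Qed.

Lemma period_neq : p%:R != 0 :> K -> period 1 != period (-1).
Proof.
apply: contraNneq => H.
have E : (period 1 - period (-1)) ^+ 2 = - p%:R.
  have -> : (period 1 - period (-1)) ^+ 2 = (period 1 + period (-1)) ^+ 2 - 4%:R * (period 1 * period (-1)) by ring.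
  rewrite period_sum period_prod [in RHS]pr natrD natrM -[r.+1]addn1 natrD; ring.
by rewrite -oppr_eq0 -E H subrr expr0n.
Qed.

(** In characteristic l, raising to the power l permutes the p-th roots of unity by
    t |-> l t, so it fixes the periods or exchanges them according to chi l. *)
Lemma period_Frobenius (l : nat) : l \in [pchar K] -> (l%:R != 0 :> 'F_p) ->
  period 1 ^+ l = period (chi (l%:R : 'F_p)).
Proof.
move=> lK l0; rewrite -(pFrobenius_autE lK) /period rmorph_sum /=.
rewrite [RHS](reindex_inj (mulfI l0)) /=.
apply: eq_big => [t|t _]; last by rewrite root_pow_mul pFrobenius_autE.
rewrite (chiM p_pr p_gt3 pE).
case: (chi_pm1 l0) => ->; first by rewrite mul1r.
by rewrite mulN1r eqr_opp.
Qed.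

End GaussPeriods.

(** * Roots of the norm polynomial and divisor sums *)

Lemma sum_divisors_coprime (G : nat -> int) (a b : nat) : (0 < a)%N -> (0 < b)%N -> coprime a b ->
  \sum_(d <- divisors (a * b)) G d =
  \sum_(i <- divisors a) \sum_(j <- divisors b) G (i * j)%N.
Proof.
move=> a0 b0 ab.
have P : perm_eq (divisors (a * b)) [seq (i * j)%N | i <- divisors a, j <- divisors b].
  apply: uniq_perm; first exact: divisors_uniq.
    apply: allpairs_uniq; try exact: divisors_uniq.
    move=> [i j] [i' j'] /allpairsP [[x y] [/= Hx Hy [-> ->]]] /allpairsP [[x' y'] [/= Hx' Hy' [-> ->]]] /= E.
    rewrite -!dvdn_divisors // in Hx Hy Hx' Hy'.
    have g (u v : nat) : (u %| a)%N -> (v %| b)%N -> gcdn (u * v) a = u.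
      move=> ua vb; rewrite gcdnC Gauss_gcdl; first by rewrite gcdnC; apply/gcdn_idPl.
      by apply: coprime_dvdr vb _.
    have xx : x = x' by rewrite -(g x y) // E g.
    move: E; rewrite xx => /eqP; rewrite eqn_pmul2l; first by move/eqP ->.
    by apply: dvdn_gt0 Hx'.
  move=> d; rewrite -dvdn_divisors ?muln_gt0 ?a0 //.
  apply/idP/allpairsP => [H|[[i j] [/= Hi Hj ->]]].
    exists (gcdn d a, gcdn d b); rewrite -!dvdn_divisors ?dvdn_gcdr //=; split => //.
    have gab : coprime (gcdn d a) (gcdn d b).
      by apply: coprime_dvdl (dvdn_gcdr d a) _; apply: coprime_dvdr (dvdn_gcdr d b) _.
    apply/eqP; rewrite eqn_dvd Gauss_dvd // !dvdn_gcdl !andbT muln_gcdl dvdn_gcd dvdn_mulr //=.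
    by rewrite muln_gcdr dvdn_gcd H dvdn_mull.
  by rewrite -!dvdn_divisors // in Hi Hj; apply: dvdn_mul.
by rewrite (perm_big _ P) big_allpairs_dep.
Qed.

Section RootMod.
Variables (p n : nat).
Hypotheses (p_pr : prime p) (p_gt3 : (3 < p)%N) (pE : p = (2 * n).+1) (n_odd : odd n).

(** The norm of omega = (1 + sqrt (-p)) / 2. *)
Definition omega_norm : nat := ((p + 1) %/ 4)%N.

Lemma omega_normE : (4 * omega_norm = p + 1)%N.
Proof. by rewrite /omega_norm; lia. Qed.

(** The norm of x + omega; its discriminant as a polynomial in x is -p. *)
Definition norm_shift (x : nat) : nat := (x ^ 2 + x + omega_norm)%N.

(** Quadratic reciprocity, in the form that serves here: the roots of the norm
    polynomial in characteristic l are the Gauss periods, and they lie in the prime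
    field exactly when Frobenius fixes them. For l = 2 the same argument applies. *)
Lemma root_mod_prime (l : nat) : prime l -> l != p ->
  (exists x : nat, (l %| norm_shift x)%N) <-> chi (l%:R : 'F_p) = 1.
Proof.
move=> l_pr lp.
have lF : l \in [pchar 'F_l] := pchar_Fp l_pr.
(* the periods are taken in an algebraic closure of the field with l elements *)
have [K [iota _]] := countable_algebraic_closure 'F_l.
have lK : l \in [pchar K] by rewrite (rmorph_pchar iota).
have l0 : l%:R != 0 :> 'F_p.
  by rewrite (Fp_nat_eq0 p_pr) dvdn_prime2 // eq_sym.
have p0 : p%:R != 0 :> K.
  by rewrite -(dvdn_pcharf lK) dvdn_prime2.
pose P : {poly K} := \sum_(i < p) 'X^i.
have sP : size P = p.
  have H : P * ('X - 1%:P) = 'X^p - 1 by rewrite mulrC subrX1.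
  have := congr1 (size \o @polyseq K) H; rewrite /= size_Mmonic ?monicXsubC //; last first.
    by apply: contra_eq_neq H => ->; rewrite mul0r eq_sym -size_poly_eq0 size_XnsubC; lia.
  by rewrite size_XsubC size_XnsubC ?prime_gt0 // addn2 => -[].
have [z zP] : exists z, root P z by apply/closed_rootP; rewrite sP; apply/eqP; lia.
have z_root : \sum_(i < p) z ^+ i = 0.
  have := rootP zP; rewrite /P horner_sum => zP'; rewrite -[RHS]zP'; apply: eq_bigr => i _.
  by rewrite hornerXn.
have rE : ((p - 3) %/ 4).+1 = omega_norm by have := omega_normE; lia.
have root_img (x : nat) : (l %| norm_shift x)%N = (x%:R ^+ 2 + x%:R + omega_norm%:R == 0 :> K).
  by rewrite (dvdn_pcharf lK) /norm_shift !natrD natrX.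
have Fr := period_Frobenius p_pr p_gt3 pE z_root lK l0.
have PN := period_neq p_pr p_gt3 pE n_odd z_root p0.
have fix_img (y : K) : y ^+ l = y -> exists x : nat, y = x%:R.
  move=> yl.
  have E : 'X^l - 'X = \prod_(x : 'F_l) ('X - (iota x)%:P) :> {poly K}.
    have := congr1 (map_poly iota) (finField_genPoly 'F_l).
    rewrite card_Fp // rmorphB rmorph_prod /= map_polyXn map_polyX => ->.
    by apply: eq_bigr => x _; rewrite rmorphB /= map_polyX map_polyC.
  have : root ('X^l - 'X) y by rewrite rootE !hornerE yl subrr.
  rewrite E rootE horner_prod => /prodf_eq0 [x _]; rewrite !hornerE subr_eq0 => /eqP ->.
  by exists x; rewrite -(rmorph_nat iota) natr_Zp.
split=> [[x]|H].
  rewrite root_img => /eqP; rewrite -rE => /(period_root_iff p_pr p_gt3 pE n_odd z_root) H.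
  have xl : (x%:R : K) ^+ l = x%:R.
    by rewrite -(pFrobenius_autE lK) rmorph_nat.
  case: (chi_pm1 l0) => // c; exfalso; rewrite c in Fr.
  move/eqP: PN; apply.
  case: H xl => ->; first by rewrite Fr.
  rewrite (period_N1 p_pr z_root) -(pFrobenius_autE lK) rmorphB rmorphN rmorph1 /= pFrobenius_autE Fr.
  rewrite (period_N1 p_pr z_root) => H.
  by rewrite -[RHS]H; ring.
rewrite H in Fr; have [x Hx] := fix_img _ Fr.
exists x; rewrite root_img -Hx -rE.
by rewrite (period_root p_pr p_gt3 pE n_odd z_root) //; left.
Qed.

Definition nroots (a : nat) : nat := #|[pred x : 'I_a | (a %| norm_shift x)%N]|.

Lemma norm_shift_mod (a x : nat) : norm_shift (x %% a) = norm_shift x %[mod a].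
Proof.
by rewrite /norm_shift -!addnA -modnDm modnXm -[RHS]modnDm; congr ((_ + _) %% _)%N; rewrite modnDml.
Qed.

Lemma dvdn_norm_shift_mod (a x : nat) : (a %| norm_shift (x %% a))%N = (a %| norm_shift x)%N.
Proof. by rewrite /dvdn norm_shift_mod. Qed.

Lemma nroots1 : nroots 1 = 1%N.
Proof. by rewrite /nroots -[RHS](card_ord 1); apply: eq_card => x; rewrite !inE dvd1n. Qed.

Lemma nroots_coprime (a b : nat) : (0 < a)%N -> (0 < b)%N -> coprime a b ->
  nroots (a * b) = (nroots a * nroots b)%N.
Proof.
move=> a0 b0 ab; rewrite /nroots -cardX.
pose g (x : 'I_(a * b)) := (Ordinal (ltn_pmod x a0), Ordinal (ltn_pmod x b0)).
have g_inj : injective g.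
  move=> x y [] Ea Eb; apply: val_inj => /=.
  rewrite -(modn_small (ltn_ord x)) -(modn_small (ltn_ord y)).
  by apply/eqP; rewrite chinese_remainder // Ea Eb !eqxx.
rewrite -(fintype.card_image g_inj); apply: eq_card => -[u v]; rewrite !inE.
apply/mapP/andP => [[x]|[/= Hu Hv]].
  rewrite mem_enum inE => H [-> ->] /=; rewrite !dvdn_norm_shift_mod.
  by split; apply: dvdn_trans H; [apply: dvdn_mulr|apply: dvdn_mull].
have ab0 : (0 < a * b)%N by rewrite muln_gt0 a0.
pose x := Ordinal (ltn_pmod (chinese a b u v) ab0).
have xa : (x %% a = u)%N.
  by rewrite /= modn_dvdm ?dvdn_mulr // chinese_modl // modn_small.
have xb : (x %% b = v)%N.
  by rewrite /= modn_dvdm ?dvdn_mull // chinese_modr // modn_small.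
exists x; last by congr (_, _); apply: val_inj.
by rewrite mem_enum inE Gauss_dvd // -(dvdn_norm_shift_mod a) -(dvdn_norm_shift_mod b) xa xb Hu.
Qed.

Let X (d : nat) : int := chi (d%:R : 'F_p).

Lemma norm_shift_disc (x : nat) : (4 * norm_shift x = (2 * x + 1) ^ 2 + p)%N.
Proof. by rewrite /norm_shift; have := omega_normE; nia. Qed.

Lemma norm_shift_add (x t : nat) : norm_shift (x + t) = (norm_shift x + t * (2 * x + 1) + t ^ 2)%N.
Proof. by rewrite /norm_shift; ring. Qed.

(** Conjugation of omega exchanges x and -1 - x, here modulo q. *)
Lemma norm_shift_reflect (x y q : nat) : (x + y + 1 = q -> norm_shift x + y * q = norm_shift y + x * q)%N.
Proof. by move=> <-; rewrite /norm_shift; ring. Qed.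

(** p is ramified: the norm polynomial has a double root modulo p. *)
Lemma nroots_p : nroots p = 1%N.
Proof.
have np : (n < p)%N by lia.
rewrite /nroots -(card1 (Ordinal np)); apply: eq_card => x; rewrite !inE.
have c4 : coprime p 4 by rewrite -[4%N]/(2 ^ 2)%N coprimeXr // prime_coprime // dvdn_prime2 //; lia.
rewrite -(Gauss_dvdr _ c4) norm_shift_disc dvdn_addl // -mulnn Euclid_dvdM // orbb.
apply/idP/eqP => [/dvdnP [k Hk]|->]; last by rewrite /= addn1 -pE.
apply: val_inj => /=; have := ltn_ord x => Hx.
have : k = 1%N by nia.
by move=> k1; rewrite k1 in Hk; lia.
Qed.

Lemma nroots_pX (k : nat) : nroots (p ^ k.+2) = 0%N.
Proof.
apply: eq_card0 => x; rewrite !inE; apply/negP => H.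
have p2 : (p ^ 2 %| norm_shift x)%N by apply: dvdn_trans H; apply: dvdn_exp2l.
have p1 : (p ^ 2 %| (2 * x + 1) ^ 2 + p)%N by rewrite -norm_shift_disc dvdn_mull.
have px : (p %| 2 * x + 1)%N.
  have : (p %| (2 * x + 1) ^ 2 + p)%N by apply: dvdn_trans p1; rewrite -mulnn dvdn_mulr.
  by rewrite dvdn_addl // -mulnn Euclid_dvdM // orbb.
have : (p ^ 2 %| p)%N by rewrite -(dvdn_addr p (dvdn_exp2r 2 px)).
move=> /dvdn_leq; rewrite prime_gt0 // => /(_ isT); rewrite leqNgt => /negP; apply.
by rewrite -[X in (X < _)%N]expn1 ltn_exp2l //; lia.
Qed.

Lemma nroots_none (l k : nat) : prime l -> l != p -> X l = -1 -> nroots (l ^ k.+1) = 0%N.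
Proof.
move=> l_pr lp Xl; apply: eq_card0 => x; rewrite !inE; apply/negP => H.
have : exists x : nat, (l %| norm_shift x)%N by exists x; apply: dvdn_trans H; rewrite expnS dvdn_mulr.
by move/(root_mod_prime l_pr lp); rewrite -/(X l) Xl.
Qed.

(** Hensel's lemma: a root modulo l is simple, since its discriminant -p is prime
    to l. *)
Lemma lift_root (l k : nat) : prime l -> l != p -> X l = 1 -> exists x : nat, (l ^ k %| norm_shift x)%N.
Proof.
move=> l_pr lp Xl; have [x1 Hx1] : exists x : nat, (l %| norm_shift x)%N by apply/root_mod_prime.
have simple x : (l %| norm_shift x)%N -> coprime (2 * x + 1) l.
  move=> H; rewrite coprime_sym prime_coprime //; apply/negP => H2.
  have : (l %| (2 * x + 1) ^ 2 + p)%N by rewrite -norm_shift_disc dvdn_mull.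
  rewrite dvdn_addr; last by rewrite -mulnn dvdn_mulr.
  by rewrite dvdn_prime2 // (negPf lp).
elim: k => [|[|k] IH]; first by exists 0%N; rewrite dvd1n.
  by exists x1; rewrite expn1.
case: IH => x Hx; have lx : (l %| norm_shift x)%N by apply: dvdn_trans Hx; rewrite expnS dvdn_mulr.
have /dvdnP [m Hm] := Hx.
have := simple _ lx; rewrite /coprime => /eqP g1.
have l0 : (0 < 2 * x + 1)%N by rewrite addn1.
have [u v Huv _] := egcdnP l l0; rewrite g1 in Huv.
(* the linear term forces m + j (2 x + 1) = 0 mod l; here u inverts 2 x + 1
   modulo l, and l - 1 stands for -1 *)
pose j := (u * m * (l - 1))%N.
exists (x + l ^ k.+1 * j)%N.
have -> : norm_shift (x + l ^ k.+1 * j) = (l ^ k.+1 * (m + j * (2 * x + 1)) + l ^ (k.+1 + k.+1) * j ^ 2)%N.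
  by rewrite norm_shift_add Hm expnD; ring.
apply: dvdn_add; last by apply: dvdn_mulr; apply: dvdn_exp2l; lia.
rewrite expnSr dvdn_pmul2l ?expn_gt0 ?prime_gt0 //.
have -> : (m + j * (2 * x + 1) = m + m * (l - 1) * (u * (2 * x + 1)))%N by rewrite /j; nia.
rewrite Huv; apply/dvdnP; exists (m + m * (l - 1) * v)%N.
by have := prime_gt0 l_pr; nia.
Qed.

(** The two roots are exchanged by conjugation. If z is any root, q divides
    (z - x) (z + x + 1), and l divides only one of the two factors. *)
Lemma nroots_two (l k : nat) : prime l -> l != p -> X l = 1 -> nroots (l ^ k.+1) = 2%N.
Proof.
move=> l_pr lp Xl; have [x0 Hx0] := lift_root k.+1 l_pr lp Xl.
set q := (l ^ k.+1)%N in Hx0 *.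
have q0 : (0 < q)%N by rewrite expn_gt0 prime_gt0.
have lq : (l %| q)%N by rewrite /q expnS dvdn_mulr.
pose x := Ordinal (ltn_pmod x0 q0).
pose y := Ordinal (ltn_pmod (q - 1 - x) q0).
have Hx : (q %| norm_shift x)%N by rewrite /= dvdn_norm_shift_mod.
have xq : (x < q)%N := ltn_ord x.
have yE : nat_of_ord y = (q - 1 - x)%N by rewrite /= modn_small //; lia.
have xyq : (x + y + 1 = q)%N by rewrite yE; clear -xq; lia.
have Hy : (q %| norm_shift y)%N.
  have E := norm_shift_reflect xyq.
  have : (q %| norm_shift y + x * q)%N by rewrite -E dvdn_add // dvdn_mull.
  by rewrite dvdn_addl // dvdn_mull.
have lx : ~~ (l %| 2 * x + 1)%N.
  apply/negP => H2.
  have : (l %| (2 * x + 1) ^ 2 + p)%N by rewrite -norm_shift_disc dvdn_mull // (dvdn_trans lq).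
  rewrite dvdn_addr; last by rewrite -mulnn dvdn_mulr.
  by rewrite dvdn_prime2 // (negPf lp).
have xy : x != y.
  apply/negP => /eqP E; move/negP: lx; apply.
  have <- // : q = (2 * x + 1)%N.
  have vE : nat_of_ord x = y := congr1 val E.
  transitivity (x + y + 1)%N; first by rewrite xyq.
  by rewrite -vE; ring.
rewrite /nroots -[RHS](_ : #|[set x; y]| = 2%N); last by rewrite cards2 xy.
apply: eq_card => z; rewrite !inE; apply/idP/orP => [Hz|[/eqP ->|/eqP ->] //].
have zq : (z < q)%N := ltn_ord z.
pose d := ((z - x) + (x - z))%N.
have Hd : (q %| d * (z + x + 1))%N.
  case: (leqP x z) => xz.
    have E : (norm_shift z = norm_shift x + d * (z + x + 1))%N.
      have := subnKC xz; rewrite /d (eqP (_ : x - z == 0)%N) ?subn_eq0 // addn0.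
      by move: (z - x)%N => t <-; rewrite /norm_shift; ring.
    by move: Hz; rewrite E dvdn_addr.
  have E : (norm_shift x = norm_shift z + d * (z + x + 1))%N.
    have := subnKC (ltnW xz); rewrite /d (eqP (_ : z - x == 0)%N) ?subn_eq0 ?(ltnW xz) // add0n.
    by move: (x - z)%N => t <-; rewrite /norm_shift; ring.
  by move: Hx; rewrite E dvdn_addr.
have cop (m : nat) : ~~ (l %| m)%N -> coprime q m.
  by move=> H; rewrite /q coprimeXl // prime_coprime.
case: (boolP (l %| z + x + 1)%N) => H1; last first.
  move: Hd; rewrite Gauss_dvdl ?cop // => Hd; left; apply/eqP/val_inj.
  change (nat_of_ord z = nat_of_ord x).
  case: (posnP d) => d0; first by move: d0; rewrite /d; clear; lia.
  by have := dvdn_leq d0 Hd; move: xq zq; rewrite /d; clear; lia.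
have H2 : ~~ (l %| d)%N.
  apply/negP => H2; move/negP: lx; apply.
  case: (leqP x z) => xz.
    have E : (z + x + 1 = d + (2 * x + 1))%N by move: xz; rewrite /d; clear; lia.
    by move: H1; rewrite E dvdn_addr.
  have E : (2 * x + 1 = (z + x + 1) + d)%N by move: xz; rewrite /d; clear; lia.
  by rewrite E dvdn_add.
move: Hd; rewrite Gauss_dvdr ?cop // => /dvdnP [m Hm]; right; apply/eqP/val_inj.
change (nat_of_ord z = nat_of_ord y).
have m1 : m = 1%N by move: Hm xq zq; clear; nia.
by rewrite yE; move: Hm; rewrite m1; clear; lia.
Qed.

Lemma nroots_prime (l : nat) : prime l -> (nroots l)%:Z = 1 + X l.
Proof.
move=> l_pr; case: (eqVneq l p) => [->|lp].
  by rewrite nroots_p /X pchar_Fp_0 // chi0.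
have l0 : l%:R != 0 :> 'F_p by rewrite (Fp_nat_eq0 p_pr) dvdn_prime2 // eq_sym.
rewrite -[l in nroots l]expn1; case: (chi_pm1 l0); rewrite -/(X l) => H.
  by rewrite nroots_two // H.
by rewrite nroots_none // H.
Qed.

Lemma nroots_prime_pow (l k : nat) : prime l -> (nroots (l ^ k.+2))%:Z = X l ^+ k.+1 + X l ^+ k.+2.
Proof.
move=> l_pr; case: (eqVneq l p) => [->|lp].
  by rewrite nroots_pX /X pchar_Fp_0 // chi0 !expr0n.
have l0 : l%:R != 0 :> 'F_p by rewrite (Fp_nat_eq0 p_pr) dvdn_prime2 // eq_sym.
case: (chi_pm1 l0); rewrite -/(X l) => H.
  by rewrite nroots_two // H !expr1n.
by rewrite nroots_none // H (exprS _ k.+1) mulN1r addrN.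
Qed.

(** The number of ideals of norm m, written d (a Z + (x + omega) Z) with
    d^2 a = m. *)
Definition ideal_count (m : nat) : int :=
  \sum_(d <- divisors m | (d ^ 2 %| m)%N) (nroots (m %/ d ^ 2))%:Z.

Definition chi_count (m : nat) : int := \sum_(d <- divisors m) X d.

Lemma chi_natM a b : X (a * b) = X a * X b.
Proof. by rewrite /X natrM (chiM p_pr p_gt3 pE). Qed.

Lemma chi_count_coprime a b : (0 < a)%N -> (0 < b)%N -> coprime a b ->
  chi_count (a * b) = chi_count a * chi_count b.
Proof.
move=> a0 b0 ab; rewrite /chi_count sum_divisors_coprime // mulr_suml.
by apply: eq_bigr => i _; rewrite mulr_sumr; apply: eq_bigr => j _; rewrite chi_natM.
Qed.

Lemma ideal_count_coprime a b : (0 < a)%N -> (0 < b)%N -> coprime a b ->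
  ideal_count (a * b) = ideal_count a * ideal_count b.
Proof.
move=> a0 b0 ab; rewrite /ideal_count big_mkcond sum_divisors_coprime //.
rewrite [X in X * _]big_mkcond [X in _ * X]big_mkcond mulr_suml /= big_seq [RHS]big_seq.
apply: eq_bigr => i; rewrite -dvdn_divisors // => ia.
rewrite mulr_sumr big_seq [RHS]big_seq; apply: eq_bigr => j; rewrite -dvdn_divisors // => jb.
have ib : coprime (i ^ 2) b by rewrite coprimeXl // (coprime_dvdl ia).
have ja : coprime (j ^ 2) a by rewrite coprimeXl // coprime_sym (coprime_dvdr jb).
have ij : coprime (i ^ 2) (j ^ 2) by rewrite coprimeXr // (coprime_dvdr jb).
rewrite expnMn Gauss_dvd // Gauss_dvdl // Gauss_dvdr //.
case: (boolP (i ^ 2 %| a)%N) => [H1|_]; last by rewrite mul0r.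
case: (boolP (j ^ 2 %| b)%N) => [H2|_]; last by rewrite mulr0.
rewrite -PoszM -nroots_coprime.
- have i0 := dvdn_gt0 a0 H1; have j0 := dvdn_gt0 b0 H2.
  by rewrite /= -{1}(divnK H1) -{1}(divnK H2) mulnACA mulnK // muln_gt0 i0.
- by rewrite divn_gt0 ?(dvdn_gt0 a0 H1) //; exact: dvdn_leq.
- by rewrite divn_gt0 ?(dvdn_gt0 b0 H2) //; exact: dvdn_leq.
by apply: coprime_dvdl (dvdn_div H1) _; apply: coprime_dvdr (dvdn_div H2) _.
Qed.

Lemma big_divisors_pow (G : nat -> int) (l k : nat) : prime l ->
  \sum_(d <- divisors (l ^ k)) G d = \sum_(i < k.+1) G (l ^ i)%N.
Proof.
move=> l_pr; rewrite -(big_mkord xpredT (fun i => G (l ^ i)%N)).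
have lk0 : (0 < l ^ k)%N by rewrite expn_gt0 prime_gt0.
have P : perm_eq (divisors (l ^ k)) [seq (l ^ i)%N | i <- index_iota 0 k.+1].
  apply: uniq_perm; first exact: divisors_uniq.
    rewrite map_inj_uniq ?iota_uniq //; apply: expnI; exact: prime_gt1.
  move=> d; rewrite -dvdn_divisors //; apply/(dvdn_pfactor _ _ l_pr)/mapP => [[m mk ->]|[m]].
    by exists m => //; rewrite mem_index_iota.
  by rewrite mem_index_iota => mk ->; exists m.
by rewrite (perm_big _ P) big_map.
Qed.

(** Induction on k in steps of two: removing the factor l from an ideal of norm
    l ^ (k + 2) leaves one of norm l ^ k. *)
Lemma counts_prime_pow l k : prime l -> ideal_count (l ^ k) = chi_count (l ^ k).
Proof.
move=> l_pr; have XX i : X (l ^ i) = X l ^+ i.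
  by elim: i => [|i IH]; [rewrite /X chi1|rewrite expnS chi_natM IH exprS].
rewrite /ideal_count /chi_count big_mkcond !big_divisors_pow //.
under [RHS]eq_bigr do rewrite XX.
have cond i : (i <= k)%N -> ((l ^ i) ^ 2 %| l ^ k)%N = (2 * i <= k)%N.
  by move=> ik; rewrite -expnM mulnC dvdn_Pexp2l // prime_gt1.
have -> : \sum_(i < k.+1) (if ((l ^ i) ^ 2 %| l ^ k)%N then (nroots (l ^ k %/ (l ^ i) ^ 2))%:Z else 0) =
   \sum_(i < k.+1) (if (2 * i <= k)%N then (nroots (l ^ (k - 2 * i)))%:Z else 0).
  apply: eq_bigr => i _; have ik : (i <= k)%N by rewrite -ltnS.
  rewrite cond //; case: ifP => // H.
  by rewrite -expnM mulnC expnB ?prime_gt0.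
elim/ltn_ind: k {cond} => -[|[|k]] IH.
- by rewrite !big_ord1 muln0 leq0n subn0 expn0 nroots1.
- by rewrite !big_ord_recr !big_ord0 /= expn1 nroots_prime // expr1 expr0; ring.
have E := IH k (ltnW (leqnn _)).
rewrite big_ord_recl /= subn0 nroots_prime_pow // [in RHS]big_ord_recr [in RHS]big_ord_recr /=.
rewrite -E.
rewrite [in LHS]big_ord_recr /=.
have -> : (2 * bump 0 k.+1 <= k.+2)%N = false by rewrite /bump; lia.
rewrite addr0 [in LHS]addrC -addrA; congr (_ + _).
apply: eq_bigr => i _; rewrite /bump /= add1n mulnS.
have -> : (2 + 2 * i <= k.+2)%N = (2 * i <= k)%N by lia.
by have -> : (k.+2 - (2 + 2 * i) = k - 2 * i)%N by lia.
Qed.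

(** The Euler product of the Dedekind zeta function, coefficient by coefficient:
    both sides are multiplicative, so only prime powers matter. *)
Theorem ideal_countE m : (0 < m)%N -> ideal_count m = chi_count m.
Proof.
elim/ltn_ind: m => m IH m0.
case: (ltngtP m 1%N) => [|m1|->]; first by lia.
  set l := pdiv m; have l_pr : prime l by apply: pdiv_prime.
  have lm : (l %| m)%N by apply: pdiv_dvd.
  rewrite -(partnC l m0).
  have c : coprime (m`_l) (m`_l^') by apply: coprime_partC.
  rewrite ideal_count_coprime ?chi_count_coprime ?part_gt0 //.
  rewrite p_part counts_prime_pow // (IH (m`_l^')%N) ?part_gt0 //.
  rewrite -{2}(partnC l m0) ltn_Pmull ?part_gt0 //.
  by rewrite p_part -(exp1n (logn l m)) ltn_exp2r ?prime_gt1 // logn_gt0 mem_primes l_pr m0.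
by have := counts_prime_pow 0 (l := 2) isT; rewrite expn0.
Qed.

(** The double sum on the left is - sum of j chi (j). Evaluating the latter by
    pairing j with p - j, and again by pairing 2 j with p - 2 j, gives two linear
    relations with the half sum, from which the first moment is eliminated. *)
Lemma double_half_sum :
  (2 - X 2) * (\sum_(i < p) \sum_(j < i.+1) X j.+1) = p%:Z * \sum_(j < n) X j.+1.
Proof.
set D := \sum_(i < p) _; set S := \sum_(j < n) _.
have chp (i : nat) : (i <= p)%N -> X (p - i) = - X i.
  by move=> ip; rewrite /X natrB // pchar_Fp_0 // sub0r (chiN p_pr p_gt3 pE).
have X0 : X 0 = 0 by rewrite /X chi0.
have Xp : X p = 0 by rewrite /X pchar_Fp_0 // chi0.
pose W := \sum_(j < n) j.+1%:Z * X j.+1.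
pose T := \sum_(j < p) j%:Z * X j.
have DT : D = - T.
  rewrite /D /T.
  have -> : \sum_(i < p) \sum_(j < i.+1) X j.+1 = \sum_(j < p) (p%:Z - j%:Z) * X j.+1.
    transitivity (\sum_(i < p) \sum_(j < p | (j <= i)%N) X j.+1).
      apply: eq_bigr => i _.
      by rewrite (big_ord_widen_cond p xpredT (fun j => X j.+1)).
    rewrite (exchange_big_dep xpredT) //=; apply: eq_bigr => j _.
    rewrite sumr_const -[LHS]mulr_natl natz; congr (_ * _).
    have -> : #|[pred i : 'I_p | (j <= i)%N]| = (p - j)%N.
      rewrite -(card_ord (p - j)) -!sum1_card.
      rewrite -(big_mkord (fun i => (j <= i)%N) (fun _ => 1%N)) big_mkcond /=.
      rewrite (@big_cat_nat _ _ _ j) //=; last exact: ltnW.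
      rewrite big_nat_cond big1; last by move=> i /andP [/andP [_ H] _]; rewrite leqNgt H.
      rewrite add0n big_nat_cond (eq_bigr (fun _ => 1%N)); last by move=> i /andP [/andP [-> _] _].
      by rewrite -big_nat_cond sum_nat_const_nat muln1 sum1_card card_ord.
    by have := ltn_ord j; lia.
  have Q : \sum_(j < p) X j.+1 = 0.
    have := sum_chi p_pr p_gt3 pE n_odd; rewrite sum_Fp // => H.
    rewrite -(big_mkord xpredT (fun j => X j.+1)) -(big_add1 _ _ 0 p.+1 xpredT X).
    rewrite big_nat_recr ?prime_gt0 //= Xp addr0.
    by rewrite -(add0r (\sum_(1 <= i < p) X i)) -X0 -big_ltn ?prime_gt0 // big_mkord.
  have -> : \sum_(j < p) (p%:Z - j%:Z) * X j.+1 = \sum_(j < p) (p%:Z + 1) * X j.+1 - \sum_(j < p) j.+1%:Z * X j.+1.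
    rewrite -sumrB; apply: eq_bigr => j _; rewrite -mulrBl; congr (_ * _); lia.
  rewrite -mulr_sumr Q mulr0 sub0r; congr (- _).
  rewrite -(big_mkord xpredT (fun j => j.+1%:Z * X j.+1)) -(big_add1 _ _ 0 p.+1 xpredT (fun j => j%:Z * X j)).
  rewrite big_nat_recr ?prime_gt0 //= Xp mulr0 addr0.
  by rewrite -(add0r (\sum_(1 <= i < p) _)) -{1}(mul0r (X 0)) -big_ltn ?prime_gt0 // big_mkord.
(* for m = 1 and m = 2 every nonzero residue is m k or p - m k for exactly one
   1 <= k <= n *)
have pair (m : nat) (G : nat -> int) : (0 < m <= 2)%N ->
    \sum_(j < p) G j = G 0%N + \sum_(j < n) (G (m * j.+1)%N + G (p - m * j.+1)%N).
  move=> m12; have m0 : m%:R != 0 :> 'F_p.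
    by rewrite (Fp_nat_eq0 p_pr); apply/negP => /dvdn_leq; lia.
  pose G' (x : 'F_p) := G (nat_of_ord x).
  have := sum_Fp_half p_pr p_gt3 pE (fun x => G' (m%:R * x)).
  have RI : \sum_(x : 'F_p) G' x = \sum_(x : 'F_p) G' (m%:R * x) by rewrite (reindex_inj (mulfI m0)).
  rewrite -RI sum_Fp //.
  have E (i : nat) : (i < p)%N -> G' i%:R = G i.
    by move=> ip; rewrite /G' val_Fp_nat // modn_small.
  have -> : \sum_(i < p) G' i%:R = \sum_(i < p) G i by apply: eq_bigr => i _; rewrite E.
  move=> ->; rewrite mulr0; congr (_ + _); apply: eq_bigr => j _.
  have jn := ltn_ord j; have mj : (0 < m * j.+1 < p)%N by nia.
  rewrite mulrN -natrM E; last by lia.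
  have -> : - (m * j.+1)%:R = (p - m * j.+1)%:R :> 'F_p.
    by rewrite natrB ?pchar_Fp_0 ?sub0r //; lia.
  by rewrite E //; lia.
have T1 : T = 2 * W - p%:Z * S.
  rewrite /T (pair 1%N (fun j => j%:Z * X j)) // mul0r add0r /W /S !mulr_sumr -sumrB; apply: eq_bigr => j _.
  have jn := ltn_ord j; rewrite mul1n chp; last by lia.
  by rewrite -subzn; [ring|lia].
have T2 : T = X 2 * (4 * W - p%:Z * S).
  rewrite /T (pair 2%N (fun j => j%:Z * X j)) // mul0r add0r /W /S !mulr_sumr -sumrB mulr_sumr; apply: eq_bigr => j _.
  have jn := ltn_ord j; rewrite chp; last by lia.
  by rewrite chi_natM -subzn; [rewrite PoszM; ring|lia].
have X2 : X 2 ^+ 2 = 1.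
  rewrite /X; apply: chi_sqr; rewrite (Fp_nat_eq0 p_pr); apply/negP => /dvdn_leq; lia.
rewrite DT; move: X2 T1 T2; move: (X 2) => c X2 T1 T2.
have E : c * T = 4 * W - p%:Z * S by rewrite T2 mulrA -expr2 X2 mul1r.
have -> : (2 - c) * - T = c * T - 2 * T by ring.
by rewrite E T1; ring.
Qed.

End RootMod.

(** * Ideals of the imaginary quadratic order as lattices *)

Section Scaling.
Local Open Scope classical_set_scope.

Definition scale (a : algC) (I : set algC) : set algC := [set a * x | x in I].

Lemma scaleM a b I : scale a (scale b I) = scale (a * b) I.
Proof.
apply/seteqP; split => z; first by move=> [_ [y Iy <-] <-]; exists y => //; rewrite mulrA.
by move=> [y Iy <-]; exists (b * y); [exists y|rewrite mulrA].
Qed.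

Lemma scale1 I : scale 1 I = I.
Proof.
apply/seteqP; split => z; first by move=> [y Iy <-]; rewrite mul1r.
by move=> Iz; exists z => //; rewrite mul1r.
Qed.

Lemma scale_inj a : a != 0 -> injective (scale a).
Proof.
move=> a0 I J /(congr1 (scale a^-1)); rewrite !scaleM mulVf // !scale1; exact.
Qed.

Lemma scale_mem a I z : I z -> scale a I (a * z).
Proof. by move=> Iz; exists z. Qed.

End Scaling.

Section Ideals.
Local Open Scope classical_set_scope.
Variables (p : nat).
Hypotheses (p_pr : prime p) (p_gt3 : (3 < p)%N) (p_mod4 : (p %% 4 = 3)%N).

Notation c0 := (omega_norm p).
Notation nf := (norm_shift p).

Let pE : p = (2 * p./2).+1. Proof. by clear -p_mod4; lia. Qed.
Let p2_odd : odd p./2. Proof. by clear -p_mod4; lia. Qed.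
Let c0E : (4 * c0 = p + 1)%N := omega_normE p_pr p_gt3 pE p2_odd.
Let nf_disc := norm_shift_disc p_pr p_gt3 pE p2_odd.

Definition rho : algC := sqrtC (- p%:Z)%:~R.

Lemma rho_sqr : rho ^+ 2 = - p%:R.
Proof. by rewrite sqrtCK rmorphN. Qed.

Definition omega : algC := (1 + rho) / 2.

Definition qint (u v : int) : algC := u%:~R + v%:~R * omega.

Definition qnorm (u v : int) : int := u ^+ 2 + u * v + c0%:Z * v ^+ 2.

Lemma omega_sqr : omega ^+ 2 = omega - c0%:R.
Proof.
have H : 4 * c0%:R = p%:R + 1 :> algC by rewrite -natrM c0E natrD.
have -> : c0%:R = (p%:R + 1) / 4 :> algC by rewrite -H; field.
have -> : p%:R = - rho ^+ 2 by rewrite rho_sqr opprK.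
by rewrite /omega; field.
Qed.

Lemma qintM u v u' v' : qint u v * qint u' v' = qint (u * u' - c0%:Z * v * v') (u * v' + u' * v + v * v').
Proof.
rewrite /qint !(rmorphB, rmorphD, rmorphM) /= -pmulrn.
have -> : (u%:~R + v%:~R * omega) * (u'%:~R + v'%:~R * omega) =
  u%:~R * u'%:~R + (u%:~R * v'%:~R + v%:~R * u'%:~R) * omega + v%:~R * v'%:~R * omega ^+ 2 by ring.
by rewrite omega_sqr; ring.
Qed.

Lemma qintD u v u' v' : qint u v + qint u' v' = qint (u + u') (v + v').
Proof. by rewrite /qint !rmorphD /=; ring. Qed.

Lemma qintN u v : - qint u v = qint (- u) (- v).
Proof. by rewrite /qint !rmorphN /=; ring. Qed.

Lemma intr_qint u : u%:~R = qint u 0.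
Proof. by rewrite /qint mul0r addr0. Qed.

Lemma qint_mul_conj u v : qint u v * qint (u + v) (- v) = (qnorm u v)%:~R.
Proof. by rewrite qintM intr_qint; congr qint; rewrite /qnorm; ring. Qed.

(** Completing the square in the norm shows that it is positive definite. *)
Lemma qnorm_disc u v : 4 * qnorm u v = (2 * u + v) ^+ 2 + p%:Z * v ^+ 2.
Proof.
have H : p%:Z = 4 * c0%:Z - 1 by have := c0E; lia.
by rewrite /qnorm H; ring.
Qed.

Lemma qnorm_ge0 u v : 0 <= qnorm u v.
Proof.
have : 0 <= 4 * qnorm u v by rewrite qnorm_disc addr_ge0 ?sqr_ge0 // mulr_ge0 ?sqr_ge0.
by lia.
Qed.

Lemma qnorm_eq0 u v : qnorm u v = 0 -> u = 0 /\ v = 0.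
Proof.
move=> H; have := qnorm_disc u v; rewrite H mulr0 => E.
have h1 := sqr_ge0 (2 * u + v); have h2 := sqr_ge0 v.
have v0 : v ^+ 2 = 0 by move: (v ^+ 2) ((2 * u + v) ^+ 2) h1 h2 E => y x *; nia.
move: E; rewrite v0 mulr0 addr0 => /eqP; rewrite eq_sym sqrf_eq0.
by move/eqP: v0; rewrite sqrf_eq0 => /eqP -> /eqP; lia.
Qed.

Lemma qnormM u v u' v' : qnorm (u * u' - c0%:Z * v * v') (u * v' + u' * v + v * v') = qnorm u v * qnorm u' v'.
Proof. by rewrite /qnorm; ring. Qed.

Lemma qint_eq0 u v : qint u v = 0 -> u = 0 /\ v = 0.
Proof.
move=> H; apply: qnorm_eq0; apply/eqP; rewrite -(intr_eq0 algC) -qint_mul_conj H mul0r //.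
Qed.

Lemma qint_inj u v u' v' : qint u v = qint u' v' -> u = u' /\ v = v'.
Proof.
move/eqP; rewrite -subr_eq0 qintN qintD => /eqP /qint_eq0 [] /eqP; rewrite subr_eq0 => /eqP -> /eqP.
by rewrite subr_eq0 => /eqP ->.
Qed.

Notation K := (quadratic_field (- p%:Z)).
Notation O := (ring_of_integers K).

Lemma qint_Aint u v : qint u v \in Aint.
Proof.
have wA : omega \in Aint.
  apply: (@root_monic_Aint ('X^2 + (c0%:R%:P - 'X))).
  - by rewrite rootE hornerD hornerXn hornerD hornerN hornerC hornerX omega_sqr addrA subrK subrr.
  - rewrite monicE lead_coefDl ?lead_coefXn // size_polyXn ltnS.
    by rewrite (leq_trans (size_polyD _ _)) // size_polyN size_polyX geq_max leqnn (leq_trans (size_polyC_leq1 _)).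
  - apply/polyOverP => i; rewrite coefD coefXn coefB coefC coefX.
    by rewrite rpredD ?rpredB ?rpred_nat //; case: (i == 0)%N; rewrite ?rpred_nat ?rpred0.
by apply: rpredD; [exact: Aint_int|apply: rpredM => //; exact: Aint_int].
Qed.

Lemma conj_rho : rho^* = - rho.
Proof.
have : (rho^*) ^+ 2 == rho ^+ 2 by rewrite -rmorphXn rho_sqr rmorphN rmorph_nat.
rewrite eqf_sqr => /orP [/eqP /CrealP rR|/eqP //].
have : 0 <= rho ^+ 2 by rewrite real_exprn_even_ge0.
by rewrite rho_sqr oppr_ge0 lern0; lia.
Qed.

(** The square of the denominator divides p. *)
Lemma rat_sqr_int (x : rat) (k : int) : p%:R * x ^+ 2 = k%:~R -> exists v : int, x = v%:~R.
Proof.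
move=> H; exists (numq x).
have d0 : (denq x)%:~R != 0 :> rat by rewrite intr_eq0 denq_neq0.
have E : p%:Z * numq x ^+ 2 = k * denq x ^+ 2.
  have H' : p%:R * ((numq x)%:~R / (denq x)%:~R) ^+ 2 = k%:~R :> rat by rewrite divq_num_den.
  by apply/eqP; rewrite -(eqr_int rat) !rmorphM /= -H'; apply/eqP; field.
have dv : (`|denq x| ^ 2 %| p)%N.
  have : (`|denq x| ^ 2 %| p * `|numq x| ^ 2)%N.
    have := congr1 absz E; rewrite !expr2 !abszM /= !mulnn => ->; exact: dvdn_mull.
  by rewrite Gauss_dvdl // coprimeXl // coprimeXr // coprime_sym coprime_num_den.
have d1 : `|denq x|%N = 1%N.
  have : (`|denq x| %| p)%N by apply: dvdn_trans dv; rewrite -mulnn dvdn_mulr.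
  move/primeP: p_pr => [_ H1 /H1 /orP [/eqP //|/eqP dp]].
  exfalso; move: dv; rewrite dp => /dvdn_leq; rewrite prime_gt0 // => /(_ isT).
  by rewrite leqNgt -[X in (X < _)%N]expn1 ltn_exp2l //; lia.
rewrite -{1}(divq_num_den x).
have -> : denq x = 1 by have := denq_gt0 x; move: d1; lia.
by rewrite divr1.
Qed.

(** The trace and the norm of an integer are rational integers. Multiplied by 4, the
    norm equation forces the coordinates 2 a and 2 b to be integers of equal
    parity. *)
Lemma ring_of_integersP z : O z <-> exists u v, z = qint u v.
Proof.
split=> [[[a [b ->]] /= zA]|[u [v ->]]]; last first.
  split; last exact: qint_Aint.
  exists (u%:~R + v%:~R / 2), (v%:~R / 2).
  by rewrite /qint /omega -/rho !(rmorphD, rmorphM, fmorphV, rmorph_int, rmorph_nat) /=; field.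
rewrite -/rho in zA *.
have cE : (ratr a + ratr b * rho)^* = ratr a - ratr b * rho.
  have cD (x y : algC) : (x + y)^* = x^* + y^* := rmorphD _ x y.
  have cM (x y : algC) : (x * y)^* = x^* * y^* := rmorphM _ x y.
  by rewrite cD (cM (ratr b) rho) conj_rho !conj_Crat ?Crat_rat // mulrN.
have cA : ratr a - ratr b * rho \in Aint by rewrite -cE Aint_aut.
have ratA (x : rat) : ratr x \in Aint -> exists k : int, x = k%:~R.
  move=> xA; have /intrP [k Hk] := Cint_rat_Aint (Crat_rat x) xA.
  exists k; apply: (fmorph_inj (ratr : rat -> algC)); apply: etrans Hk _.
  by rewrite [RHS]rmorph_int.
have [A HA] : exists k : int, a + a = k%:~R.
  apply: ratA; rewrite rmorphD /=.
  by have := rpredD zA cA; rewrite addrACA subrr addr0.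
have [m Hm] : exists k : int, a ^+ 2 + p%:R * b ^+ 2 = k%:~R.
  have N (x y : algC) : (x + y * rho) * (x - y * rho) = x ^+ 2 + p%:R * y ^+ 2.
    have -> : p%:R = - rho ^+ 2 by rewrite rho_sqr opprK.
    by ring.
  have rD (x y : rat) : ratr (x + y) = ratr x + ratr y :> algC := rmorphD _ x y.
  have rM (x y : rat) : ratr (x * y) = ratr x * ratr y :> algC := rmorphM _ x y.
  apply: ratA; rewrite !expr2 rD !rM (_ : ratr p%:R = p%:R) ?rmorph_nat // -!expr2 -N.
  exact: rpredM.
have bE : p%:R * (b + b) ^+ 2 = (4 * m - A ^+ 2)%:~R.
  by rewrite rmorphB rmorphM /= rmorphXn /= -HA -Hm; ring.
have [B HB] := rat_sqr_int bE.
rewrite HB -rmorphXn /= -(rmorph_nat intr) -rmorphM /= in bE.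
move/eqP: bE; rewrite eqr_int natz => /eqP bE.
have [u Hu] : exists u : int, A - B = u + u.
  exists ((A - B) %/ 2)%Z.
  have : (2 %| A - B)%Z.
    have : (2 %| (A - B) * (A + B))%Z.
      apply/dvdzP; exists (2 * m - 2 * c0%:Z * B ^+ 2).
      have -> : (A - B) * (A + B) = (p%:Z * B ^+ 2 + A ^+ 2) - (p%:Z + 1) * B ^+ 2 by ring.
      rewrite bE; have -> : p%:Z + 1 = 4 * c0%:Z by have := c0E; lia.
      ring.
    rewrite dvdzE abszM Euclid_dvdM // => /orP [h|h]; first by rewrite dvdzE.
    by have : (2 %| A + B)%Z; [rewrite dvdzE|lia].
  by move=> /dvdzP [q ->]; rewrite mulzK //; ring.
exists u, B.
have -> : a = A%:~R / 2 by rewrite -HA; field.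
have -> : b = B%:~R / 2 by rewrite -HB; field.
have -> : A = u + u + B by rewrite -Hu subrK.
by rewrite /qint /omega !(rmorphD, rmorphM, fmorphV, rmorph_int, rmorph_nat) /=; field.
Qed.

(** d (a Z + (x + omega) Z), in coordinates. *)
Definition lattice (d a : nat) (x : int) : set algC :=
  [set z | exists m k : int, z = qint (d%:Z * (a%:Z * m + x * k)) (d%:Z * k)].

(** The condition for a Z + (x + omega) Z to be an ideal. *)
Definition admissible (a x : nat) : Prop := (0 < a)%N /\ (a %| nf x)%N.

Lemma qnorm_shift (x : nat) : qnorm x%:Z 1 = (nf x)%:Z.
Proof. by rewrite /qnorm /norm_shift !PoszD; lia. Qed.

Lemma lattice_mod d a x : (0 < a)%N -> lattice d a x = lattice d a (x %% a)%Z.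
Proof.
move=> a0; have E := divz_eq x a%:Z; set q := (x %/ a)%Z in E *; set r := (x %% a)%Z in E *.
apply/seteqP; split => z [m [k ->]].
  by exists (m + q * k), k; congr qint; rewrite E; ring.
by exists (m - q * k), k; congr qint; rewrite E; ring.
Qed.

Lemma ring_of_integersM y z : O y -> O z -> O (y * z).
Proof.
move=> /ring_of_integersP [u [v ->]] /ring_of_integersP [u' [v' ->]]; apply/ring_of_integersP; rewrite qintM.
by eexists; eexists; reflexivity.
Qed.

Lemma ring_of_integers_int k : O k%:~R.
Proof. by apply/ring_of_integersP; rewrite intr_qint; exists k, 0. Qed.

(** x matters only modulo a. *)
Lemma admissible_mod a x : (0 < a)%N -> (a%:Z %| qnorm x 1)%Z ->
  exists x' : nat, [/\ admissible a x', (x' < a)%N & forall d, lattice d a x = lattice d a x'].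
Proof.
move=> a0 aN.
have x0 : 0 <= (x %% a)%Z by apply: modz_ge0; lia.
exists `|(x %% a)%Z|%N; split => //.
- split=> //; have : (a%:Z %| qnorm (x %% a)%Z 1)%Z.
    have E := divz_eq x a%:Z; set q := (x %/ a)%Z in E; set r := (x %% a)%Z in E *.
    have -> : qnorm r 1 = qnorm x 1 - a%:Z * (q * (q * a%:Z + 2 * r + 1)) by rewrite E /qnorm; ring.
    by apply: rpredB => //; exact: dvdz_mulr.
  by rewrite -{1}(gez0_abs x0) qnorm_shift.
- have : (x %% a)%Z < a%:Z by apply: ltz_pmod; lia.
  lia.
- by move=> d; rewrite gez0_abs // -lattice_mod.
Qed.

Lemma int_subgroup (S : int -> Prop) : (exists2 x, S x & x != 0) ->
  (forall x y, S x -> S y -> S (x - y)) ->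
  exists d : nat, (0 < d)%N /\ forall x, S x <-> (d%:Z %| x)%Z.
Proof.
move=> [x Sx x0] SB.
have S0 : S 0 by rewrite -(subrr x); apply: SB.
have SN y : S y -> S (- y) by move=> Sy; rewrite -[- y]add0r; apply: SB.
have SD y z : S y -> S z -> S (y + z) by move=> Sy Sz; rewrite -[z]opprK; apply/SB/SN.
have SM y (n : nat) : S y -> S (y * n%:Z).
  move=> Sy; elim: n => [|n IH]; first by rewrite mulr0.
  by rewrite intS mulrDr mulr1; apply: SD.
have SZ y (k : int) : S y -> S (y * k).
  by move=> Sy; case: (intP k) => [|n|n]; rewrite ?mulr0 // ?mulrN; [|apply: SN]; exact: SM.
have ex : exists n, `[< (0 < n)%N /\ S n%:Z >].
  exists `|x|%N; apply/asboolP; rewrite absz_gt0; split => //.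
  by rewrite abszE; case: (ger0P x) => _ //; exact: SN.
case: (ex_minnP ex) => d /asboolP [d0 Sd] dmin.
exists d; split => // y; split=> [Sy|/dvdzP [k ->]]; last by rewrite mulrC; apply: SZ.
apply/dvdz_mod0P; have := modz_ge0 y (_ : d%:Z != 0) => /(_ _) H.
have r0 : 0 <= (y %% d)%Z by apply: H; lia.
have rd : (y %% d)%Z < d%:Z by apply: ltz_pmod; lia.
have Sr : S (y %% d)%Z.
  have -> : (y %% d)%Z = y - (y %/ d)%Z * d%:Z.
    by apply/eqP; rewrite eq_sym subr_eq addrC -divz_eq.
  by apply: SB => //; rewrite mulrC; apply: SZ.
apply/eqP; apply: contraT => rn0.
have Hm := dmin `|(y %% d)%Z|%N.
have : (d <= `|(y %% d)%Z|)%N.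
  by apply: Hm; apply/asboolP; split; [rewrite absz_gt0|rewrite gez0_abs].
by move: rd r0; clear; lia.
Qed.

(** d is the gcd of the omega-coordinates, and a d generates the intersection with
    the rational integers. Stability under omega forces d to divide everything, and
    stability under the conjugate of x + omega forces a to divide its norm. *)
Lemma ideal_normal_form I : nonzero_ideal O I ->
  exists d a x : nat, [/\ (0 < d)%N, admissible a x, (x < a)%N & I = lattice d a x].
Proof.
case=> IO [z0 Iz0 z00] ID IM.
pose J u v := I (qint u v).
have JD u v u' v' : J u v -> J u' v' -> J (u + u') (v + v').
  by move=> H H'; rewrite /J -qintD; apply: ID.
have JZ k u v : J u v -> J (k * u) (k * v).
  move=> H; have := IM _ _ (ring_of_integers_int k) H; rewrite intr_qint qintM; congr I; congr qint; ring.
have Jw u v : J u v -> J (- c0%:Z * v) (u + v).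
  move=> H; have := IM (qint 0 1) _ _ H; rewrite qintM => /(_ (proj2 (ring_of_integersP _) _)).
  have -> : 0 * u - c0%:Z * 1 * v = - c0%:Z * v by ring.
  have -> : 0 * v + u * 1 + 1 * v = u + v by ring.
  by apply; exists 0, 1.
have JB u v u' v' : J u v -> J u' v' -> J (u - u') (v - v').
  by move=> H H'; apply: JD => //; have := JZ (-1) _ _ H'; rewrite !mulN1r.
have [A [A0 HA]] : exists d : nat, (0 < d)%N /\ forall u, J u 0 <-> (d%:Z %| u)%Z.
  apply: int_subgroup => [|x y Hx Hy]; last by have := JB _ _ _ _ Hx Hy; rewrite subr0.
  have [u [v Ez]] := proj1 (ring_of_integersP z0) (IO _ Iz0).
  exists (qnorm u v); last first.
    by apply/eqP => /qnorm_eq0 [u0 v0]; move: z00; rewrite Ez u0 v0 -intr_qint eqxx.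
  have := IM (qint (u + v) (- v)) z0; rewrite Ez mulrC qint_mul_conj intr_qint /J; apply.
    by apply/ring_of_integersP; exists (u + v), (- v).
  by rewrite -Ez.
have [d [d0 Hd]] : exists d : nat, (0 < d)%N /\ forall v, (exists u, J u v) <-> (d%:Z %| v)%Z.
  apply: int_subgroup => [|x y [u Hu] [v Hv]]; last by exists (u - v); apply: JB.
  exists A%:Z; last by lia.
  exists 0; have /Jw : J A%:Z 0 by apply/HA.
  by rewrite mulr0 addr0.
have [y Jy] : exists u, J u d%:Z by apply/Hd.
have /dvdzP [x' Hx'] : (d%:Z %| y)%Z.
  have : (d%:Z %| y + d%:Z)%Z by apply/Hd; exists (- c0%:Z * d%:Z); apply: Jw.
  by rewrite rpredDr ?dvdzz.
have /dvdzP [a' Ha'] : (d%:Z %| A%:Z)%Z.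
  apply/Hd; exists 0; have /Jw : J A%:Z 0 by apply/HA.
  by rewrite mulr0 addr0.
have [a Ea] : exists a : nat, a' = a%:Z.
  by exists `|a'|%N; rewrite gez0_abs //; nia.
have a0 : (0 < a)%N by move: Ha'; rewrite Ea; case: (a) => //; lia.
have IE : I = lattice d a x'.
  apply/seteqP; split => z.
    move=> Iz; have [u [v Ez]] := proj1 (ring_of_integersP z) (IO _ Iz).
    have Juv : J u v by rewrite /J -Ez.
    have /dvdzP [k Hk] : (d%:Z %| v)%Z by apply/Hd; exists u.
    have : J (u - k * y) 0.
      by have := JB _ _ _ _ Juv (JZ k _ _ Jy); rewrite Hk subrr.
    move=> /HA /dvdzP [m Hm]; exists m, k; rewrite Ez; congr qint; last by rewrite Hk mulrC.
    by rewrite -[u](subrK (k * y)) Hm Ha' Hx' Ea; ring.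
  move=> [m [k ->]]; have HAm : J (m * A%:Z) (m * 0) by apply: JZ; apply/HA.
  have := JD _ _ _ _ HAm (JZ k _ _ Jy); rewrite /J; congr I; congr qint.
    by rewrite Ha' Hx' Ea; ring.
  by ring.
have aN : (a%:Z %| qnorm x' 1)%Z.
  have : J (d%:Z * qnorm x' 1) 0.
    have := IM (qint (x' + 1) (- 1)) (qint y d%:Z); rewrite qintM /J => H.
    have := H _ Jy; rewrite Hx' /qnorm.
    have -> : (x' + 1) * (x' * d%:Z) - c0%:Z * (-1) * d%:Z = d%:Z * (x' ^+ 2 + x' * 1 + c0%:Z * 1 ^+ 2) by ring.
    have -> : (x' + 1) * d%:Z + (x' * d%:Z) * (-1) + (-1) * d%:Z = 0 by ring.
    by apply; apply/ring_of_integersP; exists (x' + 1), (-1).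
  move=> /HA; rewrite Ha' Ea mulrC => /dvdzP [k Hk]; apply/dvdzP; exists k.
  by apply: (@mulIf _ d%:Z); [lia|rewrite Hk; ring].
have [x [V xa L]] := admissible_mod a0 aN.
by exists d, a, x; split => //; rewrite IE.
Qed.

Lemma intr_mul_qint (r s k : int) : r%:~R * qint s k = qint (r * s) (r * k).
Proof. by rewrite intr_qint qintM; congr qint; ring. Qed.

Lemma scale_lattice D d a x : scale D%:R (lattice d a x) = lattice (D * d) a x.
Proof.
rewrite pmulrn; apply/seteqP; split => z.
  by move=> [_ [m [k ->]] <-]; exists m, k; rewrite intr_mul_qint PoszM !mulrA.
by move=> [m [k ->]]; exists (qint (d%:Z * (a%:Z * m + x * k)) (d%:Z * k));
  [exists m, k|rewrite intr_mul_qint PoszM !mulrA].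
Qed.

Lemma lattice_memA d a x : lattice d a x (qint (d%:Z * a%:Z) 0).
Proof. by exists 1, 0; congr qint; ring. Qed.

Lemma lattice_memX d a x : lattice d a x (qint (d%:Z * x) d%:Z).
Proof. by exists 0, 1; congr qint; ring. Qed.

(** The normal form is unique: d, then a, then x modulo a are read off from the
    lattice. *)
Lemma lattice_inj d a x d' a' x' : (0 < d)%N -> (0 < d')%N -> (x < a)%N -> (x' < a')%N ->
  lattice d a x%:Z = lattice d' a' x'%:Z -> [/\ d = d', a = a' & x = x'].
Proof.
have D d1 a1 x1 d2 a2 x2 : lattice d1 a1 x1%:Z = lattice d2 a2 x2%:Z -> (d2 %| d1)%N.
  move=> E; have := lattice_memX d1 a1 x1; rewrite E => -[m [k /qint_inj [_ H]]].
  by apply/dvdnP; exists `|k|%N; rewrite -[d1]absz_nat H abszM absz_nat mulnC.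
have A d1 a1 x1 a2 x2 : (0 < d1)%N -> lattice d1 a1 x1%:Z = lattice d1 a2 x2%:Z -> (a2 %| a1)%N.
  move=> d0 E; have := lattice_memA d1 a1 x1; rewrite E => -[m [k /qint_inj [H H']]].
  have k0 : k = 0 by move/esym/eqP: H'; rewrite mulf_eq0 => /orP [|] /eqP; lia.
  move: H; rewrite k0 mulr0 addr0 => /mulfI H.
  have {}H : a1%:Z = a2%:Z * m by apply: H; lia.
  by apply/dvdnP; exists `|m|%N; rewrite -[a1]absz_nat H abszM absz_nat mulnC.
move=> d0 d0' xa xa' E.
have dd : d = d' by apply/eqP; rewrite eqn_dvd (D _ _ _ _ _ _ (esym E)) (D _ _ _ _ _ _ E).
rewrite -{}dd in E *; have aa : a = a'.
  by apply/eqP; rewrite eqn_dvd (A _ _ _ _ _ d0 (esym E)) (A _ _ _ _ _ d0 E).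
rewrite -{}aa in E xa' *; split => //.
have := lattice_memX d a x; rewrite E => -[m [k /qint_inj [H H']]].
have k1 : k = 1 by apply: (@mulfI _ d%:Z); [lia|rewrite mulr1 -H'].
have {}H : x%:Z = a%:Z * m + x'%:Z by apply: (@mulfI _ d%:Z); [lia|rewrite H k1; ring].
have : (x = x' %[mod a])%N.
  by apply/eqP; rewrite -eqz_nat -!modz_nat H mulrC modzMDl.
by rewrite !modn_small.
Qed.

Lemma lattice_ideal d a x : (0 < d)%N -> (0 < a)%N -> (a%:Z %| qnorm x 1)%Z -> nonzero_ideal O (lattice d a x).
Proof.
move=> d0 a0 /dvdzP [c Hc]; split.
- by move=> z [m [k ->]]; apply/ring_of_integersP; eexists; eexists.
- exists (qint (d%:Z * a%:Z) 0); first exact: lattice_memA.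
  by apply/eqP => /qint_eq0 [/eqP]; rewrite mulf_eq0 => /orP [] /eqP; lia.
- move=> _ _ [m [k ->]] [m' [k' ->]]; exists (m + m'), (k + k'); rewrite qintD; congr qint; ring.
- move=> y _ /ring_of_integersP [u [v ->]] [m [k ->]].
  exists (u * m - x * m * v - v * k * c), (u * k + (a%:Z * m + x * k) * v + v * k).
  rewrite qintM; congr qint; last by ring.
  apply/eqP; rewrite -subr_eq0; apply/eqP.
  transitivity (d%:Z * v * k * (c * a%:Z - qnorm x 1)); last by rewrite Hc; ring.
  by rewrite /qnorm; ring.
Qed.

Lemma admissible_ideal d a x : (0 < d)%N -> admissible a x -> nonzero_ideal O (lattice d a x).
Proof. by move=> d0 [a0 ax]; apply: lattice_ideal => //; rewrite qnorm_shift. Qed.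

(** The coefficients a, 2 x + 1 and norm (x + omega) / a of the norm form have
    no common factor: the square of a common prime factor would divide the
    discriminant -p. The factor M stands for a content. *)
Lemma norm_form_primitive (a x : nat) (g M : nat) : admissible a x ->
  (g %| M * a)%N -> (g %| M * (2 * x + 1))%N -> (g %| M * (nf x %/ a))%N -> (g %| M)%N.
Proof.
move=> [a0 ax] Ha Hb Hc.
suff G : gcdn (gcdn a (2 * x + 1)) (nf x %/ a) = 1%N.
  by rewrite -[M]muln1 -G !muln_gcdr !dvdn_gcd Ha Hb Hc.
apply/eqP; apply: contraT => G1.
have [|l l_pr lG] := @pdivP (gcdn (gcdn a (2 * x + 1)) (nf x %/ a)).
  by rewrite ltn_neqAle eq_sym G1 gcdn_gt0 gcdn_gt0 a0.
move: lG; rewrite !dvdn_gcd => /andP [/andP [la lb] lc].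
have disc := nf_disc x.
have : (l ^ 2 %| p)%N.
  rewrite -(@dvdn_addr ((2 * x + 1) ^ 2)) ?dvdn_exp2r // -disc dvdn_mull //.
  by rewrite -(divnK ax) -mulnn mulnC dvdn_mul.
move=> lp; have : (l %| p)%N by apply: dvdn_trans lp; rewrite dvdn_exp.
rewrite dvdn_prime2 // => /eqP lE; move: lp; rewrite lE => /dvdn_leq.
by move/(_ (prime_gt0 p_pr)); rewrite -mulnn; move: p_gt3; clear; nia.
Qed.

Lemma qnorm_lattice d a x m k : admissible a x ->
  qnorm (d%:Z * (a%:Z * m + x%:Z * k)) (d%:Z * k) =
  (d ^ 2 * a)%:Z * (a%:Z * m ^+ 2 + (2 * x + 1)%:Z * m * k + (nf x %/ a)%:Z * k ^+ 2).
Proof.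
move=> [a0 ax]; have E : (nf x)%:Z = (nf x %/ a)%:Z * a%:Z by rewrite -PoszM divnK.
transitivity ((d ^ 2)%:Z * (a%:Z * (a%:Z * m ^+ 2 + (2 * x + 1)%:Z * m * k) + (nf x)%:Z * k ^+ 2)).
  by rewrite -qnorm_shift /qnorm; lia.
by rewrite E PoszM; ring.
Qed.

(** So the norm of a lattice is the gcd of the norms of its elements, which needs
    only three elements to be seen. *)
Lemma index_gcd D A X (g M : nat) : admissible A X ->
  (forall r s, lattice D A X%:Z (qint r s) -> (g%:Z %| M%:Z * qnorm r s)%Z) -> (g %| M * (D ^ 2 * A))%N.
Proof.
move=> V H.
have {}H m k : (g%:Z %| (M * (D ^ 2 * A))%:Z *
    (A%:Z * m ^+ 2 + (2 * X + 1)%:Z * m * k + (nf X %/ A)%:Z * k ^+ 2))%Z.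
  rewrite PoszM -mulrA -qnorm_lattice //; apply: H; by exists m, k.
have Ha : (g %| M * (D ^ 2 * A) * A)%N.
  by have := H 1 0; rewrite expr1n expr0n /= !mulr0 mulr1 !addr0 -PoszM dvdzE.
have Hc : (g %| M * (D ^ 2 * A) * (nf X %/ A))%N.
  by have := H 0 1; rewrite expr1n expr0n /= !(mulr0, mul0r, add0r) mulr1 -PoszM dvdzE.
apply: (norm_form_primitive V Ha) => //.
have := H 1 1; rewrite !expr1n !mulr1 -!PoszD -PoszM dvdzE !absz_nat !mulnDr.
by rewrite dvdn_addl // dvdn_addr // -mulnDr.
Qed.

(** Norms of ideals are multiplicative with respect to principal ideals, by their
    description as gcds. *)
Lemma norm_index u v D A X D' A' X' : admissible A X -> admissible A' X' ->
  lattice D A X%:Z = scale (qint u v) (lattice D' A' X'%:Z) ->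
  (D ^ 2 * A)%:Z = qnorm u v * (D' ^ 2 * A')%:Z.
Proof.
move=> V V' E.
pose N := `|qnorm u v|%N; have NE : qnorm u v = N%:Z by rewrite gez0_abs ?qnorm_ge0.
rewrite NE -PoszM; congr Posz; apply/eqP; rewrite eqn_dvd; apply/andP; split.
- apply: (index_gcd V') => r s rs.
  have : lattice D A X (qint u v * qint r s) by rewrite E; apply: scale_mem.
  rewrite qintM => -[m [k /qint_inj [h1 h2]]].
  by rewrite -NE -qnormM h1 h2 qnorm_lattice // dvdz_mulr.
- rewrite -[X in (_ %| X)%N]mul1n; apply: (index_gcd V) => r s.
  rewrite E mul1r => -[_ [m [k ->]]]; rewrite qintM => /qint_inj [<- <-].
  by rewrite qnormM qnorm_lattice // NE mulrA -PoszM dvdz_mulr.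
Qed.

(** y / y' maps the lattice into itself, so it is integral. In coordinates: if it
    sends a to a m + (x + omega) k, then a divides k times each coefficient of
    the norm form, hence k, because the form is primitive. *)
Lemma stabilizer_integral (a x : nat) (y y' : algC) : admissible a x -> y' != 0 ->
  scale y (lattice 1 a x%:Z) `<=` scale y' (lattice 1 a x%:Z) -> exists u v, y = y' * qint u v.
Proof.
move=> V mu0 sub; have [a0 ax] := V.
have E : (nf x)%:Z = (nf x %/ a)%:Z * a%:Z by rewrite -PoszM divnK.
have aC : a%:R != 0 :> algC by rewrite pnatr_eq0 -lt0n.
have [_ [m [k ->]] H1] := sub _ (scale_mem y (lattice_memA 1 a x%:Z)).
have [_ [m2 [k2 ->]] H2] := sub _ (scale_mem y (lattice_memX 1 a x%:Z)).
rewrite !mul1r -intr_qint in H1 H2.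
have H3 : qint (a%:Z * m + x%:Z * k) k * qint x%:Z 1 = a%:~R * qint (a%:Z * m2 + x%:Z * k2) k2.
  by apply: (mulfI mu0); rewrite mulrA H1 mulrCA H2; ring.
move: H3; rewrite qintM intr_mul_qint => /qint_inj [h1 h2].
have kc : k * (nf x %/ a)%:Z = - m2 * a%:Z.
  apply: (@mulfI _ a%:Z); first by lia.
  have <- : k * (nf x)%:Z = a%:Z * (k * (nf x %/ a)%:Z) by rewrite E; ring.
  have h3 := congr1 (fun t => x%:Z * t) h2.
  by rewrite -qnorm_shift /qnorm; move: h1 h3; clear; lia.
have /dvdnP [q Hq] : (a %| `|k|)%N.
  apply: (norm_form_primitive V); first exact: dvdn_mull.
    rewrite -[(2 * x + 1)%N]absz_nat -abszM; change (a%:Z %| k * (2 * x + 1)%N%:Z)%Z.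
    by apply/dvdzP; exists (k2 - m); move: h2; clear; lia.
  rewrite -[(nf x %/ a)%N]absz_nat -abszM kc; change (a%:Z %| - m2 * a%:Z)%Z.
  exact: dvdz_mull.
have [k1 Hk] : exists k1 : int, k = a%:Z * k1.
  by exists (sgz k * q%:Z); rewrite [LHS]intEsg Hq PoszM; ring.
exists (m + x%:Z * k1), k1.
apply: (mulIf aC); rewrite pmulrn -H1 -mulrA [_ * a%:~R]mulrC intr_mul_qint Hk; congr (_ * qint _ _); ring.
Qed.

(** The only units are 1 and -1, because p > 4. *)
Lemma qnorm_eq1 u v : qnorm u v = 1 -> v = 0 /\ (u = 1 \/ u = -1).
Proof.
move=> H; have := qnorm_disc u v; rewrite H => E.
have v0 : v = 0.
  apply/eqP; rewrite -sqrf_eq0; apply/eqP.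
  have h1 := sqr_ge0 (2 * u + v); have h2 := sqr_ge0 v.
  move: (v ^+ 2) ((2 * u + v) ^+ 2) h1 h2 E => y x *; nia.
split=> //; rewrite v0 in E; have : u ^+ 2 = 1 by move: E; rewrite expr0n /=; lia.
by move/eqP; rewrite sqrf_eq1 => /orP [] /eqP ->; [left|right].
Qed.

Lemma scale_eq_pm (a x : nat) (y y' : algC) : admissible a x -> y != 0 -> y' != 0 ->
  scale y (lattice 1 a x%:Z) = scale y' (lattice 1 a x%:Z) -> y = y' \/ y = - y'.
Proof.
move=> V m0 m0' E.
have [|u [v H]] := stabilizer_integral V m0' (y := y); first by rewrite E.
have [|u' [v' H']] := stabilizer_integral V m0 (y := y'); first by rewrite E.
have : qint u v * qint u' v' = qint 1 0.
  by apply: (mulfI m0'); rewrite mulrA -H -H' -intr_qint mulr1.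
rewrite qintM => /qint_inj [h1 h2].
have := qnormM u v u' v'; rewrite h1 h2 /qnorm.
rewrite -/(qnorm u v) -/(qnorm u' v') => h.
have {}h : qnorm u v * qnorm u' v' = 1 by rewrite -h; ring.
have n1 : qnorm u v = 1.
  move: (qnorm_ge0 u v) (qnorm_ge0 u' v') h; move: (qnorm u v) (qnorm u' v') => s t.
  case: s => // s _; case: t => // t _; rewrite -PoszM => -[] /eqP.
  by rewrite muln_eq1 => /andP [/eqP ->].
have [v0 u1] := qnorm_eq1 n1.
rewrite H v0 -intr_qint; case: u1 => ->; [left|right]; first by rewrite mulr1.
by rewrite rmorphN mulrN mulr1.
Qed.

Lemma scale_ideal y I : O y -> y != 0 -> nonzero_ideal O I -> nonzero_ideal O (scale y I).
Proof.
move=> Oy y0 [IO [z Iz z0] ID IM]; split.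
- by move=> _ [t It <-]; apply: ring_of_integersM => //; apply: IO.
- by exists (y * z); [exact: scale_mem|rewrite mulf_neq0].
- by move=> _ _ [s Is <-] [t It <-]; rewrite -mulrDr; apply/scale_mem/ID.
- by move=> b _ Ob [s Is <-]; rewrite mulrCA; apply/scale_mem/IM.
Qed.

(** * Ideals of a class and values of its norm form *)

(** The norms of the elements of a Z + (x + omega) Z, divided by a. *)
Definition norm_form (a x : nat) (m k : int) : nat := qform a (2 * x + 1)%:Z (nf x %/ a) m k.

(** a m + k (x + 1 - omega), where x + 1 - omega is the conjugate of x + omega: the
    elements of the conjugate lattice. *)
Definition multiplier (a x : nat) (m k : int) : algC := qint (a%:Z * m + k * (x%:Z + 1)) (- k).

Lemma posdef_norm_form a x : admissible a x -> posdef a (2 * x + 1)%:Z (nf x %/ a).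
Proof.
move=> [a0 ax]; have n0 : (0 < nf x)%N by rewrite /norm_shift; move: c0E; clear; lia.
split=> //; first by rewrite divn_gt0 // dvdn_leq.
have E : (4 * a * (nf x %/ a) = (2 * x + 1) ^ 2 + p)%N by rewrite -mulnA (mulnC a) divnK // nf_disc.
have -> : 4 * a%:Z * (nf x %/ a)%N%:Z = ((2 * x + 1) ^ 2 + p)%N%:Z by rewrite -E !PoszM.
by rewrite expr2 -PoszM mulnn ltz_nat; move: p_gt3; clear; lia.
Qed.

Lemma qnorm_multiplier a x m k : admissible a x ->
  qnorm (a%:Z * m + k * (x%:Z + 1)) (- k) = a%:Z * (norm_form a x m k)%:Z.
Proof.
move=> V; have [a0 ax] := V; have E : (nf x)%:Z = (nf x %/ a)%:Z * a%:Z by rewrite -PoszM divnK.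
rewrite /norm_form qformE; last exact: posdef_norm_form.
transitivity (a%:Z * (a%:Z * m ^+ 2 + (2 * x + 1)%:Z * m * k) + (nf x)%:Z * k ^+ 2).
  by rewrite -qnorm_shift /qnorm; lia.
by rewrite E; ring.
Qed.

(** The vector (m, k) gives the element y of the conjugate of J = a Z + (x + omega) Z,
    and y J is a times an ideal equivalent to J; the ideal is the lattice with
    parameters d, a' and x'. Multiplying by a avoids division of lattices. *)
Definition related a x m k d a' x' : Prop :=
  lattice (a * d) a' x'%:Z = scale (multiplier a x m k) (lattice 1 a x%:Z).

(** All elements of y J have omega-coordinates divisible by a, since J times its
    conjugate lies in a O. *)
Lemma related_ex a x m k : admissible a x -> (0 < norm_form a x m k)%N ->
  exists d a' x' : nat, [/\ (0 < d)%N, admissible a' x', (x' < a')%N & related a x m k d a' x'].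
Proof.
move=> V Q0; have [a0 ax] := V.
have mu0 : multiplier a x m k != 0.
  apply/eqP => /qint_eq0 [h1 h2]; have := qnorm_multiplier m k V.
  rewrite h1 h2 /qnorm => /esym/eqP; rewrite !(mulr0, expr0n) /= addr0 mulf_eq0.
  by move=> /orP [] /eqP; lia.
have Omu : O (multiplier a x m k) by apply/ring_of_integersP; eexists; eexists.
have [D [a' [x' [D0 V' xa E]]]] := ideal_normal_form (scale_ideal Omu mu0 (@admissible_ideal 1 a x isT V)).
have /dvdnP [d Hd] : (a %| D)%N.
  have := lattice_memX D a' x'%:Z; rewrite -E => -[_ [m1 [k1 ->]]].
  rewrite qintM => /qint_inj [_ h]; change (a%:Z %| D%:Z)%Z.
  by rewrite -h; apply/dvdzP; exists (m * k1 - m1 * k); ring.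
exists d, a', x'; split=> //; first by move: D0; rewrite Hd muln_gt0 => /andP [].
by rewrite /related mulnC -Hd.
Qed.

(** Under this correspondence the value of the norm form is the norm of the ideal. *)
Lemma related_norm a x m k d a' x' : admissible a x -> admissible a' x' -> related a x m k d a' x' ->
  (d ^ 2 * a')%N = norm_form a x m k.
Proof.
move=> V V' /(norm_index V' V); rewrite qnorm_multiplier // exp1n mul1n => /eqP.
rewrite mulrAC -!PoszM eqz_nat expnMn -mulnA -mulnn eqn_pmul2l; first by move/eqP.
by have [a0 _] := V; rewrite muln_gt0 a0.
Qed.

(** If alpha I = beta J, then a lies in J, so a beta = alpha y with y in I; thus
    a I = y J, and y lies in the conjugate of J because y (x + omega) is in a O. *)
Lemma related_of_equiv a x d a' x' : admissible a x -> admissible a' x' -> (0 < d)%N ->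
  ideal_equiv O (lattice d a' x'%:Z) (lattice 1 a x%:Z) -> exists m k, related a x m k d a' x'.
Proof.
move=> V V' d0 [alpha [beta [Oa Ob a0 b0 E]]].
have IO : lattice d a' x'%:Z `<=` O by have [] := admissible_ideal d0 V'.
have [z Iz H1] : scale alpha (lattice d a' x'%:Z) (beta * qint (1 * a%:Z) 0).
  by rewrite /scale E; apply: scale_mem; apply: lattice_memA.
have [y Iy H2] : scale alpha (lattice d a' x'%:Z) (beta * qint (1 * x%:Z) 1).
  by rewrite /scale E; apply: scale_mem; apply: lattice_memX.
have [r [s Ez]] := proj1 (ring_of_integersP _) (IO _ Iz); have [y1 [y2 Ey]] := proj1 (ring_of_integersP _) (IO _ Iy).
rewrite !mul1r -?intr_qint in H1 H2.
have : qint r s * qint x%:Z 1 = a%:~R * qint y1 y2.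
  by apply: (mulfI a0); rewrite -Ez -Ey mulrA H1 mulrCA H2; ring.
rewrite qintM intr_mul_qint => /qint_inj [_ h].
exists y2, (- s); rewrite /related.
have -> : multiplier a x y2 (- s) = z by rewrite Ez /multiplier; congr qint; move: h; clear; lia.
have E' : scale alpha (lattice d a' x'%:Z) = scale beta (lattice 1 a x%:Z) := E.
rewrite -scale_lattice; apply: (scale_inj a0); rewrite [RHS]scaleM H1 [beta * _]mulrC.
by rewrite -[RHS]scaleM -E' !scaleM mulrC -pmulrn.
Qed.

Lemma related_equiv a x m k d a' x' : admissible a x -> (0 < norm_form a x m k)%N -> related a x m k d a' x' ->
  ideal_equiv O (lattice d a' x'%:Z) (lattice 1 a x%:Z).
Proof.
move=> V Q0; have [a0 ax] := V; rewrite /related -scale_lattice => E.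
exists a%:R, (multiplier a x m k); split => //.
- by rewrite pmulrn; exact: ring_of_integers_int.
- by apply/ring_of_integersP; eexists; eexists.
- by rewrite pnatr_eq0 -lt0n.
apply/eqP => /qint_eq0 [h1 h2]; have := qnorm_multiplier m k V.
rewrite h1 h2 /qnorm => /esym/eqP; rewrite !(mulr0, expr0n) /= addr0 mulf_eq0.
by move=> /orP [] /eqP; lia.
Qed.

Lemma related_opp a x m k d a' x' : related a x m k d a' x' -> related a x (- m) (- k) d a' x'.
Proof.
rewrite /related => ->.
have -> : multiplier a x (- m) (- k) = (-1) * multiplier a x m k.
  by rewrite mulN1r /multiplier qintN; congr qint; ring.
rewrite -scaleM; apply/seteqP; split => _ [y Iy <-].
- exists (multiplier a x m k * - y); last by rewrite mulN1r mulrN opprK.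
  apply: scale_mem; move: Iy => [u [v ->]]; exists (- u), (- v); rewrite qintN; congr qint; ring.
- case: Iy => [z [u [v ->]] <-]; rewrite mulN1r -mulrN.
  apply: scale_mem; exists (- u), (- v); rewrite qintN; congr qint; ring.
Qed.

(** Two vectors related to the same ideal differ by a unit. *)
Lemma related_pm a x m k m' k' d a' x' : admissible a x -> (0 < norm_form a x m k)%N -> (0 < norm_form a x m' k')%N ->
  related a x m k d a' x' -> related a x m' k' d a' x' ->
  (m, k) = (m', k') \/ (m, k) = (- m', - k').
Proof.
move=> V Q0 Q0'; rewrite /related => -> E; have [a0 ax] := V.
have N0 m1 k1 : (0 < norm_form a x m1 k1)%N -> multiplier a x m1 k1 != 0.
  move=> Q1; apply/eqP => /qint_eq0 [h1 h2]; have := qnorm_multiplier m1 k1 V.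
  rewrite h1 h2 /qnorm => /esym/eqP; rewrite !(mulr0, expr0n) /= addr0 mulf_eq0.
  by move=> /orP [] /eqP; lia.
have inj m1 k1 : multiplier a x m k = multiplier a x m1 k1 -> (m, k) = (m1, k1).
  move=> /qint_inj [h1 /oppr_inj kk]; congr (_, _) => //; apply: (@mulfI _ a%:Z); first by lia.
  by move: h1; rewrite kk => /addIr.
case: (scale_eq_pm V _ _ E); rewrite ?N0 //; first by move/inj; left.
have -> : - multiplier a x m' k' = multiplier a x (- m') (- k') by rewrite /multiplier qintN; congr qint; ring.
by move/inj; right.
Qed.

Lemma ideal_equiv_refl I : ideal_equiv O I I.
Proof. by exists 1, 1; split; rewrite ?oner_eq0 //; exact: (ring_of_integers_int 1). Qed.

Lemma ideal_equiv_sym I J : ideal_equiv O I J -> ideal_equiv O J I.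
Proof. by move=> [a [b [Oa Ob a0 b0 E]]]; exists b, a. Qed.

Lemma ideal_equiv_trans I J L : ideal_equiv O I J -> ideal_equiv O J L -> ideal_equiv O I L.
Proof.
move=> [a [b [Oa Ob a0 b0 E]]] [c [d [Oc Od c0 d0 E']]].
exists (c * a), (b * d); split; rewrite ?mulf_neq0 //; try exact: ring_of_integersM.
have E1 : scale a I = scale b J := E; have E2 : scale c J = scale d L := E'.
by change (scale (c * a) I = scale (b * d) L); rewrite -!scaleM E1 -E2 !scaleM mulrC.
Qed.

Lemma lattice_equiv_primitive d a x : (0 < d)%N -> ideal_equiv O (lattice d a x) (lattice 1 a x).
Proof.
move=> d0; exists 1, d%:R; split.
- exact: (ring_of_integers_int 1).
- by rewrite pmulrn; exact: ring_of_integers_int.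
- exact: oner_neq0.
- by rewrite pnatr_eq0 -lt0n.
by rewrite -/(scale 1 _) -/(scale d%:R _) scale1 scale_lattice muln1.
Qed.

(** Multiplication by the conjugate of x + omega takes a Z + (x + omega) Z to a times
    c Z + (- x - 1 + omega) Z, where a c is the norm of x + omega. *)
Lemma lattice_conj (a c : nat) x : (0 < a)%N -> a%:Z * c%:Z = qnorm x 1 ->
  ideal_equiv O (lattice 1 a x) (lattice 1 c (- x - 1)).
Proof.
move=> a0 E; exists (qint (x + 1) (-1)), a%:R; split.
- by apply/ring_of_integersP; eexists; eexists.
- by rewrite pmulrn; exact: ring_of_integers_int.
- by apply/eqP => /qint_eq0 [].
- by rewrite pnatr_eq0 -lt0n.
rewrite pmulrn; apply/seteqP; split => _ [_ [m [k ->]] <-].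
- rewrite qintM; exists (qint (1 * (c%:Z * (k) + (- x - 1) * (- m))) (1 * (- m))); first by exists k, (- m).
  rewrite intr_mul_qint; congr qint; last by ring.
  transitivity (a%:Z * c%:Z * k + a%:Z * m * (x + 1)); first by ring.
  by rewrite E /qnorm; ring.
- rewrite intr_mul_qint; exists (qint (1 * (a%:Z * (- k) + x * m)) (1 * m)); first by exists (- k), m.
  rewrite qintM; congr qint; last by ring.
  transitivity (a%:Z * c%:Z * m - a%:Z * k * (x + 1)); last by ring.
  by rewrite E /qnorm; ring.
Qed.

(** With |2 x + 1| <= a the cofactor c of [lattice_conj] is at most (a + p / a) / 4,
    which is less than a when a > p. *)
Lemma reduction_step (a x : nat) : admissible a x -> (x < a)%N -> (p < a)%N ->
  exists a' x' : nat, [/\ admissible a' x', (x' < a')%N, (a' < a)%N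
     & ideal_equiv O (lattice 1 a x%:Z) (lattice 1 a' x'%:Z)].
Proof.
move=> V xa pa; have [a0 ax] := V.
(* y is x or its reflection a - 1 - x, whichever satisfies 2 y + 1 <= a, and X the
   corresponding representative of x modulo a *)
have [y [X [yE LX NX]]] : exists (y : nat) (X : int),
    [/\ (2 * y + 1 <= a)%N, lattice 1 a x%:Z = lattice 1 a X & qnorm X 1 = (nf y)%:Z].
  have [le|gt] := leqP (2 * x + 1) a; first by exists x, x%:Z; rewrite qnorm_shift.
  exists (a - 1 - x)%N, (x%:Z - a%:Z); split; first by lia.
    rewrite [in RHS]lattice_mod // [in LHS]lattice_mod //; congr lattice.
    by rewrite -[x%:Z - _](_ : - 1 * a%:Z + x%:Z = _) ?modzMDl //; ring.
  rewrite -qnorm_shift (_ : (a - 1 - x)%N%:Z = a%:Z - 1 - x%:Z) /qnorm; last by lia.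
  by ring.
have /dvdnP [c Hc] : (a %| nf y)%N.
  have : (a%:Z %| qnorm X 1)%Z.
    have [_ _ _ IM] := admissible_ideal (isT : 0 < 1)%N V.
    have := IM (qint (X + 1) (-1)) (qint (1 * X) 1) (proj2 (ring_of_integersP _) _).
    rewrite LX => /(_ (ex_intro _ _ (ex_intro _ _ erefl)) (lattice_memX _ _ _)).
    rewrite qintM => -[m [k /qint_inj [h1 h2]]].
    apply/dvdzP; exists m; have k0 : k = 0 by move: h2; clear; lia.
    by move: h1; rewrite k0 /qnorm; clear; lia.
  by rewrite NX.
have ca : (c < a)%N.
  have D := nf_disc y; rewrite Hc in D.
  have : ((2 * y + 1) ^ 2 <= a ^ 2)%N by rewrite leq_sqr.
  move: D pa a0; set t := ((2 * y + 1) ^ 2)%N; rewrite -mulnn; clear; nia.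
have c1 : (0 < c)%N.
  move: Hc; rewrite /norm_shift; case: (c) => //; move: c0E; clear; lia.
have E : a%:Z * c%:Z = qnorm X 1 by rewrite NX Hc PoszM mulrC.
have [|x' [V' x'c L']] := @admissible_mod c (- X - 1) c1.
  apply/dvdzP; exists a%:Z; rewrite E /qnorm; ring.
exists c, x'; split => //; rewrite -L' LX; exact: lattice_conj.
Qed.

(** So finitely many lattices represent all ideal classes. *)
Lemma reduced_rep I : nonzero_ideal O I ->
  exists a x : nat, [/\ admissible a x, (x < a)%N, (a <= p)%N & ideal_equiv O I (lattice 1 a x%:Z)].
Proof.
move=> HI; have [d [a [x [d0 V xa ->]]]] := ideal_normal_form HI.
have [a' [x' [V' xa' ap' E]]] : exists a' x' : nat, [/\ admissible a' x', (x' < a')%N, (a' <= p)%N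
    & ideal_equiv O (lattice 1 a x%:Z) (lattice 1 a' x'%:Z)].
  elim/ltn_ind: a x V xa => a IH x V xa.
  have [le|gt] := leqP a p; first by exists a, x; split => //; exact: ideal_equiv_refl.
  have [a1 [x1 [V1 xa1 a1a E1]]] := reduction_step V xa gt.
  have [a2 [x2 [V2 xa2 a2p E2]]] := IH _ a1a _ V1 xa1.
  by exists a2, x2; split => //; apply: ideal_equiv_trans E1 E2.
exists a', x'; split => //; apply: ideal_equiv_trans E; exact: lattice_equiv_primitive.
Qed.

(** * The class number as a character sum *)

Lemma big_divisors (P : pred nat) (F : nat -> int) m : (0 < m)%N ->
  \sum_(d <- divisors m | P d) F d = \sum_(d < m.+1 | [&& (0 < d)%N, (d %| m)%N & P d]) F d.
Proof.
move=> m0; rewrite -(big_mkord (fun d => [&& (0 < d)%N, (d %| m)%N & P d])).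
rewrite -[LHS]big_filter -[RHS]big_filter.
have H : perm_eq [seq d <- divisors m | P d]
    [seq d <- index_iota 0 m.+1 | [&& (0 < d)%N, (d %| m)%N & P d]]; last by rewrite (perm_big _ H).
apply: uniq_perm.
- by rewrite filter_uniq ?divisors_uniq.
- by rewrite filter_uniq ?iota_uniq.
move=> d; rewrite !mem_filter -dvdn_divisors // mem_index_iota ltnS /=.
case: (P d); rewrite ?andbT ?andbF //=; case: (boolP (d %| m)%N) => dm; rewrite ?andbF //=.
by rewrite (dvdn_gt0 m0 dm) dvdn_leq.
Qed.

(** The pairs (d, x) for which d ((n / d^2) Z + (x + omega) Z) is an ideal of norm n in
    normal form. *)
Definition ideals (n : nat) : pred ('I_n.+1 * 'I_n.+1) := fun t =>
  [&& (0 < t.1)%N, (t.1 ^ 2 %| n)%N, (t.2 < n %/ t.1 ^ 2)%N & (n %/ t.1 ^ 2 %| nf t.2)%N].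

Definition ideal_of (n : nat) (t : 'I_n.+1 * 'I_n.+1) := lattice t.1 (n %/ t.1 ^ 2) (t.2 : nat)%:Z.

Lemma card_ideals n : (0 < n)%N -> #|@ideals n|%:Z = ideal_count p n.
Proof.
move=> n0; rewrite /ideal_count big_divisors //.
have -> : #|@ideals n| = (\sum_(d < n.+1) \sum_(x < n.+1 | @ideals n (d, x)) 1)%N.
  by rewrite pair_big_dep /= -sum1_card; apply: eq_bigl => -[].
rewrite -natz natr_sum [RHS]big_mkcond /=; apply: eq_bigr => d _.
rewrite sum1_card /ideals /=; case: ifP => [/and3P [d0 dn d2n]|H]; last first.
  rewrite (eq_card0 (A := _)) // => x; rewrite !inE; apply/negbTE/negP => /and4P [d0 d2n xt _].
  by move: H; rewrite d0 d2n andbT (dvdn_trans _ d2n) // dvdn_exp.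
rewrite d0 d2n /= /nroots natz; congr Posz.
set a := (n %/ d ^ 2)%N.
have an : (a <= n.+1)%N by rewrite leqW // leq_div.
rewrite -!sum1_card (big_ord_widen_cond _ (fun x => (a %| nf x)%N) (fun=> 1%N) an).
by apply: eq_bigl => x; rewrite unfold_in andbC.
Qed.

Definition box_vec B (u : 'I_(2 * B).+1 * 'I_(2 * B).+1) : int * int := (u.1%:Z - B%:Z, u.2%:Z - B%:Z).

Lemma box_vec_inj B : injective (@box_vec B).
Proof.
move=> [i j] [i' j'] /= [h1 h2]; congr (_, _); apply/val_inj => /=.
  by move: h1; clear; lia.
by move: h2; clear; lia.
Qed.

Lemma box_vec_surj B (m k : int) : m ^+ 2 <= B%:Z -> k ^+ 2 <= B%:Z -> exists u, @box_vec B u = (m, k).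
Proof.
have b (z : int) : z ^+ 2 <= B%:Z -> exists i : 'I_(2 * B).+1, i%:Z - B%:Z = z.
  move=> zB; have zb : - B%:Z <= z <= B%:Z by move: zB; rewrite expr2; clear; nia.
  have h : (absz (z + B%:Z)%R < (2 * B).+1)%N by move: zb; clear; lia.
  by exists (Ordinal h) => /=; move: zb; clear; lia.
by move=> /b [i hi] /b [j hj]; exists (i, j); rewrite /box_vec /= hi hj.
Qed.

Lemma card_nat_sum (T : finType) (P b : pred T) :
  (\sum_(t | P t) b t)%N = #|[pred t | P t && b t]|.
Proof.
rewrite -sum1_card big_mkcond [RHS]big_mkcond /=; apply: eq_bigr => t _; rewrite inE.
by case: (P t); case: (b t).
Qed.

(** Each ideal of norm n in the class of J comes from exactly two vectors of value n,
    (m, k) and its opposite, and every such vector gives one ideal. Summing over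
    vectors first or over ideals first gives the equality. *)
Lemma reps_form a x n B : admissible a x -> (0 < n)%N -> (4 * (a + nf x %/ a) * n <= B)%N ->
  reps (a, (2 * x + 1)%:Z, nf x %/ a)%N B n =
  (\sum_(t | @ideals n t) 2 * `[< ideal_equiv O (ideal_of t) (lattice 1 a x%:Z) >])%N.
Proof.
move=> V n0 nB.
pose rl (u : 'I_(2 * B).+1 * 'I_(2 * B).+1) (t : 'I_n.+1 * 'I_n.+1) : bool :=
  `[< related a x (box_vec u).1 (box_vec u).2 t.1 (n %/ t.1 ^ 2) t.2 >].
have tV t : @ideals n t -> [/\ (0 < t.1)%N, admissible (n %/ t.1 ^ 2) t.2, (t.2 < n %/ t.1 ^ 2)%N
    & (t.1 ^ 2 * (n %/ t.1 ^ 2) = n)%N].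
  move=> /and4P [t0 tn xt tx]; split => //; last by rewrite mulnC divnK.
  by split => //; apply: leq_ltn_trans xt.
have rlQ u t : @ideals n t -> rl u t -> norm_form a x (box_vec u).1 (box_vec u).2 = n.
  by move=> /tV [t0 Vt _ tn] /asboolP /(related_norm V Vt) <-.
transitivity (\sum_u \sum_(t | @ideals n t) rl u t)%N.
  rewrite /reps pair_bigA /=; apply: eq_bigr => u _.
  rewrite card_nat_sum; rewrite -[qform _ _ _ _ _]/(norm_form a x (box_vec u).1 (box_vec u).2).
  case: (eqVneq (norm_form a x (box_vec u).1 (box_vec u).2) n) => [E|NE]; last first.
    apply/esym/eqP/pred0P => t /=; apply/negbTE/negP => /andP [It Rt].
    by move: NE; rewrite (rlQ _ _ It Rt) eqxx.
  have [|d [a' [x' [d0 V' xa R]]]] := @related_ex a x (box_vec u).1 (box_vec u).2 V; first by rewrite E.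
  have N := related_norm V V' R; rewrite E in N; have [a0' ax'] := V'.
  have d2 : (0 < d ^ 2)%N by rewrite expn_gt0 d0.
  have a'E : (n %/ d ^ 2 = a')%N by rewrite -N mulKn.
  have dn : (d < n.+1)%N by rewrite ltnS -N; move: d0 a0'; rewrite -mulnn; clear; nia.
  have xn : (x' < n.+1)%N by rewrite ltnS -N; move: d2 a0' xa; clear; nia.
  change (1%N = #|[pred t | @ideals n t && rl u t]|).
  rewrite -(card1 (Ordinal dn, Ordinal xn)); apply/esym; apply: eq_card => t; rewrite !inE.
  apply/andP/eqP => [[It /asboolP Rt]|->]; last first.
    split; first by rewrite /ideals /= a'E d0 xa ax' -N dvdn_mulr.
    by apply/asboolP; rewrite /= a'E.
  have [t0 [_ Vt] xt tn] := tV _ It; have a0 := proj1 V.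
  have [|||||E1 E2 E3] := @lattice_inj (a * t.1) (n %/ t.1 ^ 2) t.2 (a * d) a' x'.
  - by rewrite muln_gt0 a0.
  - by rewrite muln_gt0 a0.
  - by [].
  - by [].
  - by rewrite [LHS]Rt [RHS]R.
  move/eqP: E1; rewrite eqn_pmul2l // => /eqP E1.
  by case: t {It Rt t0 Vt xt tn E2} E1 E3 => t1 t2 /= E1 E3; congr (_, _); apply: val_inj.
rewrite exchange_big /=; apply: eq_bigr => t It; have [t0 Vt xt tn] := tV _ It.
rewrite card_nat_sum; case: asboolP => [eq|neq]; last first.
  apply/eqP/pred0P => u /=; apply/negbTE/negP => Ru; have /asboolP R := Ru.
  by apply: neq; apply: (related_equiv V _ R); rewrite (rlQ _ _ It Ru).
have [m [k R]] := related_of_equiv V Vt t0 eq.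
have Qn : norm_form a x m k = n by rewrite -(related_norm V Vt R).
have P := posdef_norm_form V.
have mB : m ^+ 2 <= B%:Z.
  apply: le_trans (qform_gem m k P) _; rewrite -/(norm_form a x m k) Qn -!PoszM lez_nat.
  by apply: leq_trans nB; rewrite leq_mul2r leq_mul2l leq_addl !orbT.
have kB : k ^+ 2 <= B%:Z.
  apply: le_trans (qform_gek m k P) _; rewrite -/(norm_form a x m k) Qn -!PoszM lez_nat.
  by apply: leq_trans nB; rewrite leq_mul2r leq_mul2l leq_addr !orbT.
have [u1 U1] := box_vec_surj mB kB.
have [u2 U2] : exists u2, @box_vec B u2 = (- m, - k) by apply: box_vec_surj; rewrite sqrrN.
have u12 : u1 != u2.
  apply/eqP => u12; move: U2; rewrite -u12 U1 => -[m0 k0].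
  have m00 : m = 0 by move: m0; clear; lia.
  have k00 : k = 0 by move: k0; clear; lia.
  by move: n0; rewrite -Qn m00 k00 /norm_form /qform !(mulr0, addr0).
rewrite muln1; transitivity #|[set u1; u2]%SET|; last by rewrite cards2 u12.
apply: eq_card => u; rewrite !inE; apply/asboolP/orP => [Ru|[/eqP ->|/eqP ->]]; last 2 first.
- by rewrite U1.
- by rewrite U2; apply: related_opp.
have Qu : norm_form a x (box_vec u).1 (box_vec u).2 = n by apply: rlQ It _; apply/asboolP.
have [||H|H] := related_pm V _ _ Ru R; rewrite ?Qu ?Qn //.
- by left; apply/eqP/box_vec_inj; rewrite U1 -H; case: (box_vec u).
- by right; apply/eqP/box_vec_inj; rewrite U2 -H; case: (box_vec u).
Qed.

Lemma ideal_class_eq I J : ideal_equiv O I J -> ideal_class O I = ideal_class O J.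
Proof.
move=> E; apply/seteqP; split => L [HL EL]; split => //.
  exact: ideal_equiv_trans (ideal_equiv_sym E) EL.
exact: ideal_equiv_trans E EL.
Qed.

Lemma ideal_class_inj I J : nonzero_ideal O J -> ideal_class O I = ideal_class O J -> ideal_equiv O I J.
Proof.
move=> HJ E; have : ideal_class O J J by split => //; exact: ideal_equiv_refl.
by rewrite -E => -[].
Qed.

Lemma class_rep c : ideal_classes O c -> exists t : nat * nat,
  [/\ admissible t.1 t.2, (t.2 < t.1)%N, (t.1 <= p)%N & c = ideal_class O (lattice 1 t.1 t.2%:Z)].
Proof.
move=> [I HI <-]; have [a [x [V xa ap E]]] := reduced_rep HI.
by exists (a, x); split => //; exact: ideal_class_eq.
Qed.

Lemma ideal_classes_finite : finite_set (ideal_classes O).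
Proof.
apply: (@sub_finite_set _ _ [set ideal_class O (lattice 1 t.1 (t.2 : nat)%:Z) | t in [set: 'I_p.+1 * 'I_p.+1]]).
  move=> c /class_rep [[a x] /= [V xa ap ->]].
  have xp : (x < p.+1)%N by rewrite ltnS (leq_trans (ltnW xa)).
  by exists (Ordinal (ap : (a < p.+1)%N), Ordinal xp).
by apply: finite_image; exact: finite_finset.
Qed.

Notation X d := (chi (d%:R : 'F_p)).

(** Every ideal lies in exactly one class, so the representation numbers of the norm
    forms of all classes add up to twice the number of ideals of given norm, which is
    a divisor sum of chi. The theta identity then counts the forms. *)
Theorem class_number_sum :
  p%:Z * (class_number K)%:Z = \sum_(i < p) \sum_(j < i.+1) X j.+1.
Proof.
have /choice [rp rpP] : forall c, exists t : nat * nat, ideal_classes O c ->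
    [/\ admissible t.1 t.2, (t.2 < t.1)%N, (t.1 <= p)%N & c = ideal_class O (lattice 1 t.1 t.2%:Z)].
  move=> c; case: (pselect (ideal_classes O c)) => [Hc|nHc]; last by exists (0, 0)%N.
  by have [t Ht] := class_rep Hc; exists t.
pose cs := enum_fset (fset_set (ideal_classes O)).
have csP c : c \in cs -> ideal_classes O c.
  by move=> Hc; apply/set_mem; rewrite -in_fset_set //; exact: ideal_classes_finite.
have cs_mem c : ideal_classes O c -> c \in cs.
  move=> /mem_set; rewrite -in_fset_set //; exact: ideal_classes_finite.
(* the norm form of the chosen lattice of each class *)
pose form (c : set (set algC)) := ((rp c).1, (2 * (rp c).2 + 1)%N%:Z, nf (rp c).2 %/ (rp c).1)%N.
have -> : class_number K = size (map form cs) by rewrite size_map.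
apply: (@constant_term p (fun d => X d)).
- exact: prime_gt0.
- by move=> i; rewrite natrD pchar_Fp_0 ?addr0 // prime_gt1.
- by move=> i; have [h1 h2 _] := chi_range (i%:R : 'F_p); rewrite ler_norml h1 h2.
- have := sum_chi_shift p_pr p_gt3 pE p2_odd 1; rewrite (sum_Fp p_pr); apply: etrans; apply: eq_bigr => i _.
  by rewrite -natr1.
- by move=> _ /mapP [c /csP /rpP [V _ _ _] ->]; exact: posdef_norm_form.
move=> n B n0 HB; rewrite big_map.
have E c : c \in cs -> reps (form c) B n = (\sum_(t | @ideals n t) 2 * (c == ideal_class O (ideal_of t)))%N.
  move=> Hc; have [V _ _ cE] := rpP _ (csP _ Hc).
  rewrite reps_form //; last by apply: (HB (form c)); apply: map_f.
  apply: eq_bigr => t /and4P [t0 tn xt tx]; congr (_ * nat_of_bool _)%N.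
  have It : nonzero_ideal O (ideal_of t).
    apply: admissible_ideal => //; split => //; exact: leq_ltn_trans xt.
  apply/asboolP/eqP => [/ideal_class_eq ->|H]; first exact: cE.
  apply: ideal_class_inj; first exact: admissible_ideal.
  by rewrite -H -cE.
rewrite (eq_big_seq _ E) exchange_big /=.
have -> : (\sum_(t | @ideals n t) \sum_(c <- cs) 2 * (c == ideal_class O (ideal_of t)) = 2 * #|@ideals n|)%N.
  rewrite mulnC -sum_nat_const; apply: eq_bigr => t /and4P [t0 tn xt tx].
  have Hc : ideal_class O (ideal_of t) \in cs.
    apply: cs_mem; exists (ideal_of t) => //; apply: admissible_ideal => //.
    by split => //; exact: leq_ltn_trans xt.
  have S1 : (\sum_(c <- cs) (c == ideal_class O (ideal_of t)) = 1)%N.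
    transitivity (count_mem (ideal_class O (ideal_of t)) cs).
      by rewrite -sum1_count [RHS]big_mkcond; apply: eq_bigr => c _ /=; case: eqP.
    by rewrite count_uniq_mem ?fset_uniq // Hc.
  by rewrite -big_distrr /= S1 muln1.
rewrite natz PoszM card_ideals // (ideal_countE p_pr p_gt3 pE p2_odd) //; congr (_ * _).
rewrite /chi_count big_divisors // big_mkcond big_ord_recl /= add0r [RHS]big_mkcond /=.
by apply: eq_bigr => d _; rewrite andbT.
Qed.

End Ideals.

(** * The determinants *)

Theorem corollary1p1 (p : nat) (p_prime : prime p) (p_gt3 : (3 < p)%N)
    (p_mod4 : (p %% 4 = 3)%N) (R : comNzRingType) (x y w : R) :
  let n := ((p - 1) %/ 2)%N in
  let leg (a : int) : R := (legendre a p)%:~R in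
  let h := class_number (quadratic_field (- p%:Z)) in
  let c : R := ((2 - legendre 2 p) * h%:Z)%:~R in
  \det (\matrix_(j < n, k < n)
          (x + leg (j.+1%:Z + k.+1%:Z) + leg (j.+1%:Z - k.+1%:Z)
             + leg j.+1%:Z * y))
    = (-1) ^+ ((h - 1) %/ 2) * p%:R ^+ ((p - 3) %/ 4)
        * (1 - c * x - n%:R * y)
  /\
  \det (\matrix_(j < n, k < n)
          (leg (j.+1%:Z + k.+1%:Z) + leg (j.+1%:Z - k.+1%:Z)
             + leg j.+1%:Z * y + leg (j.+1%:Z * k.+1%:Z) * w))
    = (-1) ^+ ((h - 1) %/ 2) * p%:R ^+ ((p - 3) %/ 4)
        * (1 - c * w - n%:R * y).
Proof.
move=> n leg h c.
have pE : p = (2 * n).+1 by rewrite /n; move: p_mod4; lia.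
have n_odd : odd n by move: p_mod4; rewrite pE; clear; lia.
have legE (a : int) : leg a = (chi (a%:~R : 'F_p))%:~R by rewrite /leg legendreE.
have hE : (2 - chi (2%:R : 'F_p)) * h%:Z = half_sum p n.
  have := double_half_sum p_prime p_gt3 pE n_odd.
  rewrite -(class_number_sum p_prime p_gt3 p_mod4) mulrCA => /mulfI; apply.
  by move: p_gt3; clear; lia.
have cE : c = (half_sum p n)%:~R by rewrite /c -hE legendreE.
have dE : (\det (sd_mx p n))%:~R = (-1) ^+ ((h - 1) %/ 2) * p%:R ^+ ((p - 3) %/ 4) :> R.
  by rewrite (det_sd_mx p_prime p_gt3 pE n_odd hE) rmorphM !rmorphXn rmorphN1.
have e1 (a b : int) : (a + b)%:~R = a%:~R + b%:~R :> 'F_p by rewrite rmorphD.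
split.
  rewrite cE -dE -(det_affine_x p_prime p_gt3 pE n_odd); congr (\det _).
  apply/matrixP => j k; rewrite !mxE !big_ord1 !mxE !legE.
  rewrite !(rmorphD, rmorphB) /=; ring.
rewrite cE -dE -(det_affine_w p_prime p_gt3 pE n_odd); congr (\det _).
apply/matrixP => j k; rewrite !mxE !big_ord1 !mxE !legE.
rewrite !(rmorphD, rmorphB, rmorphM) /= (chiM p_prime p_gt3 pE) rmorphM /=; ring.
Qed.
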